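(* Let $(A,\mathfrak m)$ be a Noetherian local ring with infinite residue field, $M$ a finitely generated $A$-module, $J$ an $\mathfrak m$-primary ideal of $A$, and $I_1,\ldots,I_d$ ($d\ge 1$) ideals of $A$ whose product $I=I_1\cdots I_d$ satisfies $I\nsubseteq\sqrt{\mathrm{Ann}\,M}$. Put $\overline M=M/(0_M:I^\infty)$. Let $\mathbf k=(k_1,\ldots,k_d)\in\mathbb N^d$ and $k_0\in\mathbb N$ be such that $k_0+|\mathbf k|=\dim\overline M-1$, where $|\mathbf k|=k_1+\cdots+k_d$. Let $\mathbf x$ be a joint reduction of $I_1,\ldots,I_d,J$ with respect to $M$ of the type $(\mathbf k,k_0+1)$, consisting of elements of $\mathfrak m$. Assume that $$\mathrm{ht}\Big(\frac{I+\mathrm{Ann}\,M}{\mathrm{Ann}\,M}\Big)>|\mathbf k|,$$ the height being taken in the ring $A/\mathrm{Ann}\,M$. Then $\mathbf x$ is a system of parameters for $M$ and $$e(J^{[k_0+1]},\mathbf I^{[\mathbf k]};M)=e(\mathbf x;M).$$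
   Context: Here $\mathbb N$ includes $0$, $\mathbf n=(n_1,\ldots,n_d)$, $\mathbf I=I_1,\ldots,I_d$, $\mathbb I^{\mathbf n}=I_1^{n_1}\cdots I_d^{n_d}$, $\mathbf n^{\mathbf k}=n_1^{k_1}\cdots n_d^{k_d}$, $\mathbf k!=k_1!\cdots k_d!$, and $0_M:I^\infty=\bigcup_{m\ge 0}(0_M:I^m)$. ''For all large $\mathbf n$'' means for all $\mathbf n$ whose coordinates are all sufficiently large. Mixed multiplicities. Since $I\nsubseteq\sqrt{\mathrm{Ann}\,M}$, $\overline M\ne 0$; put $q=\dim\overline M$. It is known that, for all large $n_0,\mathbf n$, the length $\ell_A\big(J^{n_0}\mathbb I^{\mathbf n}M/J^{n_0+1}\mathbb I^{\mathbf n}M\big)$ is given by a polynomial $P(n_0,\mathbf n)$ of total degree $q-1$. Write the terms of total degree $q-1$ of $P$ as $\sum_{k_0+|\mathbf k|=q-1}e(J^{[k_0+1]},\mathbf I^{[\mathbf k]};M)\dfrac{n_0^{k_0}\mathbf n^{\mathbf k}}{k_0!\,\mathbf k!}$. The number $e(J^{[k_0+1]},\mathbf I^{[\mathbf k]};M)$ is the mixed multiplicity of $M$ with respect to $J,\mathbf I$ of the type $(k_0+1,\mathbf k)$. Joint reductions. Let $\mathfrak a_1,\ldots,\mathfrak a_r$ be ideals of $A$ and $h_1,\ldots,h_r\ge 0$ integers. Let $\mathfrak I_i$ be a sequence of $h_i$ elements of $\mathfrak a_i$ for $1\le i\le r$; the ideal generated by the empty sequence is $0$. The sequence $\mathfrak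 I_1,\ldots,\mathfrak I_r$ is a joint reduction of $\mathfrak a_1,\ldots,\mathfrak a_r$ with respect to $M$ of the type $(h_1,\ldots,h_r)$ if for all large $n_1,\ldots,n_r$ $$\mathfrak a_1^{n_1}\cdots\mathfrak a_r^{n_r}M=\sum_{i=1}^r(\mathfrak I_i)\,\mathfrak a_1^{n_1}\cdots\mathfrak a_i^{n_i-1}\cdots\mathfrak a_r^{n_r}M.$$ Type $(\mathbf k,k_0+1)$ for $I_1,\ldots,I_d,J$ means $k_i$ elements from $I_i$ for each $1\le i\le d$ and $k_0+1$ elements from $J$. Multiplicity. For a sequence $\mathbf y=y_1,\ldots,y_n$ of elements of $\mathfrak m$ with $\ell_A(M/(\mathbf y)M)<\infty$, the multiplicity symbol is defined by $e(\mathbf y;M)=\ell_A(M)$ if $n=0$ and $e(\mathbf y;M)=e(\mathbf y';M/y_1M)-e(\mathbf y';0_M:y_1)$ if $n>0$, where $\mathbf y'=y_2,\ldots,y_n$. When $\mathbf y$ is a system of parameters for $M$, $e(\mathbf y;M)$ equals the Hilbert-Samuel multiplicity of the ideal $(\mathbf y)$ with respect to $M$. *)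

(* Defs.v *)
From HB Require Import structures.
From mathcomp Require Export all_boot all_order all_algebra.
From mathcomp Require Export boolp classical_sets cardinality.
From mathcomp Require Export mpoly.

Set Implicit Arguments.
Unset Strict Implicit.
Unset Printing Implicit Defensive.

Import GRing.Theory.
Local Open Scope classical_set_scope.
Local Open Scope ring_scope.

(* Submodules are Prop-valued sets; ideals of A are submodules of A^o.
   A subquotient N/K of a module M is handled through the pair of submodules
   K `<=` N of M, and a quotient ring A/c through the ideal c of A: submodules
   of N/K are the submodules of M between K and N, and ideals of A/c are the
   ideals of A containing c. *)

Section Submodules.
Variables (A : comNzRingType) (M : lmodType A).
Implicit Types (I J c : set A) (N K : set M).

Definition submodule N : Prop :=
  N 0 /\ forall (a : A) (u v : M), N u -> N v -> N (a *: u + v).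

Definition span (S : set M) : set M := smallest submodule S.

Definition fin_gen N : Prop := exists s : seq M, N = span [set` s].

Definition addsm N K : set M := [set u + v | u in N & v in K].

Definition mulsm I N : set M := span [set a *: u | a in I & u in N].

(* Ann (M/K) *)
Definition ann K : set A := [set a | forall u : M, K (a *: u)].

Definition submod_chain K N n (L : nat -> set M) : Prop :=
  [/\ L 0%N = K, L n = N,
      forall i, (i <= n)%N -> submodule (L i)
    & forall i, (i < n)%N -> L i `<` L i.+1].

Definition chain_lengths K N : set nat :=
  [set n | exists L, submod_chain K N n L].

Definition has_length K N n : Prop :=
  chain_lengths K N n /\ ubound (chain_lengths K N) n.

Definition finite_length K N : Prop := exists n, has_length K N n.

(* The length of N/K, with junk value 0 when it is infinite. *)
Definition mlength K N : nat := xget 0%N [set n | has_length K N n].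

(* e(y; N/K).  For a sequence a :: y, the module (N/K)/a(N/K) is N/(K + aN),
   and the submodule of N/K killed by a is {u in N | a u in K}/K. *)
Fixpoint mult_symbol (y : seq A) K N : int :=
  if y is a :: y' then
    mult_symbol y' (addsm K [set a *: u | u in N]) N
    - mult_symbol y' K [set u | N u /\ K (a *: u)]
  else (mlength K N)%:Z.

End Submodules.

Section Ideals.
Variable A : comNzRingType.
Implicit Types (I J c m : set A).

Definition ideal I : Prop := submodule (I : set A^o).

Definition ideal_span (s : seq A) : set A := span ([set` s] : set A^o).

Definition noetherian : Prop :=
  forall I, ideal I -> fin_gen (I : set A^o).

Definition radical I : set A := [set a | exists n : nat, I (a ^+ n)].

Definition prime_ideal (p : set A) : Prop :=
  [/\ ideal p, ~ p 1 & forall a b, p (a * b) -> p a \/ p b].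

Definition maximal_ideal m : Prop :=
  [/\ ideal m, ~ m 1
    & forall I, ideal I -> m `<=` I -> I = m \/ I = [set: A]].

Definition local_ring m : Prop :=
  maximal_ideal m /\ forall m', maximal_ideal m' -> m' = m.

(* The set of cosets of m is the carrier of A/m. *)
Definition infinite_residue m : Prop :=
  infinite_set (range (fun a : A => [set b : A | m (b - a)])).

Definition primary_ideal I : Prop :=
  [/\ ideal I, ~ I 1 & forall a b, I (a * b) -> I a \/ radical I b].

Definition m_primary m J : Prop := primary_ideal J /\ radical J = m.

Definition mulid I J : set A := mulsm I (J : set A^o).

Definition expid I n : set A := iter n (mulid I) [set: A].

(* a_1^(n_1) ... a_r^(n_r) *)
Definition prodid (r : nat) (a : 'I_r -> set A) (n : 'I_r -> nat) : set A :=
  \big[mulid/[set: A]]_(i < r) expid (a i) (n i).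

(* Strict chains p_0 < ... < p_n of primes of A/c. *)
Definition prime_chain c n (p : nat -> set A) : Prop :=
  (forall i, (i <= n)%N -> prime_ideal (p i) /\ c `<=` p i) /\
  (forall i, (i < n)%N -> p i `<` p i.+1).

Definition prime_chain_lengths c : set nat :=
  [set n | exists p, prime_chain c n p].

(* dim (A/c) = n *)
Definition krull_dim c n : Prop :=
  prime_chain_lengths c n /\ ubound (prime_chain_lengths c) n.

(* ht (b/c) > n in the ring A/c, for an ideal b containing c.  The height is the
   infimum, over the primes P containing b, of the supremum of the lengths of
   chains of primes ending at P; it is infinite when b is the unit ideal. *)
Definition height_gt c b n : Prop :=
  forall P, prime_ideal P -> b `<=` P ->
    exists2 l, (n < l)%N & exists2 p, prime_chain c l p & p l = P.

End Ideals.

Definition fcons T d (t : T) (f : 'I_d -> T) (i : 'I_d.+1) : T :=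
  if unlift ord0 i is Some j then f j else t.

Definition frcons T d (f : 'I_d -> T) (t : T) (i : 'I_d.+1) : T :=
  if unlift ord_max i is Some j then f j else t.

Section Multiplicities.
Variables (A : comNzRingType) (M : lmodType A).

(* 0_M : I^oo *)
Definition ann_infty (I : set A) : set M :=
  [set u | exists n, forall a, expid I n a -> a *: u = 0].

(* dim (M/K) = n *)
Definition module_dim (K : set M) n : Prop := krull_dim (ann K) n.

Definition system_of_parameters (m : set A) (x : seq A) : Prop :=
  [/\ {in x, forall a, m a},
      module_dim [set 0] (size x)
    & finite_length (mulsm (ideal_span x) [set: M]) [set: M]].

Definition joint_reduction r (a : 'I_r -> set A) (h : 'I_r -> nat)
    (x : 'I_r -> seq A) : Prop :=
  [/\ forall i, size (x i) = h i,
      forall i, {in x i, forall b, a i b}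
    & exists n0, forall n : 'I_r -> nat, (forall i, (n0 <= n i)%N) ->
        mulsm (prodid a n) [set: M] =
        \big[@addsm A M/[set 0]]_(i < r)
          mulsm (ideal_span (x i))
            (mulsm (prodid a (fun j => n j - (j == i))%N) [set: M])].

Section Mixed.
Variables (d : nat) (J : set A) (I : 'I_d -> set A).

Definition filtration n0 (n : 'I_d -> nat) : set M :=
  mulsm (mulid (expid J n0) (prodid I n)) [set: M].

(* The variable of index 0 stands for n_0, the following ones for n_1, ... *)
Definition is_hilbert_poly (P : {mpoly rat[d.+1]}) : Prop :=
  exists N, forall n0 n, (N <= n0)%N -> (forall i, (N <= n i)%N) ->
    (mlength (filtration n0.+1 n) (filtration n0 n))%:R
      = P.@[fcons n0%:R (fun i => (n i)%:R)].

(* Such a polynomial is unique; the junk value is 0 if there is none. *)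
Definition hilbert_poly : {mpoly rat[d.+1]} := xget 0 is_hilbert_poly.

(* e(J^[k_0 + 1], I^[k]; M), meaningful when k_0 + |k| + 1 = dim M/(0_M : I^oo) *)
Definition mixed_mult (k0 : nat) (k : 'I_d -> nat) : rat :=
  (k0`! * \prod_(i < d) (k i)`!)%:R
    * hilbert_poly@_[multinom fcons k0 k i | i < d.+1].

End Mixed.
End Multiplicities.
Arguments ann_infty {A} M I.

(* Main.v *)
(** The proof compares the Koszul-type symbol of [x] on [M] with symbols of multigraded
    modules.  For a family [(N_g / K_g)] of subquotients of [M] on which the elements of
    [x] act with degrees, [gsym] is the multiplicity symbol with kernels and cokernels
    formed degreewise; it is additive by the snake lemma, provided that, modulo [(x)],
    an ideal contained in no prime other than [m] kills everything.  Put
    [F_g = J^(n_0) I^n M] and [F'_g = I^n M] for [g = (n, n_0)].  Then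
      [e(x; M) = gsym(F) + gsym(F'/F) + gsym(M/F')].
    - [gsym(M/F') = 0], because by the height hypothesis [dim M/F'_g <= k_0], which is less
      than the number [k_0 + 1] of elements of [x] taken from [J].
    - [gsym(F)] vanishes for large [g]: the joint reduction says that [F / x F] does, and
      the determinant trick with Artin-Rees transfers this to all kernels and cokernels.
    - [F'/F] has finite length in each degree, so its symbol is an iterated difference of
      [l(F'_g / F_g)], that is, the [(k_0, k)]-th difference of the Hilbert function of
      [F_g / J F_g].
    Thus this difference of the Hilbert polynomial [P] is the constant [e(x; M)], and the
    coefficient of [n_0^(k_0) n^k] in [P] can be read off without knowing the degree of [P].
    Localization is avoided throughout by multipliers outside a prime. *)

Require Import Defs.
From HB Require Import structures.
From mathcomp Require Import ring zify.

Set Implicit Arguments.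
Unset Strict Implicit.
Unset Printing Implicit Defensive.

Import GRing.Theory.
Local Open Scope classical_set_scope.
Local Open Scope ring_scope.

(** * Submodules and ideals *)

(** All families are kept inside the one module M, so that the constant family M, whose symbol is
    the ungraded e(x; M), can be compared with F by additivity. The price is that degrees are
    lowered by truncated subtraction and that families must decrease with the degree. Infinite
    lengths count as 0, so additivity depends on finiteness, which the ideal (x) + Ann M provides.
    The height hypothesis therefore serves twice: to show that m is the only prime above this ideal,
    and for the symbol of M/F'. F' does not depend on the exponent of J. Hence one difference in
    that direction turns l(F'/F) into the length of J^(n_0 - 1) I^n M / J^(n_0) I^n M: one of the
    k_0 + 1 elements from J is spent on this, and k_0 differences of the Hilbert function remain.
    The difference is constant in all large degrees, not merely known in one; this is what disposes
    of the unknown degree of P, since further differences vanish and P has no coefficient whose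
    exponent properly dominates (k_0, k). *)

Section SubmoduleTheory.
Context {A : comNzRingType} {M : lmodType A}.
Implicit Types (N K L : set M) (I : set A).

Lemma submodule0 N : submodule N -> N 0. Proof. by case. Qed.

Lemma submoduleZ N a u : submodule N -> N u -> N (a *: u).
Proof. by case=> N0 NP Nu; rewrite -[_ *: _]addr0; apply: NP. Qed.

Lemma submoduleD N u v : submodule N -> N u -> N v -> N (u + v).
Proof. by case=> N0 NP Nu Nv; rewrite -[u]scale1r; apply: NP. Qed.

Lemma submoduleN N u : submodule N -> N u -> N (- u).
Proof. by move=> sN Nu; rewrite -scaleN1r; apply: submoduleZ. Qed.

Lemma submoduleB N u v : submodule N -> N u -> N v -> N (u - v).
Proof. by move=> sN Nu Nv; apply: submoduleD => //; apply: submoduleN. Qed.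

Lemma submoduleI N K : submodule N -> submodule K -> submodule (N `&` K).
Proof.
move=> sN sK; split; first by split; apply: submodule0.
by move=> a u v [Nu Ku] [Nv Kv]; split; [apply sN|apply sK].
Qed.

Lemma submoduleT : submodule [set: M]. Proof. by split. Qed.

Lemma submodule_set0 : submodule [set (0 : M)].
Proof. by split=> // a u v /= -> ->; rewrite scaler0 addr0. Qed.

Lemma addsmE N K u : addsm N K u <-> exists2 v, K v & N (u - v).
Proof.
split=> [[v Nv [w Kw <-]]|[v Kv Nuv]]; first by exists w => //; rewrite addrK.
by exists (u - v) => //; exists v => //; rewrite subrK.
Qed.

Lemma submodule_addsm N K : submodule N -> submodule K -> submodule (addsm N K).
Proof.
move=> sN sK; split.
  by exists 0; [exact: submodule0|exists 0; [exact: submodule0|rewrite addr0]].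
move=> a u v [u1 Nu1 [u2 Ku2 <-]] [v1 Nv1 [v2 Kv2 <-]].
exists (a *: u1 + v1); first by apply sN.
by exists (a *: u2 + v2); [apply sK|rewrite scalerDr addrACA].
Qed.

Lemma addsm_subl N K : submodule K -> N `<=` addsm N K.
Proof. by move=> sK u Nu; apply/addsmE; exists 0; rewrite ?subr0//; exact: submodule0. Qed.

Lemma addsm_subr N K : submodule N -> K `<=` addsm N K.
Proof. by move=> sN u Ku; apply/addsmE; exists u; rewrite ?subrr//; exact: submodule0. Qed.

Lemma addsm_min N K L : submodule L -> N `<=` L -> K `<=` L -> addsm N K `<=` L.
Proof. by move=> sL NL KL u [v /NL Lv [w /KL Lw <-]]; apply: submoduleD. Qed.

Lemma addsm_mono N N' K K' : N `<=` N' -> K `<=` K' -> addsm N K `<=` addsm N' K'.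
Proof. by move=> NN' KK' u [v /NN' Nv [w /KK' Kw <-]]; exists v => //; exists w. Qed.

Lemma submodule_scale N a : submodule N -> submodule [set a *: u | u in N].
Proof.
move=> sN; split; first by exists 0; rewrite ?scaler0//; exact: submodule0.
move=> b _ _ [u Nu <-] [v Nv <-]; exists (b *: u + v); first by apply sN.
by rewrite scalerDr !scalerA mulrC.
Qed.

Lemma submodule_pre N a : submodule N -> submodule [set u | N (a *: u)].
Proof.
move=> sN; split => /= [|b u v Nu Nv]; first by rewrite scaler0; exact: submodule0.
by rewrite scalerDr scalerA mulrC -scalerA; apply sN.
Qed.

Lemma submodule_span (S : set M) : submodule (span S).
Proof.
split=> [N [[]]//|a u v Su Sv N [sN SN]].
by case: (sN) => _; apply; [apply: Su|apply: Sv].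
Qed.

Lemma span_sub (S : set M) : S `<=` span S. Proof. exact: sub_gen_smallest. Qed.

Lemma span_in (S : set M) u : S u -> span S u. Proof. exact: span_sub. Qed.

Lemma span_min (S N : set M) : submodule N -> S `<=` N -> span S `<=` N.
Proof. exact: smallest_sub. Qed.

Opaque span.

Lemma span_nil u : span [set` ([::] : seq M)] u <-> u = 0.
Proof.
split=> [|->]; last by apply: submodule0; exact: submodule_span.
suff H : span [set` ([::] : seq M)] `<=` [set 0] by move=> /H.
by apply: span_min; first exact: submodule_set0.
Qed.

Lemma span_cons v (s : seq M) u :
  span [set` v :: s] u <-> exists a, span [set` s] (u - a *: v).
Proof.
split.
  have sS := submodule_span [set` s].
  suff H : span [set` v :: s] `<=` [set u | exists a, span [set` s] (u - a *: v)] by move=> /H.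
  apply: span_min.
    split; first by exists 0; rewrite scale0r subr0; exact: (submodule0 sS).
    move=> a w1 w2 [a1 h1] [a2 h2]; exists (a * a1 + a2).
    rewrite scalerDl -scalerA opprD addrACA -scalerBr.
    by apply: (submoduleD sS) => //; apply: (submoduleZ _ sS).
  move=> w /=; rewrite inE => /orP[/eqP->|ws].
    by exists 1; rewrite scale1r subrr; exact: (submodule0 sS).
  by exists 0; rewrite scale0r subr0; exact: span_in ws.
case=> a h; rewrite -[u](subrK (a *: v)).
apply: (submoduleD (submodule_span _)).
- apply: span_min h; first exact: submodule_span.
  move=> w ws; have h' : w \in v :: s by rewrite inE ws orbT.
  exact: span_in h'.
apply: (submoduleZ _ (submodule_span _)).
exact: (span_in (mem_head v s)).
Qed.

Lemma mulsm_in I N a u : I a -> N u -> mulsm I N (a *: u).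
Proof. by move=> Ia Nu; apply: span_in; exists a => //; exists u. Qed.

Lemma mulsm_min I N K : submodule K ->
  (forall a u, I a -> N u -> K (a *: u)) -> mulsm I N `<=` K.
Proof. by move=> sK h; apply: span_min => // _ [a Ia [u Nu <-]]; apply: h. Qed.

Lemma submodule_mulsm I N : submodule (mulsm I N).
Proof. exact: submodule_span. Qed.

Lemma mulsm_mono I I' N N' : I `<=` I' -> N `<=` N' -> mulsm I N `<=` mulsm I' N'.
Proof.
move=> II' NN'; apply: mulsm_min => [|a u /II' Ia /NN' Nu]; first exact: submodule_mulsm.
exact: mulsm_in.
Qed.

Lemma mulsm_subr I N : submodule N -> mulsm I N `<=` N.
Proof. by move=> sN; apply: mulsm_min => // a u _; apply: submoduleZ. Qed.

End SubmoduleTheory.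

#[export] Hint Resolve submoduleT submodule_set0 submodule_span submodule_mulsm : core.

Section IdealTheory.
Context {A : comNzRingType}.
Implicit Types (I J L : set A).

Lemma ideal0 I : ideal I -> I 0. Proof. exact: submodule0. Qed.
Lemma idealD I a b : ideal I -> I a -> I b -> I (a + b).
Proof. exact: submoduleD. Qed.
Lemma idealB I a b : ideal I -> I a -> I b -> I (a - b).
Proof. exact: submoduleB. Qed.
Lemma idealMl I a b : ideal I -> I b -> I (a * b).
Proof. exact: (@submoduleZ _ A^o). Qed.
Lemma idealMr I a b : ideal I -> I a -> I (a * b).
Proof. by rewrite mulrC; exact: idealMl. Qed.

Lemma idealT : ideal [set: A]. Proof. exact: submoduleT. Qed.

Lemma ideal1 I : ideal I -> I 1 -> I = [set: A].
Proof. by move=> iI I1; apply/seteqP; split=> // a _; rewrite -[a]mulr1; apply: idealMl. Qed.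

Lemma ideal_mulid I J : ideal (mulid I J). Proof. exact: submodule_mulsm. Qed.

Lemma mulid_in I J a b : I a -> J b -> mulid I J (a * b).
Proof. exact: (@mulsm_in _ A^o). Qed.

Lemma mulid_min I J L : ideal L ->
  (forall a b, I a -> J b -> L (a * b)) -> mulid I J `<=` L.
Proof. exact: (@mulsm_min _ A^o). Qed.

Lemma mulid_mono I I' J J' : I `<=` I' -> J `<=` J' -> mulid I J `<=` mulid I' J'.
Proof. exact: (@mulsm_mono _ A^o). Qed.

Lemma mulidC I J : mulid I J = mulid J I.
Proof.
suff H I' J' : mulid I' J' `<=` mulid J' I' by apply/seteqP.
by apply: mulid_min => [|a b Ia Jb]; [exact: ideal_mulid|rewrite mulrC; exact: mulid_in].
Qed.

Lemma mulid_subl I J : ideal I -> mulid I J `<=` I.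
Proof. by move=> iI; apply: mulid_min => // a b Ia _; apply: idealMr. Qed.

Lemma mulid_subr I J : ideal J -> mulid I J `<=` J.
Proof. by rewrite mulidC; exact: mulid_subl. Qed.

Lemma mul1id I : ideal I -> mulid [set: A] I = I.
Proof.
move=> iI; apply/seteqP; split; first exact: mulid_subr.
by move=> a Ia; rewrite -[a]mul1r; apply: mulid_in.
Qed.

Lemma mulsm_mulid (M : lmodType A) I J (N : set M) :
  mulsm (mulid I J) N = mulsm I (mulsm J N).
Proof.
apply/seteqP; split; apply: mulsm_min => // a u.
  move=> IJa Nu.
  suff H : mulid I J `<=` [set a | mulsm I (mulsm J N) (a *: u)] by apply: (H a IJa).
  apply: mulid_min.
    split; first by rewrite /= scale0r; exact: (submodule0 (submodule_mulsm _ _)).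
    move=> e b c /= hb hc; rewrite scalerDl -scalerA.
    by apply: (submoduleD (submodule_mulsm _ _)) => //; apply: (submoduleZ _ (submodule_mulsm _ _)).
  by move=> c b Ic Jb /=; rewrite -scalerA; apply: mulsm_in => //; apply: mulsm_in.
move=> Ia Ju.
suff H : mulsm J N `<=` [set u | mulsm (mulid I J) N (a *: u)] by apply: (H u Ju).
apply: mulsm_min.
  exact: submodule_pre.
by move=> b v Jb Nv /=; rewrite scalerA; apply: mulsm_in => //; apply: mulid_in.
Qed.

Lemma mulsmT (M : lmodType A) (N : set M) : submodule N -> mulsm [set: A] N = N.
Proof.
move=> sN; apply/seteqP; split; first exact: mulsm_subr.
by move=> u Nu; rewrite -[u]scale1r; apply: mulsm_in.
Qed.

Lemma mulidA I J L : mulid I (mulid J L) = mulid (mulid I J) L.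
Proof. by symmetry; exact: (@mulsm_mulid A^o). Qed.

End IdealTheory.

(* Ideals form a commutative monoid under [mulid], whereas [mulid] has no unit on
   arbitrary subsets. *)
Record idl (A : comNzRingType) := Idl { idl_set :> set A; idl_ideal : ideal idl_set }.

Section IdealMonoid.
Context {A : comNzRingType}.

Lemma idl_inj (I J : idl A) : (I : set A) = J -> I = J.
Proof.
by case: I J => [I iI] [J iJ] /= IJ; rewrite IJ in iI *; congr Idl; exact: Prop_irrelevance.
Qed.

Definition idl1 : idl A := Idl idealT.
Definition idlM (I J : idl A) : idl A := Idl (ideal_mulid I J).

Lemma idlMA : associative idlM.
Proof. by move=> I J L; apply: idl_inj; exact: mulidA. Qed.
Lemma idlMC : commutative idlM.
Proof. by move=> I J; apply: idl_inj; exact: mulidC. Qed.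
Lemma idlMCA : left_commutative idlM.
Proof. by move=> I J L; rewrite !idlMA (idlMC I). Qed.
Lemma idl1M : left_id idl1 idlM.
Proof. by move=> I; apply: idl_inj; apply: mul1id; exact: idl_ideal. Qed.

HB.instance Definition _ := Monoid.isComLaw.Build (idl A) idl1 idlM idlMA idlMC idl1M.

Definition idlX (I : idl A) n : idl A := iter n (idlM I) idl1.

Lemma idlXE (I : idl A) n : idlX I n = expid I n :> set A.
Proof. by elim: n => //= n ->. Qed.

Lemma idlXS (I : idl A) n : idlX I n.+1 = idlM I (idlX I n). Proof. by []. Qed.

Lemma idlXD (I : idl A) p q : idlX I (p + q) = idlM (idlX I p) (idlX I q).
Proof. by elim: p => [|p IH]; rewrite ?idl1M// addSn !idlXS IH idlMA. Qed.

Lemma idlX1 (I : idl A) : idlX I 1 = I.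
Proof. by rewrite /idlX /= idlMC idl1M. Qed.

Lemma idlMX (I J : idl A) n : idlX (idlM I J) n = idlM (idlX I n) (idlX J n).
Proof. by elim: n => [|n IH]; rewrite ?idl1M// !idlXS IH -!idlMA (idlMA J) (idlMC J) !idlMA. Qed.

Lemma prodidE r (a : 'I_r -> idl A) (n : 'I_r -> nat) :
  prodid a n = \big[idlM/idl1]_i idlX (a i) (n i).
Proof. by rewrite /prodid; elim/big_rec2: _ => //= i I J _ ->; rewrite idlXE. Qed.

End IdealMonoid.

(** * Noetherian modules and primes *)

Section Adjoin.
Context {A : comNzRingType} {M : lmodType A}.
Implicit Types (N K L : set M).

Definition adjoin K (u : M) : set M := [set w | exists a : A, K (w - a *: u)].

Lemma submodule_adjoin K u : submodule K -> submodule (adjoin K u).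
Proof.
move=> sK; split; first by exists 0; rewrite scale0r subr0; exact: submodule0.
move=> a v w [b Kb] [c Kc]; exists (a * b + c).
rewrite scalerDl -scalerA opprD addrACA -scalerBr.
by apply: (submoduleD sK) => //; apply: (submoduleZ _ sK).
Qed.

Lemma adjoin_sub K u : K `<=` adjoin K u.
Proof. by move=> w Kw; exists 0; rewrite scale0r subr0. Qed.

Lemma adjoin_in K u : submodule K -> adjoin K u u.
Proof. by move=> sK; exists 1; rewrite scale1r subrr; exact: submodule0. Qed.

Lemma adjoin_min K u N : submodule N -> K `<=` N -> N u -> adjoin K u `<=` N.
Proof.
move=> sN KN Nu w [a /KN Nw]; rewrite -[w](subrK (a *: u)).
by apply: (submoduleD sN) => //; apply: (submoduleZ _ sN).
Qed.

Lemma mulsm_span_cons (I : set A) v (s : seq M) u : ideal I ->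
  mulsm I (span [set` v :: s]) u ->
  exists2 e, I e & mulsm I (span [set` s]) (u - e *: v).
Proof.
move=> iI; suff H : mulsm I (span [set` v :: s]) `<=`
  [set u | exists2 e, I e & mulsm I (span [set` s]) (u - e *: v)] by move=> /H.
have sm := submodule_mulsm I (span [set` s]).
apply: mulsm_min; first split.
- by exists 0; [exact: ideal0|rewrite scale0r subr0; exact: (submodule0 sm)].
- move=> a w1 w2 [e1 I1 h1] [e2 I2 h2]; exists (a * e1 + e2).
    by apply: idealD => //; apply: idealMl.
  rewrite scalerDl -scalerA opprD addrACA -scalerBr.
  by apply: (submoduleD sm) => //; apply: (submoduleZ _ sm).
move=> a w Ia /span_cons[c h]; exists (a * c); first exact: idealMr.
by rewrite -scalerA -scalerBr; exact: mulsm_in.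
Qed.

End Adjoin.

Definition noetherian_module (A : comNzRingType) (M : lmodType A) : Prop :=
  forall N : set M, submodule N -> fin_gen N.

Section Noetherian.
Context {A : comNzRingType} {M : lmodType A}.
Implicit Types (N K L : set M).

Lemma acc (L : nat -> set M) : noetherian_module M ->
  (forall n, submodule (L n)) -> (forall n, L n `<=` L n.+1) ->
  exists p, forall n, (p <= n)%N -> L n = L p.
Proof.
move=> nM sL LS.
have Lle i j : (i <= j)%N -> L i `<=` L j.
  by elim: j => [|j IH]; [rewrite leqn0 => /eqP->|rewrite leq_eqVlt => /predU1P[->//|/IH h];
    apply: subset_trans h (LS j)].
pose U := [set u | exists n, L n u].
have sU : submodule U.
  split; first by exists 0%N; exact: (submodule0 (sL _)).
  move=> a u v [i Li] [j Lj]; exists (maxn i j); apply sL.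
  - by apply: (Lle i) => //; exact: leq_maxl.
  - by apply: (Lle j) => //; exact: leq_maxr.
have [s Us] := nM _ sU.
have [p hp] : exists p, forall v, v \in s -> L p v.
  have : forall v, v \in s -> U v by move=> v vs; rewrite Us; exact: span_in vs.
  elim: (s) => [|v s' IH] h; first by exists 0%N.
  have [i Li] := h v (mem_head _ _).
  have [w ws|j Lj] := IH; first by apply: h; rewrite inE ws orbT.
  exists (maxn i j) => w; rewrite inE => /predU1P[->|ws].
  - by apply: (Lle i) => //; exact: leq_maxl.
  - by apply: (Lle j); [exact: leq_maxr|exact: Lj].
exists p => n pn; apply/seteqP; split; last exact: Lle.
by move=> u Lu; have : U u by [exists n]; rewrite Us; move: u {Lu}; apply: span_min.
Qed.

Lemma noeth_ind (P : set M -> Prop) : noetherian_module M ->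
  (forall K, submodule K -> (forall L, submodule L -> K `<` L -> P L) -> P K) ->
  forall K, submodule K -> P K.
Proof.
move=> nM IH K0 sK0; apply: contrapT => nP0.
have [f fP] : {f : set M -> set M & forall K, submodule K -> ~ P K ->
    [/\ submodule (f K), ~ P (f K) & K `<` f K]}.
  apply: (@choice _ _ (fun K L => submodule K -> ~ P K ->
    [/\ submodule L, ~ P L & K `<` L])) => K.
  have [[sK nPK]|nK] := pselect (submodule K /\ ~ P K); last first.
    by exists K => sK nPK; case: nK.
  apply: contrapT => /forallNP h; apply: nPK; apply: IH => // L sL KL.
  by apply: contrapT => nPL; apply: (h L).
have gP n : submodule (iter n f K0) /\ ~ P (iter n f K0).
  by elim: n => //= n [s1 s2]; have [] := fP _ s1 s2.
have [n||p hp] := @acc (fun n => iter n f K0) nM.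
- by case: (gP n).
- by move=> n; have [s1 s2] := gP n; have [_ _ []] := fP _ s1 s2.
have [s1 s2] := gP p; have [_ _ []] := fP _ s1 s2.
by move=> _; apply; have /= -> := hp p.+1 (leqnSn _).
Qed.

Lemma noeth_max (S : set (set M)) K : noetherian_module M ->
  (forall L, S L -> submodule L) -> S K ->
  exists L, [/\ S L, K `<=` L & forall L', S L' -> L `<=` L' -> L' = L].
Proof.
move=> nM sS SK; have sK := sS _ SK; move: K sK SK.
apply: (noeth_ind nM) => K sK IH SK.
have [[L [SL KL]]|h] := pselect (exists L, S L /\ K `<` L).
  have [L' [SL' LL' maxL']] := IH _ (sS _ SL) KL SL.
  by exists L'; split=> //; apply: subset_trans LL'; exact: properW.
exists K; split=> // L' SL' KL'; apply/seteqP; split=> //; apply: contrapT => nL'.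
by apply: h; exists L'.
Qed.

(* A submodule N of span (v :: s) is generated by lifts of generators of the ideal of
   v-coordinates of N, together with generators of the part of N in span s. *)
Lemma noetherian_module_fin_gen :
  noetherian A -> fin_gen [set: M] -> noetherian_module M.
Proof.
move=> nA [s0 defM]; suff H (s : seq M) N :
    submodule N -> N `<=` span [set` s] -> fin_gen N.
  by move=> N sN; apply: (H s0) => //; rewrite -defM.
elim: s N => [|v s IH] N sN Ns.
  exists [::]; apply/seteqP; split=> // u /span_nil ->; exact: submodule0.
have sI := @submoduleI _ _ N (span [set` s]) sN (submodule_span _).
have [s2 E2] := IH _ sI (@subIsetr _ _ _).
pose b := [set a : A | exists2 u, N u & span [set` s] (u - a *: v)].
have ib : ideal b.
  split; first by exists 0; [exact: submodule0|rewrite scale0r subr0;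
    exact: (submodule0 (submodule_span _))].
  move=> a x y [u Nu hu] [w Nw hw]; exists (a *: u + w); first by apply sN.
  rewrite scalerDl -[(a *: x) *: v]scalerA opprD addrACA -scalerBr.
  by apply: (submodule_span _).2.
have [l El] := nA _ ib.
have [g gP] : {g : A -> M & forall x, b x -> N (g x) /\ span [set` s] (g x - x *: v)}.
  apply: (@choice _ _ (fun x u => b x -> N u /\ span [set` s] (u - x *: v))) => x.
  by have [[u Nu hu]|nb] := pselect (b x); [exists u|exists 0].
exists (map g l ++ s2); apply/seteqP; split; last first.
  apply: span_min => // u /=; rewrite mem_cat => /orP[/mapP[x xl ->]|us].
    by have [] := gP x; [rewrite El; exact: (@span_in _ A^o _ _ xl)|].
  have : (N `&` span [set` s]) u by rewrite E2; exact: span_in us.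
  by case.
move=> u Nu; have [a ha] := (span_cons v s u).1 (Ns u Nu).
have ba : span ([set` l] : set A^o) a by rewrite -El; exists u.
pose T := span [set` map g l ++ s2].
have sT : submodule T by exact: submodule_span.
have sub2 : N `&` span [set` s] `<=` T.
  rewrite E2; apply: span_min => // w ws; apply: span_in.
  by rewrite /= mem_cat (ws : w \in s2) orbT.
have [w [Tw Nw hw]] : exists w, [/\ T w, N w & span [set` s] (w - a *: v)].
  suff H : span ([set` l] : set A^o) `<=`
    [set a : A | exists w, [/\ T w, N w & span [set` s] (w - a *: v)]] by apply: (H a).
  apply: span_min.
    split; first by exists 0; split; [exact: submodule0|exact: submodule0|rewrite scale0r subr0;
      exact: (submodule0 (submodule_span _))].
    move=> c x y [u1 [T1 N1 h1]] [u2 [T2 N2 h2]]; exists (c *: u1 + u2); split.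
    - by apply sT.
    - by apply sN.
    rewrite scalerDl -[(c *: x) *: v]scalerA opprD addrACA -scalerBr.
    by apply: (submodule_span _).2.
  move=> x xl; have [|N1 h1] := gP x; first by rewrite El; exact: (@span_in _ A^o _ _ xl).
  by exists (g x); split=> //; apply: span_in; rewrite /= mem_cat map_f.
rewrite -[u](subrK w); apply: (submoduleD sT) => //; apply: sub2; split.
  exact: submoduleB.
have -> : u - w = (u - a *: v) - (w - a *: v) by rewrite opprB addrA subrK.
exact: (submoduleB (submodule_span _)).
Qed.

End Noetherian.

Section Primes.
Context {A : comNzRingType} (nA : noetherian A).
Implicit Types (I J p q b : set A).

Lemma prime_ideal_ideal p : prime_ideal p -> ideal p. Proof. by case. Qed.

Lemma prime_idealX p a n : prime_ideal p -> p (a ^+ n) -> p a.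
Proof.
case=> ip np1 pM; elim: n => [|n IH]; first by rewrite expr0.
by rewrite exprS => /pM[].
Qed.

(** An ideal above [b] maximal among those avoiding [S] is prime: if it misses [x] and [y],
    enlarging it by either one meets [S], and multiplying the two relations puts an element of [S]
    into it as soon as it contains [x * y]. *)
Lemma prime_disjoint (S : set A) b : S 1 -> (forall x y, S x -> S y -> S (x * y)) ->
  ideal b -> (forall x, S x -> ~ b x) ->
  exists p, [/\ prime_ideal p, b `<=` p & forall x, S x -> ~ p x].
Proof.
move=> S1 SM ib Sb.
have [||p [[ip pS] bp maxp]] := @noeth_max A A^o
  [set J | ideal J /\ forall x, S x -> ~ J x] b nA.
- by move=> L [].
- by [].
exists p; split=> //; split=> //; first exact: pS.
move=> x y pxy; apply: contrapT => /not_orP[npx npy].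
have H z : ~ p z -> exists2 s, S s & exists c, p (s - c * z).
  move=> npz; apply: contrapT => h; apply: npz.
  have iz := @submodule_adjoin _ A^o p z ip.
  rewrite -(maxp (adjoin (p : set A^o) z)).
  - exact: (@adjoin_in _ A^o).
  - by split=> // s Ss [c pc]; apply: h; exists s => //; exists c.
  - exact: (@adjoin_sub _ A^o).
have [s Ss [c hc]] := H _ npx; have [t St [e he]] := H _ npy.
apply: (pS (s * t)); first exact: SM.
have -> : s * t = (s - c * x) * t + (c * x) * (t - e * y) + c * e * (x * y) by ring.
apply: idealD => //; last exact: idealMl.
by apply: idealD => //; [exact: idealMr|exact: idealMl].
Qed.

Lemma minimal_prime b p0 : prime_ideal p0 -> b `<=` p0 ->
  exists p, [/\ prime_ideal p, b `<=` p, p `<=` p0 &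
    forall q, prime_ideal q -> b `<=` q -> q `<=` p -> q = p].
Proof.
move=> pp0 bp0.
(* [Zorn_bigcup] works with unions of chains, so a prime below [p0] is encoded by a set removed from
   [p0]: descending chains of primes become ascending ones. *)
pose P := [set S : set A | prime_ideal (p0 `\` S) /\ b `<=` p0 `\` S].
have [F FP totF|S [[pS bS] maxS]] := @Zorn_bigcup A P.
  pose Q := p0 `\` \bigcup_(X in F) X.
  have QX X : F X -> Q `<=` p0 `\` X.
    by move=> FX a [pa na]; split=> // Xa; apply: na; exists X.
  have QI a : p0 a -> (forall X, F X -> (p0 `\` X) a) -> Q a.
    by move=> pa h; split=> // -[X FX Xa]; have [_] := h X FX.
  have ip0 := prime_ideal_ideal pp0.
  split; last by move=> a ba; apply: QI; [exact: bp0|move=> X /FP[_]; apply].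
  split.
  - split; first by apply: QI; [exact: ideal0|move=> X /FP[[/ideal0]]].
    move=> a x y Qx Qy; apply: QI.
      by apply ip0; [case: Qx|case: Qy].
    move=> X FX; have [[[_ h] _ _] _] := FP X FX; apply: h; exact: QX.
  - by case=> p01 _; case: pp0 => _ /(_ p01).
  move=> x y Qxy; apply: contrapT => /not_orP[nx ny].
  have pxy : p0 x \/ p0 y by case: pp0 => _ _; apply; case: Qxy.
  have H z : ~ Q z -> p0 z -> exists2 X, F X & ~ (p0 `\` X) z.
    move=> nQ pz; apply: contrapT => h; apply: nQ; apply: QI => // X FX.
    by apply: contrapT => nX; apply: h; exists X.
  have H' z : ~ Q z -> (forall X, F X -> ~ (p0 `\` X) z) \/ exists2 X, F X & ~ (p0 `\` X) z.
    move=> nQ; have [/H|npz] := pselect (p0 z); first by right; auto.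
    by left=> X FX [].
  have key X : F X -> ~ (p0 `\` X) x -> ~ (p0 `\` X) y -> False.
    move=> FX nX nY; have [[_ _ h] _] := FP X FX.
    by have [] := h x y (QX _ FX _ Qxy).
  have [hx|[X FX nX]] := H' _ nx; have [hy|[Y FY nY]] := H' _ ny.
  - case: pxy => pz; last by have [X FX nX] := H _ ny pz; exact: (key X FX (hx X FX)).
    by have [X FX nX] := H _ nx pz; exact: (key X FX nX (hy X FX)).
  - exact: (key Y FY (hx Y FY)).
  - exact: (key X FX nX (hy X FX)).
  have [XY|YX] := totF X Y FX FY.
    by apply: (key Y FY) => // -[pz nz]; apply: nX; split=> // /XY.
  by apply: (key X FX) => // -[pz nz]; apply: nY; split=> // /YX.
exists (p0 `\` S); split; [exact: pS|exact: bS|by move=> a []|].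
move=> q pq bq qS; apply/seteqP; split=> // a [pa nSa]; apply: contrapT => nqa.
have E : p0 `\` (S `|` ~` q) = q.
  apply/seteqP; split=> [x [px /not_orP[_ /contrapT]]//|x qx].
  by have [px nx] := qS x qx; split=> // -[/nx|/(_ qx)].
apply: (maxS (S `|` ~` q)); last by rewrite /P /= E.
by split=> [x|h]; [left|apply: nSa; apply: h; right].
Qed.

(** A maximal annihilator modulo [K] of an element of [N] outside [K] is prime: if [b] does not send
    [u] into [K], then [b *: u] has the same annihilator as [u]. *)
Lemma associated_prime (M : lmodType A) (K N : set M) u0 :
  submodule K -> submodule N -> N u0 -> ~ K u0 ->
  exists u, [/\ N u, ~ K u & prime_ideal [set a | K (a *: u)]].
Proof.
move=> sK sN Nu0 Ku0.
have iK u : ideal [set a : A | K (a *: u)].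
  split; rewrite /= ?scale0r; first exact: submodule0.
  by move=> a x y Kx Ky; rewrite scalerDl -[(a *: x) *: u]scalerA; apply sK.
pose S := [set I | exists u, [/\ N u, ~ K u & I = [set a : A | K (a *: u)]]].
have [||I [[u [Nu Ku ->]] _ maxI]] := @noeth_max A A^o S [set a | K (a *: u0)] nA.
- by move=> _ [u [_ _ ->]]; exact: iK.
- by exists u0.
exists u; split=> //; split=> //=; first by rewrite scale1r.
move=> a b Kab; apply: contrapT => /not_orP[Ka Kb]; apply: Ka.
have E : [set a : A | K (a *: (b *: u))] = [set a | K (a *: u)].
  apply: maxI; first by exists (b *: u); split=> //; exact: submoduleZ.
  by move=> c Kc; rewrite /= scalerA mulrC -scalerA; exact: submoduleZ.
by rewrite -[K _]/([set a | K (a *: u)] a) -E /= scalerA.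
Qed.

End Primes.

(** * Krull's height theorem *)

Section Nakayama.
Context {A : comNzRingType} {M : lmodType A}.
Implicit Types (K N : set M).

(* The determinant trick, by elimination of one generator at a time. *)
Lemma nakayama_ideal (s : seq M) K (b c : idl A) : submodule K -> b `<=` c ->
  (forall a u, (c : set A) a -> span [set` s] u -> addsm K (mulsm b (span [set` s])) (a *: u)) ->
  exists n, forall r, (idlX c n.+1 : set A) r -> exists z,
    (idlM b (idlX c n) : set A) (r - z) /\ forall u, span [set` s] u -> K (z *: u).
Proof.
move=> sK; elim: s b c => [|v s IH] b c bc H.
  exists 0%N => r _; exists r; split=> [|u /span_nil ->].
    by rewrite subrr; exact: ideal0 (idl_ideal _).
  by rewrite scaler0; exact: submodule0.
have sS := submodule_span [set` s].
have ib := idl_ideal b; have ic := idl_ideal c.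
have bcc : idlM b c `<=` idlM c c by apply: mulid_mono.
have vE w r : (c : set A) w -> span [set` v :: s] r -> exists e k w', [/\ (b : set A) e, K k,
    mulsm b (span [set` s]) w' & w *: r = k + w' + e *: v].
  move=> cw Sr; have [k Kk [m hm E]] := H w r cw Sr.
  have [e be he] := mulsm_span_cons ib hm.
  by exists e, k, (m - e *: v); split=> //; rewrite -E -addrA subrK.
have Sv : span [set` v :: s] v := span_in (mem_head v s).
have Ss w : span [set` s] w -> span [set` v :: s] w.
  by move=> h; apply/span_cons; exists 0; rewrite scale0r subr0.
(* Eliminating [v] squares the ideal: since [(r - e) *: v] lies in [K] plus [b] times the span of
   [s], the product [r * r'] sends that span into [K] plus [b c] times it. The induction hypothesis
   is therefore used for [b c] and [c c]. *)
have [n hn] : exists n, forall r, (idlX (idlM c c) n.+1 : set A) r -> exists z,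
    (idlM (idlM b c) (idlX (idlM c c) n) : set A) (r - z) /\
    forall u, span [set` s] u -> K (z *: u).
  apply: IH => // a u cca Su.
  have sT : submodule (addsm K (mulsm (idlM b c) (span [set` s]))).
    exact: submodule_addsm.
  suff h : idlM c c `<=`
      [set a | addsm K (mulsm (idlM b c) (span [set` s])) (a *: u)] by exact: h.
  apply: mulid_min.
    split; first by rewrite /= scale0r; exact: submodule0.
    by move=> x y z Ty Tz /=; rewrite scalerDl -[(x *: y) *: u]scalerA; apply sT.
  move=> r r' cr cr' /=.
  have [e [k [w [be Kk hw E]]]] := vE r v cr Sv.
  have [e' [k' [w' [be' Kk' hw' E']]]] := vE r' u cr' (Ss u Su).
  have -> : (r * r') *: u = ((r - e) *: k' + e' *: k)
      + ((r - e) *: w' + e' *: w + (e * r') *: u).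
    have Ev : (r - e) *: v = k + w by rewrite scalerBl E addrK.
    have Ex : (r - e) *: (r' *: u) =
        ((r - e) *: k' + e' *: k) + ((r - e) *: w' + e' *: w).
      by rewrite E' !scalerDr [_ *: (e' *: v)]scalerA mulrC -scalerA Ev scalerDr addrACA.
    by rewrite [RHS]addrA -Ex -!scalerA -scalerDl subrK.
  exists ((r - e) *: k' + e' *: k).
    by apply: (submoduleD sK); exact: submoduleZ.
  exists ((r - e) *: w' + e' *: w + (e * r') *: u) => //.
  have sm := submodule_mulsm (idlM b c) (span [set` s]).
  have cre : (c : set A) (r - e) by apply: (idealB ic) => //; exact: bc.
  apply: (submoduleD sm); last by apply: mulsm_in => //; exact: mulid_in.
  have E0 : mulsm (idlM b c) (span [set` s]) = mulsm c (mulsm b (span [set` s])).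
    by rewrite -mulsm_mulid mulidC.
  apply: (submoduleD sm); rewrite E0; apply: mulsm_in => //; exact: bc.
exists (n.+1 + n.+1)%N.
have cE k : idlX (idlM c c) k = idlX c (k + k) by rewrite idlMX idlXD.
set t := (n.+1 + n.+1)%N; set G := [set r : A | exists z,
    (idlM b (idlX c t) : set A) (r - z) /\ forall u, span [set` v :: s] u -> K (z *: u)].
suff h : idlM c (idlX (idlM c c) n.+1) `<=` G.
  by move=> r hr; apply: h; rewrite cE.
have iB := idl_ideal (idlM b (idlX c t)).
apply: mulid_min.
  split.
    exists 0; split; first by rewrite subrr; exact: ideal0.
    by move=> u _; rewrite scale0r; exact: submodule0.
  move=> a x y [z1 [h1 g1]] [z2 [h2 g2]]; exists (a * z1 + z2); split.
    rewrite -[a *: x]/(a * x) opprD addrACA -mulrBr.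
    by apply: (idealD iB) => //; exact: (idealMl _ iB).
  move=> u Su; rewrite scalerDl -scalerA.
  by apply: (submoduleD sK); [apply: (submoduleZ _ sK); exact: g1|exact: g2].
move=> r w cr cw; have [z0 [h0 g0]] := hn w cw.
have [e [k [w1 [be Kk hw1 E1]]]] := vE r v cr Sv.
have cre : (c : set A) (r - e) by apply: (idealB ic) => //; exact: bc.
(* [z0] sends the span of [s] into [K], and [r - e] sends [v] into [K] plus that span, so the
   product handles both. *)
exists (z0 * (r - e)); split.
  have -> : r * w - z0 * (r - e) = (r - e) * (w - z0) + e * w by ring.
  apply: (idealD iB); last by apply: mulid_in => //; rewrite -cE.
  have <- : idlM c (idlM (idlM b c) (idlX (idlM c c) n)) = idlM b (idlX c t).
    rewrite cE /t addSn addnS !idlXS -(idlMA b c).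
    by rewrite idlMCA.
  exact: mulid_in.
have Kz x : span [set` s] x -> K ((z0 * (r - e)) *: x).
  by move=> Sx; rewrite mulrC -scalerA; apply: (submoduleZ _ sK); exact: g0.
move=> u /span_cons[a Su]; rewrite -[u](subrK (a *: v)) scalerDr.
apply: (submoduleD sK); first exact: Kz.
rewrite scalerA mulrC -scalerA -scalerA scalerBl E1 addrK scalerDr.
apply: (submoduleZ _ sK); apply: (submoduleD sK); first exact: submoduleZ.
by apply: g0; apply: mulsm_subr hw1.
Qed.

(** The determinant trick for [b + (r)], which also sends [N] into [K + b N]. When a prime contains
    [b] but not [r], the multiplier stays outside it: this is Nakayama's lemma after
    localization. *)
Lemma nakayama (N K : set M) (b : set A) r : submodule N -> fin_gen N -> submodule K ->
  ideal b -> (forall u, N u -> addsm K (mulsm b N) (r *: u)) ->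
  exists n, exists2 e, b e & forall u, N u -> K ((r ^+ n - e) *: u).
Proof.
move=> sN [s Ns] sK ib H.
pose c : set A := adjoin (b : set A^o) r.
have ic : ideal c by exact: (@submodule_adjoin _ A^o).
have bc : b `<=` c by exact: (@adjoin_sub _ A^o).
have [|n hn] := @nakayama_ideal s K (Idl ib) (Idl ic) sK bc.
  rewrite -Ns => a u [x hx] Nu.
  have -> : a *: u = x *: (r *: u) + (a - x * r) *: u.
    by rewrite scalerA -scalerDl addrC subrK.
  have sT : submodule (addsm K (mulsm b N)) by exact: submodule_addsm.
  apply: (submoduleD sT); first by apply: (submoduleZ _ sT); exact: H.
  by apply: addsm_subr => //; exact: mulsm_in.
have [|z [hz gz]] := hn (r ^+ n.+1).
  have cr : c r by exact: (@adjoin_in _ A^o).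
  elim: n.+1 => [//|k IHk]; rewrite exprS idlXS; exact: mulid_in.
exists n.+1, (r ^+ n.+1 - z); first exact: (mulid_subl (J := idlX (Idl ic) n) ib).
by rewrite Ns => u Su; rewrite opprB addrC subrK; exact: gz.
Qed.

End Nakayama.

Section CommonMultiplier.
Context {A : comNzRingType} {M : lmodType A}.

Lemma common_multiplier (p : set A) (N T : set M) : prime_ideal p -> fin_gen N ->
  submodule T -> (forall u, N u -> exists2 s, ~ p s & T (s *: u)) ->
  exists2 s, ~ p s & forall u, N u -> T (s *: u).
Proof.
move=> pp [l ->] sT; elim: l => [|v l IH] H.
  by exists 1; [case: pp|move=> u /span_nil ->; rewrite scaler0; exact: submodule0].
have [|s ps Ts] := IH.
  by move=> u hu; apply: H; apply/span_cons; exists 0; rewrite scale0r subr0.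
have [s' ps' Ts'] := H v (span_in (mem_head v l)).
exists (s * s'); first by case: pp => _ _ h /h[].
move=> u /span_cons[a hu]; rewrite -[u](subrK (a *: v)) scalerDr.
apply: (submoduleD sT).
  by rewrite mulrC -scalerA; apply: (submoduleZ _ sT); exact: Ts.
have -> : (s * s') *: (a *: v) = (s * a) *: (s' *: v).
  by rewrite !scalerA mulrAC.
exact: submoduleZ.
Qed.

End CommonMultiplier.

Section Height.
Context {A : comNzRingType} (nA : noetherian A).
Implicit Types (p q b c : set A).

(* If the only prime between Ann(N/K) and p is p, then descending chains between K and N
   stabilize after localization at p; localization is expressed by multipliers outside p. *)
Lemma dcc_localized (M : lmodType A) p (K N : set M) : noetherian_module M ->
  prime_ideal p -> submodule K -> submodule N -> K `<=` N ->
  (forall q, prime_ideal q -> (forall a, (forall u, N u -> K (a *: u)) -> q a) ->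
     q `<=` p -> q = p) ->
  forall L : nat -> set M, (forall n, submodule (L n)) ->
    (forall n, K `<=` L n) -> (forall n, L n `<=` N) ->
    (forall n, L n.+1 `<=` L n) ->
  exists n, forall k u, L n u -> exists2 s, ~ p s & L k (s *: u).
Proof.
move=> nM pp sK sN; move: K sK; apply: (noeth_ind nM) => K sK IH KN H L sL KL LN LS.
have [_ np1 pM] := pp.
have Lle i j : (i <= j)%N -> L j `<=` L i.
  elim: j => [|j IHj]; first by rewrite leqn0 => /eqP->.
  rewrite leq_eqVlt => /predU1P[->//|/IHj h].
  exact: subset_trans (LS j) h.
have [NK|] := pselect (N `<=` K).
  by exists 0%N => k u Lu; exists 1 => //; rewrite scale1r; apply: KL; apply: NK; apply: LN Lu.
move=> /existsNP[u0 /not_implyP[Nu0 nKu0]].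
have [v [Nv nKv pP]] := associated_prime nA sK sN Nu0 nKu0.
set P := [set a | K (a *: v)] in pP.
have annP a : (forall u, N u -> K (a *: u)) -> P a by move=> h; exact: h.
(* [K1 / K] is a copy of [A / P]. The chain is controlled by its image in [N / K1], treated by
   induction, and by its trace [D] on the multiples of [v]. *)
pose K1 := adjoin K v; have sK1 : submodule K1 by exact: submodule_adjoin.
have KK1 : K `<=` K1 by exact: adjoin_sub.
have K1N : K1 `<=` N by exact: adjoin_min.
have KltK1 : K `<` K1 by split=> // /(_ v (adjoin_in v sK)).
have [|||||n1 hn1] := IH K1 sK1 KltK1 K1N _ (fun n => addsm (L n) K1).
- by move=> q pq hq; apply: H => // a ha; apply: hq => u Nu; apply: KK1; exact: ha.
- by move=> n; exact: submodule_addsm.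
- by move=> n; exact: addsm_subr.
- by move=> n; apply: addsm_min => //; exact: LN.
- by move=> n; apply: addsm_mono.
pose D n := [set a : A | L n (a *: v)].
have [n2 hn2] : exists n, forall k a, D n a -> exists2 s, ~ p s & D k (s * a).
  (* Either every trace is the whole ring after localization, or some trace lies in [p]. Then [P]
     does too, so [P = p] by hypothesis, and the trace has reached its least possible value [P]. *)
  have [h|] := pselect (forall n, exists2 s, ~ p s & D n s).
    exists 0%N => k a _; have [s ps Ds] := h k; exists s => //.
    by rewrite /D /= mulrC -scalerA; exact: submoduleZ.
  move=> /existsNP[n hn]; have Dp : D n `<=` p.
    by move=> a Da; apply: contrapT => pa; apply: hn; exists a.
  have PD k : P `<=` D k by move=> a; exact: KL.
  have EP : P = p by apply: H => //; apply: subset_trans Dp.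
  by exists n => k a /Dp pa; exists 1 => //; rewrite mul1r; apply: PD; rewrite EP.
exists (maxn n1 n2) => k u Lu.
have [s1 ps1 [l Ll [w [c hc]]]] : exists2 s, ~ p s & addsm (L (maxn k (maxn n1 n2))) K1 (s *: u).
  apply: hn1; apply: addsm_subl => //; apply: Lle Lu; exact: leq_maxl.
set k' := maxn k _ in Ll => E.
have Lw : L (maxn n1 n2) w.
  rewrite -[w](addKr l) E addrC; apply: (submoduleB (sL _)); first exact: submoduleZ.
  by apply: Lle Ll; exact: leq_maxr.
have LK : L (maxn n1 n2) (w - c *: v) by exact: KL.
have Dc : D n2 c.
  rewrite /D /= -[c *: v](subKr w) ; apply: (Lle n2 (maxn n1 n2)); first exact: leq_maxr.
  exact: submoduleB.
have [s2 ps2 Ds2] := hn2 k' c Dc.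
exists (s2 * s1); first by move=> /pM[].
apply: (Lle k k'); first exact: leq_maxl.
rewrite -scalerA -E scalerDr; apply: (submoduleD (sL _)); first exact: submoduleZ.
rewrite -[w](subrK (c *: v)) scalerDr; apply: (submoduleD (sL _)).
  by apply: KL; exact: submoduleZ.
by rewrite scalerA.
Qed.

Lemma prime_idlX (I : idl A) p n : prime_ideal p -> idlX I n `<=` p -> I `<=` p.
Proof.
move=> pp h a Ia; apply: (@prime_idealX _ p a n pp); apply: h.
elim: n => [//|n IH]; rewrite exprS idlXS; exact: mulid_in.
Qed.

(* Krull's principal ideal theorem in A / p0; S n below is the preimage in A of the n-th
   symbolic power of q / p0. *)
Lemma krull_principal p0 q p x : prime_ideal p0 -> prime_ideal q -> prime_ideal p ->
  p0 `<` q -> q `<` p -> p x ->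
  (forall p', prime_ideal p' -> p0 `<=` p' -> p' x -> p' `<=` p -> p' = p) -> False.
Proof.
move=> pp0 pq pp [p0q nqp0] [qp npq] px minp.
have [ip0 _ _] := pp0; have [iq nq1 qM] := pq; have [ip _ _] := pp.
have nqx : ~ q x.
  by move=> qx; apply: npq; have <- := minp q pq p0q qx qp.
pose Q := Idl iq.
pose S n : set A := [set a | exists2 s, ~ q s & addsm (idlX Q n : set A^o) (p0 : set A^o) (s * a)].
have iT n : ideal (addsm (idlX Q n : set A^o) (p0 : set A^o)).
  by apply: submodule_addsm => //; exact: idl_ideal.
have iS n : ideal (S n).
  split; first by exists 1 => //; rewrite mulr0; exact: ideal0 (iT n).
  move=> a u v [s ns hs] [t nt ht]; exists (s * t); first by move=> /qM[].
  have -> : s * t * (a *: (u : A^o) + v) = (t * a) * (s * u) + s * (t * v).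
    by rewrite -[a *: u]/(a * u); ring.
  by apply: (idealD (iT n)); apply: (idealMl _ (iT n)).
have SS n : S n.+1 `<=` S n.
  move=> a [s ns hs]; exists s => //; apply: addsm_mono hs => //.
  exact: (@mulid_subr A Q (idlX Q n) (idl_ideal _)).
have Ssat n a s : ~ q s -> S n (s * a) -> S n a.
  by move=> ns [t nt h]; exists (t * s); [move=> /qM[]|rewrite -mulrA].
have p0S n : p0 `<=` S n.
  move=> a pa; exists 1; rewrite ?mul1r//; apply: (@addsm_subr _ A^o) => //.
  exact: idl_ideal.
pose L n : set A := adjoin (S n : set A^o) x.
have sL n : ideal (L n) by apply: (@submodule_adjoin _ A^o); exact: iS.
(* Inside [p], no prime but [p] contains both [p0] and [x], so the chain [S n + (x)] stabilizes up
   to multipliers outside [p]. *)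
have [|||||||n hn] := @dcc_localized A^o p (adjoin (p0 : set A^o) x) [set: A] nA pp _ _ _ _ L sL.
- exact: (@submodule_adjoin _ A^o).
- exact: idealT.
- by move=> a _.
- move=> p' pp' hp' p'p; apply: minp => //.
    move=> a pa; apply: hp' => u _; apply: (@adjoin_sub _ A^o); exact: idealMr.
  apply: hp' => u _; apply: idealMr; first exact: (@submodule_adjoin _ A^o).
  exact: (@adjoin_in _ A^o).
- move=> n; apply: (@adjoin_min _ A^o); first exact: sL.
    by move=> a pa; apply: (@adjoin_sub _ A^o); exact: p0S.
  by apply: (@adjoin_in _ A^o); exact: iS.
- by move=> n a _.
- move=> n a [c h]; exists c; exact: SS.
have [s nps hs] : exists2 s, ~ p s & forall u, S n u -> L n.+1 (s * u).
  apply: (@common_multiplier _ A^o _ _ _ pp); [exact: nA|exact: sL|].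
  by move=> u Su; apply: hn; exact: (@adjoin_sub _ A^o).
pose B : set A := adjoin ([set 0] : set A^o) x.
have iB : ideal B by apply: (@submodule_adjoin _ A^o); exact: (@submodule_set0 _ A^o).
have Bx : B x by apply: (@adjoin_in _ A^o); exact: (@submodule_set0 _ A^o).
(* Up to a multiplier, [S n] lies in [S n.+1 + (x)]. The coefficient of [x] falls into [S n], which
   is saturated with respect to elements outside [q] such as [x]; Nakayama's lemma then removes the
   term [x S n]. *)
have SnS : S n `<=` S n.+1.
  have [||k [e [c ec] he]] := @nakayama _ A^o (S n) (S n.+1) B s (iS n) _ (iS n.+1) iB.
  - exact: nA.
  - move=> u Su; have [c hc] := hs u Su; apply/addsmE; exists (c * x); last exact: hc.
    rewrite mulrC; apply: (@mulsm_in _ A^o) => //.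
    apply: (Ssat _ _ _ nqx); rewrite mulrC.
    have -> : c * x = s * u - (s * u - c * x) by ring.
    apply: (idealB (iS n)); first exact: (idealMl _ (iS n)).
    exact: SS.
  have np : ~ p (s ^+ k - e).
    move=> h; apply: nps; apply: (prime_idealX (n := k) pp).
    rewrite -[s ^+ k](subrK e); apply: idealD => //.
    have -> : e = c * x by apply/eqP; rewrite -subr_eq0; apply/eqP.
    exact: idealMl.
  move=> u Su; apply: (@Ssat _ u (s ^+ k - e)); last exact: he.
  by move=> /qp.
(* Back from symbolic to ordinary powers: [t] sends [q^n] into [q^(n+1) + p0]. A second use of
   Nakayama's lemma puts [q^n], hence [q], into [p0]. *)
have [||t nqt ht] := @common_multiplier _ A^o q (idlX Q n)
     (addsm (idlX Q n.+1 : set A^o) (p0 : set A^o)) pq _ (iT n.+1).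
- by apply: nA; exact: idl_ideal.
- move=> u Qu; suff [s' ns' hs'] : S n.+1 u by exists s'.
  apply: SnS; exists 1; rewrite ?mul1r//; exact: (@addsm_subl _ A^o).
have [||k [e qe he]] := @nakayama _ A^o (idlX Q n) p0 q t (idl_ideal _) _ ip0 iq.
- by apply: nA; exact: idl_ideal.
- move=> u Qu; have [v Qv [w pw E]]  := ht u Qu.
  by exists w => //; exists v; rewrite // addrC.
have nqe : ~ q (t ^+ k - e).
  move=> h; apply: nqt; apply: (prime_idealX (n := k) pq).
  by rewrite -[t ^+ k](subrK e); apply: idealD.
apply: nqp0; apply: (@prime_idlX Q p0 n pp0) => u Qu.
by have [_ _ /(_ _ _ (he u Qu))[/p0q|]] := pp0.
Qed.

End Height.

Section HeightTheorem.
Context {A : comNzRingType} (nA : noetherian A).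
Implicit Types (p q b c : set A).

(** After localization at [p], [x] is nilpotent modulo [b]. Otherwise some prime above [b] avoids
    all products [t * x ^+ n]; avoiding the [t], it lies in [p], so it equals [p] by minimality, yet
    it avoids [x]. *)
Lemma minimal_prime_power b p x : prime_ideal p -> ideal b ->
  (forall q, prime_ideal q -> b `<=` q -> q `<=` p -> q = p) -> p x ->
  exists t n, ~ p t /\ b (t * x ^+ n).
Proof.
move=> pp ib minp px; apply: contrapT => h; have [_ np1 pM] := pp.
have [|||q [pq bq qS]] := @prime_disjoint A nA
  [set y | exists t n, ~ p t /\ y = t * x ^+ n] b _ _ ib.
- by exists 1, 0%N; rewrite expr0 mulr1.
- move=> _ _ [t [i [pt ->]]] [t' [j [pt' ->]]]; exists (t * t'), (i + j)%N.
  by split; [move=> /pM[]|rewrite exprD mulrACA].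
- by move=> _ [t [i [pt ->]]] bt; apply: h; exists t, i.
have qp : q `<=` p.
  move=> t qt; apply: contrapT => pt; apply: (qS t) => //.
  by exists t, 0%N; rewrite expr0 mulr1.
apply: (qS x); last by rewrite (minp q).
by exists 1, 1%N; rewrite mul1r expr1.
Qed.

(** Induction on [s]. Let [q] be maximal among the primes properly inside [p] and above the last but
    one term of the chain, and let [a] in [s] lie outside [q]. For each other [y] in [s], some
    [t * y ^+ i] with [t] outside [p] lies in [q + (a)]; subtracting a multiple of [a] moves it into
    [q]. By the principal ideal theorem [q] is minimal over [c] and these elements, one fewer than
    before. *)
Lemma krull_height (s : seq A) c p l (r : nat -> set A) :
  prime_ideal p -> {in s, forall a, p a} ->
  (forall q, prime_ideal q -> c `<=` q -> {in s, forall a, q a} -> q `<=` p -> q = p) ->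
  prime_chain c l r -> r l = p -> (l <= size s)%N.
Proof.
move En : (size s) => n; elim: n s En p l r => [|n IH] s En p l r pp sp minp [rP rS] rl.
  case: l rl rP rS => // l rl rP rS; have [p0 c0] := rP l (leqnSn l).
  have [rlp []] := rS l (leqnn _); rewrite rl (minp (r l))//; last by rewrite -rl.
  by case: (s) En.
case: l rl rP rS => // l rl rP rS; rewrite ltnS.
have [pl cl] := rP l (leqnSn l); have rlp := rS l (leqnn _); rewrite rl in rlp.
have [||q [[pq qp] lq maxq]] := @noeth_max A A^o
  [set J | prime_ideal J /\ J `<` p] (r l) nA.
- by move=> L [[]].
- by [].
have [qp' npq] := qp.
have [a as_ nqa] : exists2 a, a \in s & ~ q a.
  apply: contrapT => h; apply: npq; rewrite (minp q)//; first exact: subset_trans lq.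
  by move=> a sa; apply: contrapT => nqa; apply: h; exists a.
have iqa : ideal (adjoin (q : set A^o) a) by apply: (@submodule_adjoin _ A^o); case: pq.
have minqa p' : prime_ideal p' -> adjoin (q : set A^o) a `<=` p' -> p' `<=` p -> p' = p.
  move=> pp' qap' p'p; apply: contrapT => np'.
  have qp'' : q `<=` p' by apply: subset_trans qap'; exact: (@adjoin_sub _ A^o).
  have E : p' = q.
    apply: maxq => //; split=> //; split=> // pp2; apply: np'.
    by apply/seteqP; split.
  by apply: nqa; rewrite -E; apply: qap'; apply: (@adjoin_in _ A^o); case: pq.
have [g gP] : {g : A -> A & forall y, p y -> q (g y) /\
    exists t i e, ~ p t /\ g y = t * y ^+ i - e * a}.
  apply: (@choice _ _ (fun y z => p y -> q z /\
    exists t i e, ~ p t /\ z = t * y ^+ i - e * a)) => y.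
  have [py|npy] := pselect (p y); last by exists 0.
  have [t [i [pt [e qe]]]] := minimal_prime_power pp iqa minqa py.
  by exists (t * y ^+ i - e * a) => _; split=> //; exists t, i, e.
pose r' i := if i == l then q else r i.
apply: (IH (map g (rem a s)) _ q l r') => //.
- by rewrite size_map size_rem// En.
- by move=> _ /mapP[y ys ->]; have [] := gP y (sp _ (mem_rem ys)).
- move=> q' pq' cq' sq' q'q; apply: contrapT => nq'.
  apply: (@krull_principal A nA q' q p a) => //.
  + by split=> // qq'; apply: nq'; apply/seteqP.
  + exact: sp.
  move=> p' pp' q'p' p'a p'p; apply: minp => //; first exact: subset_trans q'p'.
  move=> y ys; have [->//|ya] := eqVneq y a.
  have yr : y \in rem a s.
    by have := perm_mem (perm_to_rem as_) y; rewrite ys inE (negPf ya) /= => <-.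
  have [_ [t [i [e [pt gE]]]]] := gP y (sp _ ys).
  have q'g : q' (g y) by apply: sq'; exact: map_f.
  have [ip' _ p'M] := pp'.
  have : p' (t * y ^+ i).
    have -> : t * y ^+ i = g y + e * a by rewrite gE subrK.
    by apply: (idealD ip'); [exact: q'p'|exact: idealMl].
  by move=> /p'M[/p'p//|]; exact: prime_idealX.
- split=> i il; rewrite /r'.
    case: eqP => [_|_]; last exact/rP/leqW.
    by split=> //; exact: subset_trans lq.
  rewrite (ltn_eqF il); case: eqP => [Ei|_]; last exact/rS/leqW.
  have [h1 h2] := rS i (leqW il).
  split; first by apply: (subset_trans h1); rewrite Ei.
  by move=> qr; apply: h2; rewrite Ei => y /lq; exact: qr.
by rewrite /r' eqxx.
Qed.

Lemma prime_chain_cat c l l' (r r' : nat -> set A) : prime_chain c l r ->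
  prime_chain c l' r' -> r l = r' 0%N ->
  prime_chain c (l + l') (fun i => if (i <= l)%N then r i else r' (i - l)%N).
Proof.
move=> [rP rS] [rP' rS'] E; split=> i il.
  by case: leqP => h; [exact: rP|apply: rP'; lia].
have [h|h] := leqP i.+1 l; first by rewrite (ltnW h); exact: rS.
have [h'|h'] := leqP i l; last by rewrite subSn ?(ltnW h')//; apply: rS'; lia.
have -> : i = l by lia.
by rewrite E subSn// subnn; apply: rS'; lia.
Qed.

End HeightTheorem.

Section Local.
Context {A : comNzRingType} (nA : noetherian A) (m : set A) (locm : local_ring m).
Implicit Types (p q b c : set A).

Lemma ideal_sub_maximal b : ideal b -> ~ b 1 -> b `<=` m.
Proof.
move=> ib nb1; have [||n [[inn nn1] bn maxn]] := @noeth_max A A^o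
  [set J | ideal J /\ ~ J 1] b nA; [by move=> L []|by []|].
suff -> : m = n by [].
apply/esym/locm.2; split=> // I iI nI; have [I1|nI1] := pselect (I 1).
  by right; exact: ideal1.
by left; exact: maxn.
Qed.

Lemma maximal_prime : prime_ideal m.
Proof.
have [[im nm1 maxm] _] := locm; split=> // x y mxy; apply: contrapT => /not_orP[nx ny].
have H z : ~ m z -> exists e, m (1 - e * z).
  move=> nz; have [|||E] := maxm (adjoin (m : set A^o) z).
  - exact: (@submodule_adjoin _ A^o).
  - exact: (@adjoin_sub _ A^o).
  - by move=> E; case: nz; rewrite -E; exact: (@adjoin_in _ A^o).
  by have : adjoin (m : set A^o) z 1 by rewrite E.
have [f hf] := H x nx; have [e he] := H y ny.
apply: nm1; have -> : 1 = (1 - f * x) + f * x * (1 - e * y) + f * e * (x * y) :> A by ring.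
apply: (idealD im); last exact: idealMl.
by apply: (idealD im) => //; exact: idealMl.
Qed.

Lemma prime_sub_maximal p : prime_ideal p -> p `<=` m.
Proof. by case=> ip np1 _; exact: ideal_sub_maximal. Qed.

Lemma prime_chain_bound (s : seq A) c l r : {in s, forall a, m a} ->
  (forall p, prime_ideal p -> c `<=` p -> {in s, forall a, p a} -> p = m) ->
  prime_chain c l r -> (l <= size s)%N.
Proof.
move=> sm H rC; have [rP rS] := rC; have [pl cl] := rP l (leqnn _).
have mm := maximal_prime.
have minm q : prime_ideal q -> c `<=` q -> {in s, forall a, q a} -> q `<=` m -> q = m.
  by move=> pq cq sq _; exact: H.
have [E|nE] := pselect (r l = m); first exact: (krull_height nA mm sm minm rC).
have lm := prime_sub_maximal pl.
pose r' i := if i == 0%N then r l else m.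
have rC' : prime_chain c 1 r'.
  split=> i il; rewrite /r'; first by case: eqP => // _; split=> //; exact: subset_trans lm.
  case: i il => // _ /=; split=> // ml; apply: nE; exact/seteqP.
have : (l + 1 <= size s)%N.
  apply: (krull_height nA mm sm minm (prime_chain_cat rC rC' erefl)).
  by rewrite addn1 ltnn subSn// subnn.
by rewrite addn1; exact: ltnW.
Qed.

End Local.

(** * Length *)

Section Length.
Context {A : comNzRingType} {M : lmodType A}.
Implicit Types (K L N : set M).

Lemma chain_lengths0 K N : chain_lengths K N 0 <-> submodule K /\ K = N.
Proof.
split=> [[C [C0 CN sC _]]|[sK <-]]; first by rewrite -C0 -CN; split=> //; exact: sC.
by exists (fun=> K); split.
Qed.

Lemma chain_lengthsS K N n : chain_lengths K N n.+1 <->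
  exists L, [/\ chain_lengths K L n, L `<` N & submodule N].
Proof.
split=> [[C [C0 CN sC CS]]|[L [[C [C0 CN sC CS]] LN sN]]].
  exists (C n); split; last by rewrite -CN; exact: sC.
    by exists C; split=> // i ile; [apply: sC; exact: leqW|apply: CS; exact: leqW].
  by rewrite -CN; exact: CS.
exists (fun i => if (i <= n)%N then C i else N); split=> //; first by rewrite ltnn.
  by move=> i _; case: leqP => // ile; exact: sC.
move=> i; rewrite ltnS => ile; rewrite ile /=; case: (leqP i.+1 n) => [|h]; first exact: CS.
by have -> : i = n by [lia]; rewrite CN.
Qed.

Lemma chain_lengths_sub K N n : chain_lengths K N n ->
  [/\ submodule K, submodule N & K `<=` N].
Proof.
elim: n N => [|n IH] N; first by move=> /chain_lengths0[sK <-]; split.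
move=> /chain_lengthsS[L [/IH[sK sL KL] [LN _] sN]].
by split=> //; exact: subset_trans LN.
Qed.

Lemma chain_lengths_cat K L N p q :
  chain_lengths K L p -> chain_lengths L N q -> chain_lengths K N (p + q)%N.
Proof.
move=> hp; elim: q N => [|q IH] N; first by move=> /chain_lengths0[_ <-]; rewrite addn0.
by move=> /chain_lengthsS[L' [/IH h L'N sN]]; rewrite addnS; apply/chain_lengthsS; exists L'.
Qed.

Lemma proper_or_eq K L : K `<=` L -> K = L \/ K `<` L.
Proof. by move=> KL; have [LK|] := pselect (L `<=` K); [left; exact/seteqP|right]. Qed.

Lemma chain_lengths_grow K L N p : chain_lengths K L p -> submodule N -> L `<=` N ->
  exists q, [/\ chain_lengths K N q, (p <= q)%N & L `<` N -> (p < q)%N].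
Proof.
move=> h sN /proper_or_eq[<-|LN]; first by exists p; split=> // /(@properxx _ _).
by exists p.+1; split=> //; apply/chain_lengthsS; exists L.
Qed.

(** Intersect the chain with [L], and add [L] to it: by the modular law each strict step stays
    strict on at least one side. *)
Lemma chain_lengths_split K L N n : submodule L -> K `<=` L -> chain_lengths K N n ->
  exists p q, [/\ (n <= p + q)%N, chain_lengths K (N `&` L) p & chain_lengths L (addsm N L) q].
Proof.
move=> sL KL; elim: n N => [|n IH] N.
  move=> /chain_lengths0[sK <-]; exists 0%N, 0%N; split=> //; apply/chain_lengths0; split=> //.
    by apply/seteqP; split=> [u Ku|u []//]; split=> //; exact: KL.
  by apply/seteqP; split; [exact: addsm_subr|exact: addsm_min].
move=> /chain_lengthsS[N1 [h [N1N nNN1] sN]].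
have [sK sN1 KN1] := chain_lengths_sub h.
have [p [q [npq hp hq]]] := IH _ h.
have [|p' [hp' pp' Hp]] := chain_lengths_grow hp (submoduleI sN sL).
  by apply: setSI.
have [|q' [hq' qq' Hq]] := chain_lengths_grow hq (submodule_addsm sN sL).
  by apply: addsm_mono.
exists p', q'; split=> //.
suff [/Hp|/Hq] : N1 `&` L `<` N `&` L \/ addsm N1 L `<` addsm N L by lia.
apply: contrapT => /not_orP[h1 h2]; apply: nNN1 => u Nu.
have [E1|/h1//] := @proper_or_eq (N1 `&` L) (N `&` L) (@setSI _ _ _ _ N1N).
have [E2|/h2//] := @proper_or_eq (addsm N1 L) (addsm N L) (addsm_mono N1N (@subset_refl _ _)).
have : addsm N L u by exact: addsm_subl.
rewrite -E2 => -[v N1v [w Lw Euvw]].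
have : (N `&` L) w.
  by split=> //; rewrite -[w](addKr v) Euvw addrC; apply: (submoduleB sN) => //; exact: N1N.
by rewrite -E1 => -[N1w _]; rewrite -Euvw; exact: submoduleD.
Qed.

Lemma has_length_unique K N n p : has_length K N n -> has_length K N p -> n = p.
Proof. by move=> [hn bn] [hp bp]; apply/eqP; rewrite eqn_leq; apply/andP; split;
  [exact: bp|exact: bn]. Qed.

Lemma mlengthE K N n : has_length K N n -> mlength K N = n.
Proof.
move=> h; rewrite /mlength; case: xgetP => [p _ hp|/(_ n)//].
exact: has_length_unique hp h.
Qed.

Lemma mlengthP K N : finite_length K N -> has_length K N (mlength K N).
Proof. by case=> n h; rewrite (mlengthE h). Qed.

Lemma finite_length_bound K N b : submodule K -> submodule N -> K `<=` N ->
  (forall n, chain_lengths K N n -> (n <= b)%N) -> finite_length K N.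
Proof.
move=> sK sN KN hb.
have ex : exists n, `[< chain_lengths K N n >].
  have [q [hq _ _]] := chain_lengths_grow (N := N) ((chain_lengths0 K K).2 (conj sK erefl)) sN KN.
  by exists q; exact/asboolP.
have ub n : `[< chain_lengths K N n >] -> (n <= b)%N by move=> /asboolP /hb.
case: (ex_maxnP ex ub) => n /asboolP hn maxn; exists n; split=> // p hp.
by apply: maxn; exact/asboolP.
Qed.

Lemma finite_length_sub K L N : submodule K -> submodule L -> submodule N ->
  K `<=` L -> L `<=` N -> finite_length K N -> finite_length K L /\ finite_length L N.
Proof.
move=> sK sL sN KL LN [b [_ hb]].
have [p [hp _ _]] := chain_lengths_grow (N := L) ((chain_lengths0 K K).2 (conj sK erefl)) sL KL.
have [q [hq _ _]] := chain_lengths_grow (N := N) ((chain_lengths0 L L).2 (conj sL erefl)) sN LN.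
split; apply: (@finite_length_bound _ _ b) => // n hn.
  by apply: leq_trans (hb _ (chain_lengths_cat hn hq)); exact: leq_addr.
by apply: leq_trans (hb _ (chain_lengths_cat hp hn)); exact: leq_addl.
Qed.

Lemma has_length_add K L N p q : has_length K L p -> has_length L N q ->
  has_length K N (p + q)%N.
Proof.
move=> [hp bp] [hq bq]; split=> [|n hn]; first exact: chain_lengths_cat hq.
have [sK sL KL] := chain_lengths_sub hp; have [_ sN LN] := chain_lengths_sub hq.
have [p' [q' [npq hp' hq']]] := chain_lengths_split sL KL hn.
have E1 : N `&` L = L by apply/seteqP; split=> [u []//|u Lu]; split=> //; exact: LN.
have E2 : addsm N L = N by apply/seteqP; split; [exact: addsm_min|exact: addsm_subl].
rewrite E1 in hp'; rewrite E2 in hq'.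
by apply: (leq_trans npq); apply: leq_add; [exact: bp|exact: bq].
Qed.

Lemma mlength_add K L N : submodule K -> submodule L -> submodule N ->
  K `<=` L -> L `<=` N -> finite_length K N ->
  mlength K N = (mlength K L + mlength L N)%N.
Proof.
move=> sK sL sN KL LN fKN.
have [/mlengthP h1 /mlengthP h2] := finite_length_sub sK sL sN KL LN fKN.
by apply: mlengthE; exact: has_length_add h2.
Qed.

Lemma mlengthxx K : submodule K -> mlength K K = 0%N.
Proof.
move=> sK; apply: mlengthE; split; first exact/chain_lengths0.
case=> // n /chain_lengthsS[L [/chain_lengths_sub[_ _ KL] [_ nKL] _]].
by have := nKL KL.
Qed.

(* Multiplication by a induces an isomorphism N/K -> N'/K'. *)
Definition scale_iso (a : A) K N K' N' : Prop :=
  [/\ forall u, N u -> N' (a *: u), forall u, K u -> K' (a *: u),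
      forall u, N u -> K' (a *: u) -> K u
    & forall v, N' v -> exists2 u, N u & K' (v - a *: u)].

Section Transport.
Variables (a : A) (K N K' N' : set M).
Hypotheses (sK : submodule K) (sN : submodule N) (sK' : submodule K')
  (sN' : submodule N') (KN : K `<=` N) (KN' : K' `<=` N') (iso : scale_iso a K N K' N').

Let fwd n L : L `<=` N -> chain_lengths K L n ->
  chain_lengths K' (addsm K' [set a *: u | u in L]) n.
Proof.
have [NN KK inj _] := iso.
elim: n L => [|n IH] L LN.
  move=> /chain_lengths0[_ <-]; apply/chain_lengths0; split=> //.
  apply/seteqP; split; first by apply: addsm_subl; exact: submodule_scale.
  by apply: addsm_min => // _ [u Ku <-]; exact: KK.
move=> /chain_lengthsS[L1 [h [L1L nLL1] sL]]; have [_ sL1 KL1] := chain_lengths_sub h.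
apply/chain_lengthsS; exists (addsm K' [set a *: u | u in L1]); split.
- by apply: IH => //; exact: subset_trans LN.
- split; first by apply: addsm_mono => // _ [u /L1L Lu <-]; exists u.
  move=> h'; apply: nLL1 => u Lu.
  have /h'/addsmE[_ [u1 L1u1 <-]] : addsm K' [set a *: u | u in L] (a *: u).
    by apply: addsm_subr => //; exists u.
  rewrite -scalerBr => /inj Kuu1; rewrite -[u](subrK u1); apply: (submoduleD sL1) => //.
  by apply: KL1; apply: Kuu1; apply: (submoduleB sN); apply: LN => //; exact: L1L.
- by apply: submodule_addsm => //; exact: submodule_scale.
Qed.

Let bwd n L : L `<=` N' -> chain_lengths K' L n ->
  chain_lengths K (N `&` [set u | L (a *: u)]) n.
Proof.
have [NN KK inj surj] := iso.
elim: n L => [|n IH] L LN.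
  move=> /chain_lengths0[_ <-]; apply/chain_lengths0; split=> //.
  by apply/seteqP; split=> [u Ku|u [Nu Ku]]; [split; [exact: KN|exact: KK]|exact: inj].
move=> /chain_lengthsS[L1 [h [L1L nLL1] sL]]; have [_ sL1 KL1] := chain_lengths_sub h.
apply/chain_lengthsS; exists (N `&` [set u | L1 (a *: u)]); split.
- by apply: IH => //; exact: subset_trans LN.
- split; first by move=> u [Nu /L1L Lu].
  move=> h'; apply: nLL1 => v Lv; have [u Nu Kvu] := surj v (LN v Lv).
  have Lau : L (a *: u).
    rewrite -[a *: u](subKr v); apply: (submoduleB sL) => //.
    by apply: L1L; exact: KL1.
  have [_ /= L1u] := h' u (conj Nu Lau).
  by rewrite -[v](subrK (a *: u)); apply: (submoduleD sL1) => //; exact: KL1.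
- by apply: submoduleI => //; exact: submodule_pre.
Qed.

Lemma scale_iso_chain_lengths : chain_lengths K N = chain_lengths K' N'.
Proof.
have [NN KK inj surj] := iso.
apply/seteqP; split=> n.
  move=> /(fwd (@subset_refl _ N)); suff -> : addsm K' [set a *: u | u in N] = N' by [].
  apply/seteqP; split; first by apply: addsm_min => // _ [u Nu <-]; exact: NN.
  by move=> v /surj[u Nu Kvu]; apply/addsmE; exists (a *: u) => //; exists u.
move=> /(bwd (@subset_refl _ N')); suff -> : N `&` [set u | N' (a *: u)] = N by [].
by apply/seteqP; split=> [u []//|u Nu]; split=> //; exact: NN.
Qed.

Lemma scale_iso_mlength : mlength K N = mlength K' N'.
Proof. by rewrite /mlength /has_length scale_iso_chain_lengths. Qed.

End Transport.

(** An associated prime of [N/K] contains its annihilator, so it is [m]: unless [N/K] is zero, it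
    contains a copy of the residue field, of length at most 1, and Noetherian induction on [K]
    treats the rest. *)
Lemma finite_length_primes (m : set A) K N : noetherian A -> noetherian_module M ->
  maximal_ideal m -> submodule K -> submodule N -> K `<=` N ->
  (forall p, prime_ideal p -> (forall a, (forall u, N u -> K (a *: u)) -> p a) -> p = m) ->
  finite_length K N.
Proof.
move=> nA nM [im nm1 maxm] sK sN; move: K sK; apply: (noeth_ind nM) => K sK IH KN H.
have [NK|] := pselect (N `<=` K).
  have <- : K = N by apply/seteqP.
  apply: (@finite_length_bound _ _ 0) => // -[//|n].
  by move=> /chain_lengthsS[L [/chain_lengths_sub[_ _ KL] [_ /(_ KL)[]]]].
move=> /existsNP[u0 /not_implyP[Nu0 nKu0]].
have [v [Nv nKv pP]] := associated_prime nA sK sN Nu0 nKu0.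
have Pm := H _ pP (fun a h => h v Nv).
have sL := submodule_adjoin v sK; have KL := @adjoin_sub _ _ K v.
have LN : adjoin K v `<=` N by exact: adjoin_min.
have [q hq] : finite_length (adjoin K v) N.
  apply: IH => //; first by split=> // /(_ v (adjoin_in v sK)).
  by move=> p pp hp; apply: H => // a ha; apply: hp => u Nu; apply: KL; exact: ha.
have simple L1 : submodule L1 -> K `<=` L1 -> L1 `<` adjoin K v -> L1 `<=` K.
  move=> sL1 KL1 [L1L nLL1] w L1w; apply: contrapT => nKw; apply: nLL1.
  apply: adjoin_min => //; have [c hc] := L1L w L1w.
  have nmc : ~ m c.
    by rewrite -Pm => /= Kcv; apply: nKw; rewrite -[w](subrK (c *: v)); exact: submoduleD.
  have [|||E] := maxm (adjoin (m : set A^o) c).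
  - exact: (@submodule_adjoin _ A^o).
  - exact: (@adjoin_sub _ A^o).
  - by move=> E; case: nmc; rewrite -E; exact: (@adjoin_in _ A^o).
  have [e] : adjoin (m : set A^o) c 1 by rewrite E.
  rewrite -Pm /= => Kv.
  have -> : v = (1 - e * c) *: v + e *: (w - (w - c *: v)).
    by rewrite subKr scalerA scalerBl scale1r subrK.
  apply: (submoduleD sL1); first exact: KL1.
  by apply: (submoduleZ _ sL1); apply: (submoduleB sL1) => //; exact: KL1.
have [p hp] : finite_length K (adjoin K v).
  apply: (@finite_length_bound _ _ 1) => // -[//|[//|n]].
  move=> /chain_lengthsS[L1 [/chain_lengthsS[L2 [h2 [L21 nL12] sL1]] L1L _]].
  have [_ _ KL2] := chain_lengths_sub h2.
  by case: nL12; apply: (fun h => subset_trans h KL2); apply: simple => //;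
    exact: (subset_trans KL2 L21).
by exists (p + q)%N; exact: has_length_add hq.
Qed.

End Length.

(** * Multiplicity symbols of graded families *)

Section GradedSymbol.
Context {A : comNzRingType} {M : lmodType A} {G : Type} {T : eqType}.
Variable sh : T -> G -> G.
Implicit Types (K L N : G -> set M) (y : seq (A * T)) (E : set A).

Definition coker_fam (a : A) t K N : G -> set M :=
  fun g => addsm (K g) [set a *: u | u in N (sh t g)].

(** Indexed by the degree [g] of the target although it lives in degree [sh t g]; this is why [gsym]
    divides it by [K \o sh t]. *)
Definition ker_fam (a : A) t K N : G -> set M :=
  fun g => [set u | N (sh t g) u /\ K g (a *: u)].

(* The multiplicity symbol of the graded module (N g / K g)_g: an entry (a, t) of the
   sequence is multiplication by a from degree [sh t g] to degree g. *)
Fixpoint gsym y K N (g : G) : int :=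
  if y is (a, t) :: y' then
    gsym y' (coker_fam a t K N) N g - gsym y' (K \o sh t) (ker_fam a t K N) g
  else (mlength (K g) (N g))%:Z.

(** The second clause rereads an element of degree g in the lower degree [sh t g]. It makes
    multiplication by the entry [a] zero on its own kernels and cokernels without any change of
    degree. *)
Definition gfam y N : Prop :=
  [/\ forall g, submodule (N g), forall p g, p \in y -> N g `<=` N (sh p.2 g)
    & forall p g u, p \in y -> N (sh p.2 g) u -> N g (p.1 *: u)].

Lemma gfam_behead p y N : gfam (p :: y) N -> gfam y N.
Proof.
case=> sN dN mN; split=> // q g; last move=> u; move=> qy;
  [apply: dN|apply: mN]; by rewrite inE qy orbT.
Qed.

Lemma gfamI y K N : gfam y K -> gfam y N -> gfam y (fun g => K g `&` N g).
Proof.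
move=> [sK dK mK] [sN dN mN]; split=> [g|p g py u [Ku Nu]|p g u py [Ku Nu]].
- exact: submoduleI.
- by split; [apply: dK Ku|apply: dN Nu].
- by split; [apply: mK|apply: mN].
Qed.

Lemma gfamD y K N : gfam y K -> gfam y N -> gfam y (fun g => addsm (K g) (N g)).
Proof.
move=> [sK dK mK] [sN dN mN]; split=> [g|p g py|p g _ py [u Ku [v Nv <-]]].
- exact: submodule_addsm.
- by apply: addsm_mono; [exact: dK|exact: dN].
- by rewrite scalerDr; exists (p.1 *: u); [apply: mK|exists (p.1 *: v); [apply: mN|]].
Qed.

Hypothesis shC : forall t t' g, sh t (sh t' g) = sh t' (sh t g).

Lemma gfam_shift y N t : gfam y N -> gfam y (N \o sh t).
Proof.
move=> [sN dN mN]; split=> [g|p g py|p g u py] /=; first exact: sN.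
- by rewrite shC; exact: dN.
- by rewrite shC; exact: mN.
Qed.

Lemma gfam_scale y N a : gfam y N -> gfam y (fun g => [set a *: u | u in N g]).
Proof.
move=> [sN dN mN]; split=> [g|p g py _ [u Nu <-]|p g _ py [u Nu <-]].
- exact: submodule_scale.
- by exists u => //; apply: dN Nu.
- by exists (p.1 *: u); [apply: mN|rewrite !scalerA mulrC].
Qed.

Lemma gfam_pre y K a : gfam y K -> gfam y (fun g => [set u | K g (a *: u)]).
Proof.
move=> [sK dK mK]; split=> [g|p g py u Ku|p g u py Ku] /=.
- exact: submodule_pre.
- exact: (dK _ _ py _ Ku).
- by rewrite scalerA mulrC -scalerA; apply: mK.
Qed.

Lemma gfam_coker y a t K N : gfam y K -> gfam y N -> gfam y (coker_fam a t K N).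
Proof. by move=> fK fN; apply: gfamD => //; apply: gfam_scale; exact: gfam_shift. Qed.

Lemma gfam_ker y a t K N : gfam y K -> gfam y N -> gfam y (ker_fam a t K N).
Proof. by move=> fK fN; apply: gfamI; [exact: gfam_shift|exact: gfam_pre]. Qed.

Definition gsub K N := forall g, K g `<=` N g.

Lemma coker_sub a t K N y : gfam ((a, t) :: y) N -> gsub K N -> gsub (coker_fam a t K N) N.
Proof.
move=> [sN _ mN] KN g; apply: addsm_min => // _ [u Nu <-].
by apply: (mN (a, t)) => //; exact: mem_head.
Qed.

Lemma sub_ker a t K N y : gfam ((a, t) :: y) K -> gsub K N -> gsub (K \o sh t) (ker_fam a t K N).
Proof.
move=> [sK _ mK] KN g u Ku; split; first exact: KN.
by apply: (mK (a, t)) => //; exact: mem_head.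
Qed.

(** Isomorphisms given by a scalar suffice for the snake lemma below: 1 for the isomorphism
    theorems, and the first element of the sequence for the connecting map. *)
Lemma gsym_iso y (a : A) K N K' N' : gfam y K -> gfam y N -> gfam y K' -> gfam y N' ->
  gsub K N -> gsub K' N' ->
  (forall g, scale_iso a (K g) (N g) (K' g) (N' g)) -> forall g, gsym y K N g = gsym y K' N' g.
Proof.
elim: y K N K' N' => [|[b t] y IH] K N K' N' fK fN fK' fN' KN KN' iso g.
  have [sK _ _] := fK; have [sN _ _] := fN; have [sK' _ _] := fK'; have [sN' _ _] := fN'.
  by congr Posz; apply: (@scale_iso_mlength _ _ a).
have [sK dK mK] := fK; have [sN dN mN] := fN; have [sK' dK' mK'] := fK'.
have [sN' dN' mN'] := fN'.
have fKy := gfam_behead fK; have fNy := gfam_behead fN.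
have fKy' := gfam_behead fK'; have fNy' := gfam_behead fN'.
have inb : (b, t) \in (b, t) :: y by exact: mem_head.
congr (_ - _); apply: IH; do ?[exact: gfam_coker|exact: gfam_ker|exact: gfam_shift
  |apply: coker_sub; eassumption|apply: sub_ker; eassumption] => // {}g;
  have [NN KK inj surj] := iso g; have [NN2 KK2 inj2 surj2] := iso (sh t g).
- split=> //.
  + move=> _ [u Ku [_ [v Nv <-] <-]]; exists (a *: u); first exact: KK.
    exists (b *: (a *: v)); first by exists (a *: v) => //; exact: NN2.
    by rewrite scalerDr !scalerA mulrC.
  + move=> u Nu [k Kk [_ [v N'v <-] E]].
    have [w Nw hw] := surj2 v N'v.
    exists (u - b *: w); last by exists (b *: w); [exists w|rewrite subrK].
    apply: inj; first by apply: submoduleB => //; apply: (mN (b, t)).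
    rewrite scalerBr -E scalerA mulrC -scalerA -addrA -scalerBr.
    by apply: submoduleD => //; apply: (mK' (b, t)).
  + by move=> v /surj[u Nu h]; exists u => //; apply: addsm_subl => //; exact: submodule_scale.
- split=> //=.
  + move=> u [Nu Ku]; split; first exact: NN2.
    by rewrite scalerA mulrC -scalerA; exact: KK.
  + by move=> u [Nu _]; exact: inj2.
  + move=> v [Nv Kv]; have [u Nu h] := surj2 v Nv; exists u => //; split=> //.
    apply: inj; first exact: (mN (b, t)).
    rewrite scalerA mulrC -scalerA -[a *: u](subKr v) scalerBr.
    by apply: submoduleB => //; apply: (mK' (b, t)).
Qed.

(* For fixed E and y, the N/K of this kind are closed under subquotients, and a kernel or
   cokernel of the first element of y is of this kind for the tail of y. *)
Definition gcls E y K N : Prop := forall r, E r ->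
  exists2 z, ideal_span (unzip1 y) (r - z) & forall g u, N g u -> K g (z *: u).

Lemma gcls_sub E y K N K' N' : gsub K K' -> gsub N' N -> gcls E y K N -> gcls E y K' N'.
Proof.
move=> KK NN h r Er; have [z hz kz] := h r Er; exists z => // g u /NN Nu.
by apply: KK; exact: kz.
Qed.

Lemma gcls_step E a t y K N K' N' :
  (forall g u, N' g u -> K' g (a *: u)) ->
  (forall z, (forall g u, N g u -> K g (z *: u)) -> forall g u, N' g u -> K' g (z *: u)) ->
  (forall g, submodule (K' g)) ->
  gcls E ((a, t) :: y) K N -> gcls E y K' N'.
Proof.
move=> ha hz sK' h r Er; have [z /= hrz kz] := h r Er.
have /(@span_cons _ A^o)[e he] := hrz; exists (z + e * a).
  by rewrite opprD addrA.
move=> g u Nu; rewrite scalerDl -scalerA; apply: (submoduleD (sK' g)); first exact: hz.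
by apply: (submoduleZ _ (sK' g)); exact: ha.
Qed.

Lemma gcls_coker E a t y K N : gfam ((a, t) :: y) K -> gfam ((a, t) :: y) N ->
  gcls E ((a, t) :: y) K N -> gcls E y (coker_fam a t K N) N.
Proof.
move=> [sK dK mK] [sN dN mN]; apply: gcls_step.
- move=> g u Nu; apply: addsm_subr => //; exists u => //.
  by apply: (dN (a, t)) Nu; exact: mem_head.
- by move=> z hz g u Nu; apply: addsm_subl; [exact: submodule_scale|exact: hz].
- by move=> g; apply: submodule_addsm => //; exact: submodule_scale.
Qed.

Lemma gcls_ker E a t y K N : gfam ((a, t) :: y) K ->
  gcls E ((a, t) :: y) K N -> gcls E y (K \o sh t) (ker_fam a t K N).
Proof.
move=> [sK dK mK]; apply: gcls_step => //=.
- by move=> g u [_ Ku]; apply: (dK (a, t)) Ku; exact: mem_head.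
- by move=> z hz g u [Nu _]; exact: hz.
Qed.

(* The induction step is the snake lemma for multiplication by the first element. *)
Lemma gsym_add E (y : seq (A * T)) :
  (forall K N : set M, submodule K -> submodule N -> K `<=` N ->
     (forall r u, E r -> N u -> K (r *: u)) -> finite_length K N) ->
  forall K L N, gfam y K -> gfam y L -> gfam y N -> gsub K L -> gsub L N ->
  gcls E y K N -> forall g, gsym y K N g = gsym y K L g + gsym y L N g.
Proof.
move=> finE; elim: y => [|[a t] y IH] K L N fK fL fN KL LN cl g.
  have [sK _ _] := fK; have [sL _ _] := fL; have [sN _ _] := fN.
  rewrite /= -PoszD; congr Posz; apply: mlength_add => //.
  apply: finE => //; first exact: subset_trans (LN g).
  move=> r u Er Nu; have [z /(@span_nil _ A^o)/eqP] := cl r Er.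
  by rewrite subr_eq0 => /eqP -> h; exact: h.
have KN : gsub K N by move=> h; apply: subset_trans (LN h).
have [sK dK mK] := fK; have [sL dL mL] := fL; have [sN dN mN] := fN.
have fKy := gfam_behead fK; have fLy := gfam_behead fL; have fNy := gfam_behead fN.
have inb : (a, t) \in (a, t) :: y by exact: mem_head.
have clKL : gcls E ((a, t) :: y) K L by exact: (gcls_sub (fun h u Ku => Ku) LN cl).
have clLN : gcls E ((a, t) :: y) L N by exact: (gcls_sub KL (fun h u Nu => Nu) cl).
rewrite /=.
pose CK := coker_fam a t K N; pose CL := coker_fam a t L N.
(* [W] modulo [K + a L] is the kernel of the map between the cokernels on [L/K] and on [N/K]. *)
pose W h := L h `&` CK h.
have fCK : gfam y CK by exact: gfam_coker.
have fCL : gfam y CL by exact: gfam_coker.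
have fW : gfam y W by exact: gfamI.
have fCKL : gfam y (coker_fam a t K L) by exact: gfam_coker.
have sCK h : submodule (CK h) by case: fCK.
have CKL : gsub CK CL by move=> h; apply: addsm_mono => //; exact: KL.
have CLN : gsub CL N by exact: coker_sub fN LN.
rewrite (IH CK CL N) //; last exact: gcls_coker.
have KLW : gsub (coker_fam a t K L) W.
  move=> h v hv; split; first by move: hv; exact: (coker_sub fL KL).
  by move: hv; apply: addsm_mono => // _ [u Lu <-]; exists u => //; exact: LN.
have WL : gsub W L by move=> h u [].
rewrite (IH (coker_fam a t K L) W L) //; last exact: gcls_coker.
have -> : gsym y W L g = gsym y CK CL g.
  apply: (@gsym_iso y 1) => // h; split=> [u Lu|u [_ CKu]|u Lu CKu|v].
  - by rewrite scale1r; apply: addsm_subl => //; exact: submodule_scale.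
  - by rewrite scale1r.
  - by split=> //; move: CKu; rewrite scale1r.
  - move=> [u Lu [w [n Nn <-] <-]]; exists u => //; rewrite scale1r addrC addKr.
    by apply: addsm_subr => //; exists n.
pose Z1 := ker_fam a t K L; pose Z2 := ker_fam a t K N; pose Z3 := ker_fam a t L N.
have fZ1 : gfam y Z1 by exact: gfam_ker.
have fZ2 : gfam y Z2 by exact: gfam_ker.
have fZ3 : gfam y Z3 by exact: gfam_ker.
have sZ2 h : submodule (Z2 h) by case: fZ2.
have fK' : gfam y (K \o sh t) by exact: gfam_shift.
have fL' : gfam y (L \o sh t) by exact: gfam_shift.
have Z12 : gsub Z1 Z2 by move=> h u [/LN].
have Z23 : gsub Z2 Z3 by move=> h u [Nu /KL].
rewrite (IH (K \o sh t) Z1 Z2) //; [|exact: sub_ker fK KL|exact: gcls_ker].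
(* [V] modulo the shifted [L] is the image of the kernel on [N/K] in the kernel on [N/L]. *)
pose V h := addsm (L (sh t h)) (Z2 h).
have fV : gfam y V by exact: gfamD.
have L'Z3 : gsub (L \o sh t) Z3 by exact: sub_ker fL LN.
have L'V : gsub (L \o sh t) V by move=> h; apply: addsm_subl; exact: sZ2.
have VZ3 : gsub V Z3.
  by move=> h; apply: addsm_min; [case: fZ3|exact: L'Z3|exact: Z23].
rewrite (IH (L \o sh t) V Z3) //; last exact: gcls_ker.
have -> : gsym y Z1 Z2 g = gsym y (L \o sh t) V g.
  apply: (@gsym_iso y 1) => // h; split=> [u Zu|u [Lu _]|u [Nu Ku]|v].
  - by rewrite scale1r; exact: addsm_subr.
  - by rewrite scale1r.
  - by rewrite scale1r.
  - move=> [u Lu [w Zw <-]]; exists w => //; rewrite scale1r addrK; exact: Lu.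
(* The connecting homomorphism is multiplication by [a]; here it is an isomorphism from its coimage
   to its image. *)
have -> : gsym y V Z3 g = gsym y (coker_fam a t K L) W g.
  apply: (@gsym_iso y a) => // h; split.
  - move=> u [Nu Lu]; split=> //; apply: addsm_subr => //; exists u => //.
  - move=> _ [u Lu [w [Nw Kw] <-]]; rewrite scalerDr addrC.
    by exists (a *: w) => //; exists (a *: u) => //; exists u.
  - move=> u [Nu Lu] [k Kk [_ [l Ll <-] E1]]; exists l => //; exists (u - l).
      split; first by apply: submoduleB => //; exact: LN.
      by rewrite scalerBr -E1 addrK.
    by rewrite addrC subrK.
  - move=> v [Lv [k Kk [_ [u Nu <-] E1]]]; exists u; last first.
      by rewrite -E1 addrK; apply: addsm_subl => //; exact: submodule_scale.
    split=> //; rewrite -[a *: u](addKr k) E1 addrC; apply: submoduleB => //; exact: KL.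
ring.
Qed.

Lemma gfam_cst y (N : set M) : submodule N -> gfam y (fun=> N).
Proof. by move=> sN; split=> [//|p g _ u //|p g u _ Nu]; exact: submoduleZ. Qed.

Lemma gsym_cst y K N (K0 N0 : set M) g :
  (forall p h, p \in y -> K (sh p.2 h) = K h) ->
  (forall p h, p \in y -> N (sh p.2 h) = N h) ->
  K g = K0 -> N g = N0 -> gsym y K N g = mult_symbol (unzip1 y) K0 N0.
Proof.
elim: y K N K0 N0 => [|[a t] y IH] K N K0 N0 hK hN Kg Ng /=; first by rewrite Kg Ng.
have hKt h : K (sh t h) = K h by apply: (hK (a, t)); exact: mem_head.
have hNt h : N (sh t h) = N h by apply: (hN (a, t)); exact: mem_head.
have hKy p h : p \in y -> K (sh p.2 h) = K h by move=> py; apply: hK; rewrite inE py orbT.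
have hNy p h : p \in y -> N (sh p.2 h) = N h by move=> py; apply: hN; rewrite inE py orbT.
congr (_ - _); apply: IH => //.
- by move=> p h py; rewrite /coker_fam hKy// shC hNy.
- by rewrite /coker_fam Kg hNt Ng.
- by move=> p h py /=; rewrite shC hKy.
- by move=> p h py; rewrite /ker_fam hKy// shC hNy.
- by rewrite /= hKt.
- by rewrite /ker_fam Kg hNt Ng.
Qed.

Fixpoint gdiff (y : seq (A * T)) (f : G -> int) (g : G) : int :=
  if y is (_, t) :: y' then gdiff y' (fun h => f h - f (sh t h)) g else f g.

Lemma gdiff_sub y f1 f2 g : gdiff y (fun h => f1 h - f2 h) g = gdiff y f1 g - gdiff y f2 g.
Proof.
elim: y f1 f2 => [//|[a t] y IH] f1 f2 /=; rewrite -IH; congr gdiff.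
by apply: funext => h; ring.
Qed.

Lemma gdiff_shift y f t g : gdiff y (fun h => f (sh t h)) g = gdiff y f (sh t g).
Proof.
elim: y f => [//|[a t'] y IH] f /=; rewrite -IH; congr gdiff.
by apply: funext => h; rewrite shC.
Qed.

Lemma gdiff_rcons y a t f g :
  gdiff (rcons y (a, t)) f g = gdiff y (fun h => f h - f (sh t h)) g.
Proof. by elim: y f => [//|[b t'] y IH] f /=; rewrite IH; congr gdiff;
  apply: funext => h; rewrite shC; ring. Qed.

(** With finite lengths, multiplication by [a] identifies its coimage with its image, and these
    cancel from the difference of the lengths in degrees [h] and [sh t h]. *)
Lemma gsym_finite y K N : gfam y K -> gfam y N -> gsub K N ->
  (forall g, finite_length (K g) (N g)) ->
  forall g, gsym y K N g = gdiff y (fun h => (mlength (K h) (N h))%:Z) g.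
Proof.
elim: y K N => [//|[a t] y IH] K N fK fN KN fl g /=.
have [sK dK mK] := fK; have [sN dN mN] := fN.
have fKy := gfam_behead fK; have fNy := gfam_behead fN.
have fC : gfam y (coker_fam a t K N) by exact: gfam_coker.
have fZ : gfam y (ker_fam a t K N) by exact: gfam_ker.
have fK' : gfam y (K \o sh t) by exact: gfam_shift.
have CN := coker_sub fN KN; have KZ := sub_ker fK KN.
have [sC _ _] := fC; have [sZ _ _] := fZ.
have KC h : K h `<=` coker_fam a t K N h by apply: addsm_subl; exact: submodule_scale.
have ZN h : ker_fam a t K N h `<=` N (sh t h) by move=> u [].
have [fC1 fC2] : (forall h, finite_length (K h) (coker_fam a t K N h)) /\
    (forall h, finite_length (coker_fam a t K N h) (N h)).
  by split=> h; have [] := finite_length_sub (sK h) (sC h) (sN h) (KC h) (CN h) (fl h).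
have [fZ1 fZ2] : (forall h, finite_length (K (sh t h)) (ker_fam a t K N h)) /\
    (forall h, finite_length (ker_fam a t K N h) (N (sh t h))).
  by split=> h; have [] := finite_length_sub (sK _) (sZ h) (sN _) (KZ h) (ZN h) (fl _).
rewrite !IH // -gdiff_sub; congr gdiff; apply: funext => h.
rewrite (mlength_add (sK h) (sC h) (sN h) (KC h) (CN h) (fl h)).
rewrite (mlength_add (sK _) (sZ h) (sN _) (KZ h) (ZN h) (fl _)).
have -> : mlength (ker_fam a t K N h) (N (sh t h)) = mlength (K h) (coker_fam a t K N h).
  apply: (@scale_iso_mlength _ _ a) => //; split=> //.
  - by move=> u Nu; apply: addsm_subr => //; exists u.
  - by move=> u [].
  - by move=> v [k Kk [_ [u Nu <-] <-]]; exists u; rewrite ?addrK.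
by rewrite !PoszD /=; ring.
Qed.

End GradedSymbol.

(** * Vanishing of the symbol of a sequence longer than the dimension *)

Section Vanishing.
Context {A : comNzRingType} {M : lmodType A} (E : set A).
Hypothesis finE : forall K N : set M, submodule K -> submodule N -> K `<=` N ->
  (forall r u, E r -> N u -> K (r *: u)) -> finite_length K N.
Implicit Types (K L N : set M) (y : seq A).

Definition cls y K N : Prop := forall r, E r ->
  exists2 z, ideal_span y (r - z) & forall u, N u -> K (z *: u).

Lemma mult_symbol_add y K L N : submodule K -> submodule L -> submodule N ->
  K `<=` L -> L `<=` N -> cls y K N ->
  mult_symbol y K N = mult_symbol y K L + mult_symbol y L N.
Proof.
move=> sK sL sN KL LN cl.
pose sh (_ : unit) (g : unit) := g.
pose y' := [seq (a, tt) | a <- y].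
have Ey : unzip1 y' = y by rewrite /y' /unzip1 -map_comp map_id.
have gE K0 N0 : mult_symbol y K0 N0 = gsym sh y' (fun=> K0) (fun=> N0) tt.
  by rewrite -[y in LHS]Ey; apply/esym/gsym_cst.
rewrite !gE; apply: (@gsym_add _ _ _ _ sh (fun _ _ _ => erefl) E) => //; do ?exact: gfam_cst.
by move=> r /cl[z hz kz]; exists z; rewrite ?Ey.
Qed.

Lemma mult_symbol_same y K : submodule K -> mult_symbol y K K = 0.
Proof.
move=> sK; have : mult_symbol y K K = mult_symbol y K K + mult_symbol y K K.
  apply: mult_symbol_add => // r _; exists r; last by move=> u; exact: submoduleZ.
  by rewrite subrr; exact: (submodule0 (submodule_span _)).
by move=> h; apply: (addrI (mult_symbol y K K)); rewrite -h addr0.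
Qed.

Lemma mult_symbol_kill y b K N : submodule K -> submodule N -> K `<=` N -> b \in y ->
  (forall u, N u -> K (b *: u)) -> mult_symbol y K N = 0.
Proof.
elim: y K N => // a y IH K N sK sN KN; rewrite inE => /predU1P[->|yb] bN /=.
  have -> : addsm K [set a *: u | u in N] = K.
    apply/seteqP; split; last by apply: addsm_subl; exact: submodule_scale.
    by apply: addsm_min => // _ [u Nu <-]; exact: bN.
  have -> : [set u | N u /\ K (a *: u)] = N.
    by apply/seteqP; split=> [u []//|u Nu]; split=> //; exact: bN.
  by rewrite subrr.
have saN : submodule [set a *: u | u in N] by exact: submodule_scale.
rewrite !IH ?subrr //.
- by apply: submoduleI => //; exact: submodule_pre.
- by move=> u Ku; split; [exact: KN|exact: submoduleZ].
- by move=> u [Nu _]; exact: bN.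
- exact: submodule_addsm.
- by apply: addsm_min => // _ [u Nu <-]; exact: submoduleZ.
- by move=> u Nu; apply: addsm_subl => //; exact: bN.
Qed.

(* A prime filtration reduces the claim to N/K = A/P; there, either the first element is
   in P and kills N/K, or it is regular and dividing by it lowers the dimension. *)
Lemma mult_symbol_vanish y K N : noetherian A -> noetherian_module M ->
  submodule K -> submodule N -> K `<=` N -> cls y K N ->
  (forall l r, prime_chain [set a | forall u, N u -> K (a *: u)] l r -> (l < size y)%N) ->
  mult_symbol y K N = 0.
Proof.
move=> nA nM; elim: y K N => [|a y IHy] K N sK sN KN cl dim.
  (* For the empty sequence the bound excludes even chains of length 0, so [N/K] has no associated
     prime and vanishes. *)
  suff <- : K = N by rewrite mult_symbol_same.
  apply/seteqP; split=> // u0 Nu0; apply: contrapT => nKu0.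
  have [v [Nv nKv pP]] := associated_prime nA sK sN Nu0 nKu0.
  have /dim// : prime_chain [set a | forall u, N u -> K (a *: u)] 0
      (fun=> [set a | K (a *: v)]).
  by split=> // i _; split=> // b; exact.
move: K sK KN cl dim; apply: (noeth_ind nM) => K sK IH KN cl dim.
have [NK|] := pselect (N `<=` K).
  by have <- : K = N by [apply/seteqP]; rewrite mult_symbol_same.
move=> /existsNP[u0 /not_implyP[Nu0 nKu0]].
have [v [Nv nKv pP]] := associated_prime nA sK sN Nu0 nKu0.
set P := [set b | K (b *: v)] in pP; have [iP nP1 PM] := pP.
have sL := submodule_adjoin v sK; have KL := @adjoin_sub _ _ K v.
set L := adjoin K v in sL KL.
have LN : L `<=` N by exact: adjoin_min.
rewrite (mult_symbol_add sK sL sN KL LN cl) (IH L sL) ?addr0 //; first last.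
- move=> l r [rP rS]; apply: (dim l r); split=> // i il; have [p1 p2] := rP i il.
  by split=> // b hb; apply: p2 => u Nu; apply: KL; exact: hb.
- by move=> r /cl[z hz kz]; exists z => // u Nu; apply: KL; exact: kz.
- by split=> // /(_ v (adjoin_in v sK)).
have PL b : P b -> forall u, L u -> K (b *: u).
  move=> Pb u [c hc]; rewrite -[u](subrK (c *: v)) scalerDr; apply: (submoduleD sK).
    exact: submoduleZ.
  by rewrite scalerA mulrC -scalerA; exact: submoduleZ.
have [Pa|nPa] := pselect (P a).
  by apply: (@mult_symbol_kill _ a) => //; [exact: mem_head|exact: PL].
have saL : submodule [set a *: u | u in L] by exact: submodule_scale.
rewrite /=; have -> : [set u | L u /\ K (a *: u)] = K.
  apply/seteqP; split=> [u [[c hc] Kau]|u Ku]; last first.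
    by split; [exact: KL|exact: submoduleZ].
  have Pac : P (a * c).
    rewrite /P /= -scalerA -[c *: v](subKr u) scalerBr; apply: (submoduleB sK) => //.
    exact: submoduleZ.
  rewrite -[u](subrK (c *: v)); apply: (submoduleD sK) => //.
  by have [/nPa|] := PM _ _ Pac.
rewrite mult_symbol_same // subr0; apply: IHy => //.
- exact: submodule_addsm.
- by apply: addsm_min => // _ [u Lu <-]; exact: submoduleZ.
- move=> r /cl[z /= hz kz]; have /(@span_cons _ A^o)[e he] := hz.
  exists (z + e * a); first by rewrite opprD addrA.
  move=> u Lu; rewrite scalerDl -scalerA scalerA mulrC -scalerA.
  have sT : submodule (addsm K [set a *: u | u in L]) by exact: submodule_addsm.
  apply: (submoduleD sT); first by apply: addsm_subl => //; apply: kz; exact: LN.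
  by apply: addsm_subr => //; exists (e *: u) => //; exact: submoduleZ.
(* Since [a] is outside [P], a chain over the annihilator of the cokernel starts strictly above [P],
   and [P] can be added at its bottom. *)
move=> l r [rP rS]; rewrite -ltnS; pose r' i := if i is j.+1 then r j else P.
apply: (dim l.+1 r'); split=> [[|i] il|[|i] il] /=.
- by split=> // b hb; exact: hb.
- have [p1 p2] := rP i il; split=> // b hb; apply: p2 => u Lu.
  by apply: addsm_subl => //; apply: hb; exact: LN.
- have [p1 p2] := rP 0%N (leq0n _); split.
    by move=> b Pb; apply: p2 => u Lu; apply: addsm_subl => //; exact: PL.
  move=> /(_ a) h; apply: nPa; apply: h; apply: p2 => u Lu.
  by apply: addsm_subr => //; exists u.
- exact: rS.
Qed.

End Vanishing.

(** * Noetherian multigraded families *)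

Section GradedNoetherian.
Context {A : comNzRingType} {M : lmodType A} {G : Type} {T : eqType}.
Variable up : T -> G -> G.
Hypothesis upC : forall t t' g, up t (up t' g) = up t' (up t g).
Hypothesis up_inj : forall t, injective (up t).
Implicit Types (K L N : G -> set M) (y : seq (A * T)).

Definition ufam y N : Prop := (forall g, submodule (N g)) /\
  forall p g u, p \in y -> N g u -> N (up p.2 g) (p.1 *: u).

Definition gnoetherian y N : Prop := forall L : nat -> G -> set M,
  (forall n, ufam y (L n)) -> (forall n g, L n g `<=` L n.+1 g) ->
  (forall n g, L n g `<=` N g) ->
  exists p, forall n, (p <= n)%N -> forall g, L n g `<=` L p g.

Section Adjoin.
Variables (a : A) (t : T) (y : seq (A * T)) (N0 : G -> set M).
Hypotheses (N0fam : ufam y N0) (N0noeth : gnoetherian y N0).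

(* The polynomials of degree less than k in a, with coefficients in N0. *)
Let Lt k h : set M := span [set v | exists j g u,
  [/\ (j < k)%N, h = iter j (up t) g, N0 g u & v = a ^+ j *: u]].

Definition gadjoin h : set M := [set u | exists k, Lt k h u].

Let sLt k h : submodule (Lt k h). Proof. exact: submodule_span. Qed.

Let Lt_mono k k' h : (k <= k')%N -> Lt k h `<=` Lt k' h.
Proof.
move=> kk'; apply: span_min => // _ [j [g [u [jk hg Nu ->]]]]; apply: span_in.
by exists j, g, u; split=> //; exact: leq_trans kk'.
Qed.

Let Lt0 h u : Lt 0 h u -> u = 0.
Proof.
suff H : Lt 0 h `<=` [set 0] by move=> /H.
by apply: span_min => // v [j [g [w []]]].
Qed.

Let Lt_up k h u : Lt k h u -> Lt k.+1 (up t h) (a *: u).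
Proof.
suff H : Lt k h `<=` [set u | Lt k.+1 (up t h) (a *: u)] by move=> /H.
apply: span_min; first exact: submodule_pre.
move=> _ [j [g [v [jk -> Nv ->]]]]; apply: span_in.
by exists j.+1, g, v; split=> //; rewrite scalerA exprS.
Qed.

Let iter_upC k t' h : iter k (up t) (up t' h) = up t' (iter k (up t) h).
Proof. by elim: k => //= k ->. Qed.

Let Lt_stable p k h u : p \in y -> Lt k h u -> Lt k (up p.2 h) (p.1 *: u).
Proof.
move=> py; suff H : Lt k h `<=` [set u | Lt k (up p.2 h) (p.1 *: u)] by move=> /H.
apply: span_min; first exact: submodule_pre.
move=> _ [j [g [v [jk -> Nv ->]]]]; apply: span_in.
exists j, (up p.2 g), (p.1 *: v); split=> //.
  exact: N0fam.2.
by rewrite !scalerA mulrC.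
Qed.

Let iter_up_inj k : injective (iter k (up t)).
Proof. by elim: k => [|k IH] g g' //= /up_inj /IH. Qed.

(** Injectivity of [up t] leaves only one degree [g] for the leading coefficient once [h] and [k]
    are given, so leading coefficients can be added. *)
Let LtS k h z : Lt k.+1 h z -> Lt k h z \/
  exists g u, [/\ h = iter k (up t) g, N0 g u & Lt k h (z - a ^+ k *: u)].
Proof.
suff H : Lt k.+1 h `<=` [set z | Lt k h z \/
  exists g u, [/\ h = iter k (up t) g, N0 g u & Lt k h (z - a ^+ k *: u)]] by move=> /H.
have [sN0 _] := N0fam.
apply: span_min; first split; first by left; exact: (submodule0 (sLt k h)).
  have [[g hg]|ng] := pselect (exists g, h = iter k (up t) g); last first.
    move=> c u v [Lu|[g [w [hg]]]]; last by case: ng; exists g.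
    case=> [Lv|[g [w [hg]]]]; last by case: ng; exists g.
    by left; apply (sLt k h).
  have R z' : Lt k h z' \/ (exists g u, [/\ h = iter k (up t) g,
    N0 g u & Lt k h (z' - a ^+ k *: u)]) ->
      exists2 u, N0 g u & Lt k h (z' - a ^+ k *: u).
    case=> [Lz|[g' [u [hg' Nu Lz]]]].
      by exists 0; [exact: submodule0|rewrite scaler0 subr0].
    by exists u => //; move: Nu; congr N0; apply: (iter_up_inj (k := k)); rewrite -hg'.
  move=> c u v /R[u1 Nu1 Lu1] /R[v1 Nv1 Lv1]; right; exists g, (c *: u1 + v1); split=> //.
    by apply (sN0 g).
  rewrite scalerDr scalerA mulrC -scalerA opprD addrACA -scalerBr.
  by apply (sLt k h).
move=> _ [j [g [u [jk hg Nu ->]]]].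
move: jk; rewrite ltnS leq_eqVlt => /predU1P[Ej|jk].
  right; exists g, u; split=> //; rewrite -?Ej // subrr; exact: (submodule0 (sLt _ _)).
by left; apply: span_in; exists j, g, u.
Qed.

Lemma ufam_gadjoin : ufam ((a, t) :: y) gadjoin.
Proof.
split=> [g|p g u].
  split; first by exists 0%N; exact: (submodule0 (sLt _ _)).
  move=> c u v [k Lu] [k' Lv]; exists (maxn k k'); apply (sLt _ g).
  - by apply: Lt_mono Lu; exact: leq_maxl.
  - by apply: Lt_mono Lv; exact: leq_maxr.
rewrite inE => /predU1P[->|py] [k Lu]; first by exists k.+1; exact: Lt_up.
by exists k; exact: Lt_stable.
Qed.

Lemma gadjoin_sub g : N0 g `<=` gadjoin g.
Proof.
by move=> u Nu; exists 1%N; apply: span_in; exists 0%N, g, u; split=> //; rewrite expr0 scale1r.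
Qed.

(* Hilbert's basis theorem: U k n consists of the leading coefficients of the elements of
   L n that have degree k in a. *)
Lemma gnoetherian_gadjoin : gnoetherian ((a, t) :: y) gadjoin.
Proof.
move=> L Lfam LS LN; have [sN0 mN0] := N0fam.
have sL n g : submodule (L n g) by case: (Lfam n).
have La n g u : L n g u -> L n (up t g) (a *: u).
  by case: (Lfam n) => _ h; apply: (h (a, t)); exact: mem_head.
have Ly n p g u : p \in y -> L n g u -> L n (up p.2 g) (p.1 *: u).
  by move=> py; case: (Lfam n) => _; apply; rewrite inE py orbT.
have Lle i j g : (i <= j)%N -> L i g `<=` L j g.
  elim: j => [|j IHj]; first by rewrite leqn0 => /eqP->.
  by rewrite leq_eqVlt => /predU1P[->//|/IHj h]; apply: subset_trans h (LS j g).
pose U k n g := [set u | N0 g u /\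
  addsm (L n (iter k (up t) g)) (Lt k (iter k (up t) g)) (a ^+ k *: u)].
have Ufam k n : ufam y (U k n).
  split=> [g|p g u py [Nu [l Ll [w Lw E]]]].
    apply: submoduleI => //; apply: submodule_pre; exact: submodule_addsm.
  split; first exact: mN0.
  rewrite scalerA mulrC -scalerA -E scalerDr iter_upC.
  by exists (p.1 *: l); [exact: Ly|exists (p.1 *: w) => //; exact: Lt_stable].
have UnS k n g : U k n g `<=` U k n.+1 g.
  by move=> u [Nu h]; split=> //; apply: addsm_mono h => //; exact: LS.
have UkS k n g : U k n g `<=` U k.+1 n g.
  move=> u [Nu [l Ll [w Lw E]]]; split=> //; rewrite exprS -scalerA -E scalerDr.
  by exists (a *: l); [exact: La|exists (a *: w) => //; exact: Lt_up].
have UN k n g : U k n g `<=` N0 g by move=> u [].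
have Ule k k' n n' g : (k <= k')%N -> (n <= n')%N -> U k n g `<=` U k' n' g.
  move=> kk' nn'; apply: (@subset_trans _ (U k' n g)).
    elim: k' kk' => [|k' IH]; first by rewrite leqn0 => /eqP->.
    rewrite leq_eqVlt => /predU1P[->//|/IH h]; exact: subset_trans h (UkS _ _ _).
  elim: n' nn' => [|n' IH]; first by rewrite leqn0 => /eqP->.
  rewrite leq_eqVlt => /predU1P[->//|/IH h]; exact: subset_trans h (UnS _ _ _).
(* The diagonal chain settles all [k] from [p] on at once; the finitely many smaller [k] are settled
   one by one. *)
have [|p hp] := @N0noeth (fun n => U n n) (fun n => Ufam n n) _ (fun n => UN n n).
  by move=> n g; exact: Ule.
have [q hq] : exists q, forall k, (k < p)%N -> forall n, (q <= n)%N -> forall g,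
  U k n g `<=` U k q g.
  elim: (p) => [|p' [q hq]]; first by exists 0%N.
  have [q' hq'] := @N0noeth (U p') (Ufam p') (UnS p') (UN p').
  exists (maxn q q') => k; rewrite ltnS leq_eqVlt => /predU1P[->|kp] n;
    rewrite geq_max => /andP[qn q'n] g.
    by apply: (subset_trans (hq' n q'n g)); apply: Ule => //; exact: leq_maxr.
  by apply: (subset_trans (hq k kp n qn g)); apply: Ule => //; exact: leq_maxl.
exists (maxn p q) => n hn g.
have hU k g' : U k n g' `<=` U k (maxn p q) g'.
  have [kp|pk] := ltnP k p.
    apply: (subset_trans (hq k kp n _ g')); first by apply: leq_trans hn; exact: leq_maxr.
    by apply: Ule => //; exact: leq_maxr.
  apply: (@subset_trans _ (U (maxn k n) (maxn k n) g')).
    by apply: Ule; [exact: leq_maxl|exact: leq_maxr].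
  apply: (subset_trans (hp _ _ g')); first by apply: (leq_trans pk); exact: leq_maxl.
  by apply: Ule => //; exact: leq_maxl.
(* Descent on the degree in [a]: an element of [L (maxn p q)] with the same leading coefficient is
   subtracted. *)
have key k : forall h z, L n h z -> Lt k h z -> L (maxn p q) h z.
  elim: k => [|k IH] h z Lz; first by move=> /Lt0->; exact: (submodule0 (sL _ _)).
  move=> /LtS[|[g' [u [hg Nu Lzu]]]]; first exact: IH.
  have [_ /addsmE[w Lw Lzw]] : U k (maxn p q) g' u.
    apply: hU; split=> //; exists z; first by rewrite -hg.
    exists (- (z - a ^+ k *: u)); first by rewrite -hg; exact: (submoduleN (sLt _ _)).
    by rewrite opprB addrC subrK.
  rewrite -hg in Lw Lzw.
  rewrite -[z](subrK (a ^+ k *: u - w)); apply: (submoduleD (sL _ _)) => //.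
  apply: IH; last by rewrite opprB addrCA addrC; exact: (submoduleD (sLt k h) Lzu Lw).
  apply: (submoduleB (sL _ _)) => //; apply: (Lle _ _ _ hn); exact: Lzw.
by move=> z Lz; have [k hk] := LN n g z Lz; exact: (key k g z).
Qed.

End Adjoin.

(** [M] alone in degree [g0] is Noetherian for the empty sequence, and the variables are adjoined
    one at a time. The result will serve as a Noetherian family containing the Rees module of
    [M]. *)
Lemma gnoetherian_exists y g0 : noetherian_module M ->
  exists N, [/\ ufam y N, gnoetherian y N & forall u, N g0 u].
Proof.
move=> nM; elim: y => [|[a t] y [N [fN nN N0]]].
  exists (fun g => [set u | u = 0 \/ g = g0]); split=> [|L Lfam LS LN|u]; last by right.
    split=> // g; split; first by left.
    by move=> c u v [->|Eg] [->|Eg']; [left; rewrite scaler0 addr0|right..].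
  have [n|n|p hp] := @acc _ _ (fun n => L n g0) nM; first by case: (Lfam n).
    exact: LS.
  exists p => n pn g; have [Eg|ng] := pselect (g = g0); first by rewrite Eg (hp n pn).
  move=> u /LN[->|//]; have [sL _] := Lfam p; exact: submodule0.
exists (gadjoin a t N); split.
- exact: ufam_gadjoin.
- exact: gnoetherian_gadjoin fN nN.
- by move=> u; apply: gadjoin_sub.
Qed.

End GradedNoetherian.

(** * Multi-indices, differences and polynomials *)

Section MultiIndex.
Context {D : nat}.
Implicit Types (g e : 'I_D -> nat).

Definition up (i : 'I_D) g : 'I_D -> nat := fun j => (g j + (j == i))%N.
Definition dn (i : 'I_D) g : 'I_D -> nat := fun j => (g j - (j == i))%N.
Definition madd g e : 'I_D -> nat := fun j => (g j + e j)%N.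
Definition mle g e : Prop := forall j, (g j <= e j)%N.
Definition mcst (b : nat) : 'I_D -> nat := fun=> b.

Lemma dnC i j g : dn i (dn j g) = dn j (dn i g).
Proof. by apply: funext => k; rewrite /dn subnAC. Qed.

Lemma upC i j g : up i (up j g) = up j (up i g).
Proof. by apply: funext => k; rewrite /up addnAC. Qed.

Lemma up_inj i : injective (up i).
Proof.
move=> g e E; apply: funext => j; have := congr1 (fun f => f j) E.
by rewrite /up => /addIn.
Qed.

Lemma dn_up i g : dn i (up i g) = g.
Proof. by apply: funext => j; rewrite /dn /up addnK. Qed.

Lemma up_dn i g : (0 < g i)%N -> up i (dn i g) = g.
Proof.
move=> gi; apply: funext => j; rewrite /dn /up subnK//.
by case: eqP => // ->.
Qed.

Definition nval g : 'I_D -> rat := fun j => (g j)%:R.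
Definition vdn (i : 'I_D) (v : 'I_D -> rat) : 'I_D -> rat := fun j => v j - (j == i)%:R.

Lemma nval_dn i g : (0 < g i)%N -> nval (dn i g) = vdn i (nval g).
Proof.
move=> gi; apply: funext => j; rewrite /nval /vdn /dn natrB//.
by case: eqP => // ->.
Qed.

Definition epoly (f : ('I_D -> nat) -> int) : Prop :=
  exists (P : {mpoly rat[D]}) (b : nat), forall g, mle (mcst b) g -> (f g)%:~R = P.@[nval g].

Lemma epoly0 f b : (forall g, mle (mcst b) g -> f g = 0) -> epoly f.
Proof. by move=> f0; exists 0, b => g /f0->; rewrite meval0. Qed.

Lemma epolyB f1 f2 : epoly f1 -> epoly f2 -> epoly (fun g => f1 g - f2 g).
Proof.
move=> [P1 [b1 h1]] [P2 [b2 h2]]; exists (P1 - P2), (maxn b1 b2) => g hg.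
rewrite mevalB intrB h1 ?h2// => j; apply: leq_trans (hg j).
  exact: leq_maxr.
exact: leq_maxl.
Qed.

(* The rising factorials of X_i form a basis on which the backward difference acts as
   differentiation acts on powers. *)
Lemma antidifference (i : 'I_D) (Q : {mpoly rat[D]}) :
  exists S : {mpoly rat[D]}, forall v, S.@[v] - S.@[vdn i v] = Q.@[v].
Proof.
pose anti (Q : {mpoly rat[D]}) := exists S : {mpoly rat[D]}, forall v, S.@[v] - S.@[vdn i v] =
  Q.@[v].
have antiD P1 P2 : anti P1 -> anti P2 -> anti (P1 + P2).
  move=> [S1 h1] [S2 h2]; exists (S1 + S2) => v.
  by rewrite !mevalD -h1 -h2; ring.
have antiZ c P1 : anti P1 -> anti (c *: P1).
  by move=> [S1 h1]; exists (c *: S1) => v; rewrite !mevalZ -h1; ring.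
pose rf k : {mpoly rat[D]} := \prod_(l < k) ('X_i + l%:R%:MP).
have rfE k v : (rf k).@[v] = \prod_(l < k) (v i + l%:R).
  rewrite /rf (big_morph (meval v) (mevalM v) (meval1 v)); apply: eq_bigr => l _.
  by rewrite mevalD mevalXU mevalC.
have antirf R k l : (forall v, R.@[vdn i v] = R.@[v]) -> anti ('X_i ^+ k * rf l * R).
  move=> hR; elim: k l => [|k IH] l.
    exists (l.+1%:R^-1 *: (rf l.+1 * R)) => v.
    rewrite expr0 mul1r !mevalZ !mevalM hR !rfE -mulrBr -mulrBl.
    have -> : \prod_(j < l.+1) (vdn i v i + j%:R) = (v i - 1) * \prod_(j < l) (v i + j%:R).
      rewrite big_ord_recl /= addr0 /vdn eqxx; congr (_ * _).
      by apply: eq_bigr => j _; rewrite /bump leq0n add1n -natr1 -[nat_of_bool true]/1%N; ring.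
    rewrite big_ord_recr /=; set p := \prod_(_ < _) _.
    have nz : l.+1%:R != 0 :> rat by rewrite Num.Theory.pnatr_eq0.
    by rewrite -natr1 in nz *; field.
  (* A power of ['X_i] is traded for a longer rising factorial through
     ['X_i * rf l = rf l.+1 - l * rf l]. *)
  have -> : 'X_i ^+ k.+1 * rf l * R = 'X_i ^+ k * rf l.+1 * R + - l%:R *: ('X_i ^+ k * rf l * R).
    rewrite /rf big_ord_recr /= exprSr -/(rf l) -mul_mpolyC mpolyCN; ring.
  by apply: antiD; [exact: IH|apply: antiZ; exact: IH].
rewrite -/(anti Q) [Q]mpolyE; elim/big_rec: _ => [|m P _ hP].
  by exists 0 => v; rewrite !meval0 subr0.
apply: antiD => //; apply: antiZ.
pose R : {mpoly rat[D]} := \prod_(j < D | j != i) 'X_j ^+ m j.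
have RE v : R.@[v] = \prod_(j < D | j != i) v j ^+ m j.
  rewrite /R (big_morph (meval v) (mevalM v) (meval1 v)); apply: eq_bigr => l _.
  by rewrite rmorphXn /= mevalXU.
have [|S hS] := antirf R (m i) 0%N.
  move=> v; rewrite !RE; apply: eq_bigr => j ji.
  by rewrite /vdn (negPf ji) subr0.
exists S => v; rewrite hS !mevalM rfE big_ord0 mulr1 RE rmorphXn /= mevalXU.
by rewrite mevalX [RHS](bigD1 i).
Qed.

(** The coordinates are first frozen at [b], then released one at a time: along coordinate [i] the
    polynomial [Q i] is summed from [b] on, and its antidifference [S] telescopes. The substitution
    [sub] freezes the coordinate being released. *)
Lemma epoly_of_diff f : (forall i, epoly (fun g => f g - f (dn i g))) -> epoly f.
Proof.
move=> hf.
have [Q hQ] : {Q : 'I_D -> {mpoly rat[D]} & forall i, exists b, forall g,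
    mle (mcst b) g -> (f g - f (dn i g))%:~R = (Q i).@[nval g]}.
  by apply: (@choice _ _ (fun i P => exists b, forall g,
    mle (mcst b) g -> (f g - f (dn i g))%:~R = P.@[nval g])).
have [bb hbb] := choice hQ.
pose b := \max_i bb i.
have hb i g : mle (mcst b) g -> (f g)%:~R = (f (dn i g))%:~R + (Q i).@[nval g].
  move=> bg; rewrite -hbb ?intrB; first by rewrite addrC subrK.
  by move=> j; apply: leq_trans (bg j); exact: leq_bigmax.
suff H l : (l <= D)%N -> exists P : {mpoly rat[D]}, forall g, mle (mcst b) g ->
    (forall j : 'I_D, (l <= j)%N -> g j = b) -> (f g)%:~R = P.@[nval g].
  have [P hP] := H D (leqnn D); exists P, b => g bg; apply: hP => // j.
  by rewrite leqNgt ltn_ord.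
elim: l => [|l IH] lD.
  exists (f (mcst b))%:~R%:MP => g bg gb; rewrite mevalC; congr (f _)%:~R.
  by apply: funext => j; rewrite gb.
have [P hP] := IH (ltnW lD); pose i := Ordinal lD.
have [S hS] := antidifference i (Q i).
pose sub : D.-tuple {mpoly rat[D]} := [tuple if j == i then b%:R%:MP else 'X_j | j < D].
exists ((P \mPo sub) + S - (S \mPo sub)) => g bg gb.
pose g0 : 'I_D -> nat := fun j => if j == i then b else g j.
have subE (R : {mpoly rat[D]}) : (R \mPo sub).@[nval g] = R.@[nval g0].
  rewrite comp_mpoly_meval; apply: meval_eq => j; rewrite tnth_mktuple /nval /g0.
  by case: eqP => _; rewrite ?mevalC ?mevalXU.
rewrite mevalB mevalD !subE.
rewrite -(hP g0); first last.
- move=> j lj; rewrite /g0; case: eqP => // /eqP ji; apply: gb.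
  by rewrite ltn_neqAle lj andbT eq_sym -[l]/(nat_of_ord i).
- by move=> j; rewrite /g0; case: eqP => // _; exact: leqnn.
suff key k : forall h, mle (mcst b) h -> (h i - b)%N = k -> (forall j, j != i -> h j = g0 j) ->
    (f h)%:~R = (f g0)%:~R + S.@[nval h] - S.@[nval g0].
  by apply: (key _ g bg erefl) => j ji; rewrite /g0 (negPf ji).
elim: k => [|k IHk] h bh hk hj.
  have -> : h = g0.
    apply: funext => j; have [->|/hj//] := eqVneq j i.
    by have := bh i; rewrite /g0 eqxx /mcst; lia.
  by rewrite addrK.
have hi : (b < h i)%N by lia.
rewrite (hb i) // -hS -nval_dn; last exact: leq_ltn_trans hi.
rewrite (IHk (dn i h)).
- by ring.
- by move=> j; rewrite /dn; have [->|_] := eqVneq j i; rewrite /mcst ?subn0; [lia|exact: bh].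
- by rewrite /dn eqxx; lia.
- by move=> j ji; rewrite /dn (negPf ji) subn0 hj.
Qed.

(** * Reading off coefficients by iterated differences *)

Fixpoint vdiff (ds : seq 'I_D) (f : ('I_D -> rat) -> rat) (v : 'I_D -> rat) : rat :=
  if ds is i :: ds' then vdiff ds' (fun w => f w - f (vdn i w)) v else f v.

Lemma vdiff_cat ds ds' f v : vdiff (ds ++ ds') f v = vdiff ds' (fun w => vdiff ds f w) v.
Proof. by elim: ds f => //= i ds IH f; rewrite IH. Qed.

Lemma vdiff_sum (I : eqType) (r : seq I) (c : I -> rat) (F : I -> ('I_D -> rat) -> rat) ds v :
  vdiff ds (fun w => \sum_(m <- r) c m * F m w) v = \sum_(m <- r) c m * vdiff ds (F m) v.
Proof.
elim: ds F => //= i ds IH F; rewrite -IH; congr vdiff; apply: funext => w.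
by rewrite -sumrB; apply: eq_bigr => m _; rewrite mulrBr.
Qed.

Definition udiff (h : rat -> rat) : rat -> rat := fun x => h x - h (x - 1).

Lemma vdiff_prod ds (h : 'I_D -> rat -> rat) v :
  vdiff ds (fun w => \prod_j h j (w j)) v = \prod_j iter (count_mem j ds) udiff (h j) (v j).
Proof.
elim: ds h => //= i ds IH h.
pose h' j := if j == i then udiff (h i) else h j.
transitivity (vdiff ds (fun w => \prod_j h' j (w j)) v).
  congr vdiff; apply: funext => w; rewrite !(bigD1 i (P := predT))//= /h' eqxx.
  rewrite [X in _ - _ * X](eq_bigr (fun j => h j (w j))); last first.
    by move=> j /negPf ji; rewrite /vdn ji subr0.
  rewrite [X in _ = _ * X](eq_bigr (fun j => h j (w j))); last by move=> j /negPf ->.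
  by rewrite -mulrBl /udiff /vdn eqxx.
rewrite IH; apply: eq_bigr => j _; rewrite /h' (eq_sym i).
by case: (eqVneq j i) => [->|_]; rewrite ?add0n // -iterSr.
Qed.

Lemma udiff_mulX k h x : iter k.+1 udiff (fun z => z * h z) x =
  x * iter k.+1 udiff h x + k.+1%:R * iter k udiff h (x - 1).
Proof.
elim: k x => [|k IH] x; first by rewrite /= /udiff; ring.
have E n f z : iter n.+1 udiff f z = iter n udiff f z - iter n udiff f (z - 1) by [].
rewrite E !IH (E k.+1) (E k h (x - 1)) -[k.+2%:R]natr1.
by set a := iter _ _ _ x; set b := iter _ _ _ _; set c := iter _ _ _ _; ring.
Qed.

Lemma udiff0 k x : iter k udiff (fun=> 0) x = 0.
Proof. by elim: k x => //= k IH x; rewrite /udiff !IH subrr. Qed.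

Lemma udiff_expX m k x : (m <= k)%N ->
  iter k udiff (fun z => z ^+ m) x = (if m == k then k`!%:R else 0).
Proof.
elim: m k x => [|m IH] k x mk.
  case: k mk => [|k] _; first by rewrite /= expr0 fact0.
  rewrite iterSr; have -> : udiff (fun z => z ^+ 0) = (fun=> 0 : rat).
    by apply: funext => z; rewrite /udiff !expr0 subrr.
  exact: udiff0.
case: k mk => // k mk.
have -> : (fun z : rat => z ^+ m.+1) = (fun z => z * z ^+ m).
  by apply: funext => z; rewrite exprS.
rewrite udiff_mulX !IH//; last exact: ltnW.
rewrite ltn_eqF ?ltnS // eqSS mulr0 add0r; case: eqP => _; last by rewrite mulr0.
by rewrite factS natrM.
Qed.

(** A monomial whose exponent is below that of [m] in some variable is killed by the differences in
    that variable; the hypothesis removes all the others except [m] itself. *)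
Lemma vdiff_mcoeff (P : {mpoly rat[D]}) (m : 'X_{1..D}) ds v :
  (forall j, count_mem j ds = m j) ->
  (forall m' : 'X_{1..D}, (forall j, (m j <= m' j)%N) -> m' != m -> P@_m' = 0) ->
  vdiff ds (fun w => P.@[w]) v = P@_m * (\prod_j (m j)`!)%:R.
Proof.
move=> cm hP.
have -> : (fun w => P.@[w]) = (fun w => \sum_(m' <- msupp P) P@_m' * \prod_i w i ^+ m' i).
  by apply: funext => w; rewrite mevalE.
have termE (m' : 'X_{1..D}) : P@_m' * vdiff ds (fun w => \prod_i w i ^+ m' i) v =
    if m' == m then P@_m * (\prod_j (m j)`!)%:R else 0.
  rewrite (vdiff_prod ds (fun j z => z ^+ m' j)).
  have [mm'|/existsNP[j /negP]] := pselect (forall j, (m j <= m' j)%N); last first.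
    rewrite -ltnNge => mj; rewrite (bigD1 j)//= udiff_expX; last by rewrite cm ltnW.
    rewrite cm ltn_eqF// mul0r mulr0; case: eqP => // E.
    by rewrite E ltnn in mj.
  have [->|ne] := eqVneq m' m; last by rewrite hP// mul0r.
  rewrite natr_prod; congr (_ * _); apply: eq_bigr => j _.
  by rewrite udiff_expX cm ?eqxx.
rewrite vdiff_sum (eq_bigr _ (fun m' _ => termE m')).
have [mP|mP] := boolP (m \in msupp P).
  by rewrite (bigD1_seq m)//= eqxx [X in _ + X]big1 ?addr0// => m' /negPf ->.
rewrite [LHS]big1_seq ?(memN_msupp_eq0 mP) ?mul0r// => m' /= m'P.
by case: eqP => // E; rewrite E (negPf mP) in m'P.
Qed.

Lemma count_exists (e : 'I_D -> nat) : exists ds, forall j, count_mem j ds = e j.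
Proof.
exists (\big[cat/[::]]_i nseq (e i) i) => j.
rewrite (big_morph (count_mem j) (count_cat _) erefl).
rewrite (bigD1 j)//= count_nseq /= eqxx mul1n big1 ?addn0// => i ij.
by rewrite count_nseq /= (negPf ij) mul0n.
Qed.

Lemma vdiff_grid_cst f b c ds g : (forall g, mle (mcst b) g -> f (nval g) = c) ->
  mle (mcst (b + size ds)%N) g -> vdiff ds f (nval g) = if ds is [::] then c else 0.
Proof.
elim: ds f b c => [|i ds IH] f b c hf hg /=; first by apply: hf; rewrite addn0 in hg.
rewrite (IH _ b.+1 0); first by case: (ds).
  move=> h bh; rewrite -nval_dn; last exact: leq_ltn_trans (bh i).
  rewrite !hf ?subrr// => j; last exact: ltnW (bh j).
  by have := bh j; rewrite /mcst /dn; case: (j == i) => /=; lia.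
by move=> j; have := hg j; rewrite /mcst /= addnS.
Qed.

(** The coefficients above [m] are first shown to vanish, from the largest total degree down: the
    differences of order [m'] isolate the coefficient at [m'] times a product of factorials, and
    they are further differences of a constant, hence 0. *)
Lemma mcoeff_of_vdiff (P : {mpoly rat[D]}) (m : 'X_{1..D}) ds b c :
  (forall j, count_mem j ds = m j) ->
  (forall g, mle (mcst b) g -> vdiff ds (fun w => P.@[w]) (nval g) = c) ->
  (\prod_j (m j)`!)%:R * P@_m = c.
Proof.
move=> cm hc.
have mdegS (m1 m2 : 'X_{1..D}) : (forall j, (m1 j <= m2 j)%N) -> m2 != m1 ->
    exists2 j, (m1 j < m2 j)%N & (mdeg m1 < mdeg m2)%N.
  move=> le12 ne; have [j lt12] : exists j, (m1 j < m2 j)%N.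
    apply: contrapT => h; move/eqP: ne; apply; apply/mnmP => j; apply/eqP.
    by rewrite eqn_leq le12 andbT leqNgt; apply/negP => ltj; apply: h; exists j.
  exists j => //; rewrite !mdegE (bigD1 j)//= [X in (_ < X)%N](bigD1 j)//= -addSn.
  by apply: leq_add => //; apply: leq_sum.
have hP n : forall m' : 'X_{1..D}, (forall j, (m j <= m' j)%N) -> m' != m ->
    (msize P - mdeg m' <= n)%N -> P@_m' = 0.
  elim: n => [|n IH] m' mm' ne hn.
    by apply: memN_msupp_eq0; apply/negP => /msize_mdeg_lt; lia.
  have [ds' cds'] := count_exists (fun j => m' j - m j)%N.
  have cnt j : count_mem j (ds ++ ds') = m' j by rewrite count_cat cm cds' subnKC.
  have above (m2 : 'X_{1..D}) : (forall j, (m' j <= m2 j)%N) -> m2 != m' -> P@_m2 = 0.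
    move=> le2 ne2; have [j _ lt2] := mdegS _ _ le2 ne2.
    have [j' ltj' _] := mdegS _ _ mm' ne.
    apply: IH; last by lia.
    - by move=> i; apply: leq_trans (le2 i).
    - by apply/eqP => E; move: (le2 j'); rewrite E leqNgt ltj'.
  have := vdiff_mcoeff (nval (mcst (b + size ds')%N)) cnt above.
  rewrite vdiff_cat (vdiff_grid_cst hc)//.
  have [j ltj _] := mdegS _ _ mm' ne.
  case: ds' cds' {cnt} => [|i ds'] cds'; first by have := cds' j => /=; lia.
  move/esym/eqP; rewrite mulf_eq0 => /orP[/eqP//|].
  rewrite Num.Theory.pnatr_eq0 -leqn0 leqNgt => /negP[]; apply: prodn_gt0 => l.
  exact: fact_gt0.
rewrite mulrC -(vdiff_mcoeff (nval (mcst b)) cm); first by apply: hc => j; exact: leqnn.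
by move=> m' mm' ne; apply: (hP (msize P)) => //; exact: leq_subr.
Qed.

End MultiIndex.

(** * Multigraded families over products of ideals *)

Section PowerProducts.
Context {A : comNzRingType} {D : nat} (aa : 'I_D -> idl A).
Implicit Types (g h e : 'I_D -> nat).

Definition pw e : idl A := \big[idlM/idl1]_(i < D) idlX (aa i) (e i).

Lemma pwE e : pw e = prodid aa e :> set A.
Proof. by rewrite prodidE. Qed.

Lemma pwD g e : pw (madd g e) = idlM (pw g) (pw e).
Proof. by rewrite /pw -big_split; apply: eq_bigr => i _; exact: idlXD. Qed.

Lemma pw0 : pw (mcst 0) = idl1.
Proof. by rewrite /pw big1. Qed.

Definition unit_mi (i : 'I_D) : 'I_D -> nat := fun j => (j == i).

Lemma pw1 i : pw (unit_mi i) = aa i.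
Proof.
rewrite /pw (bigD1 i)//= /unit_mi eqxx idlX1 big1 ?(idlMC _ idl1) ?idl1M// => j /negPf ->.
by [].
Qed.

Lemma pw_mono g h : mle g h -> pw h `<=` pw g.
Proof.
move=> gh; have -> : h = madd g (fun j => (h j - g j)%N).
  by apply: funext => j; rewrite /madd subnKC.
by rewrite pwD; apply: mulid_subl; exact: idl_ideal.
Qed.

Lemma pwX e n : idlX (pw e) n = pw (fun j => (e j * n)%N).
Proof.
elim: n => [|n IH]; first by rewrite /pw [RHS]big1// => i _; rewrite muln0.
rewrite idlXS IH -pwD; congr pw; apply: funext => j; by rewrite /madd mulnS.
Qed.

Lemma pw_dn i g : (0 < g i)%N -> pw g = idlM (aa i) (pw (dn i g)).
Proof.
by move=> gi; rewrite -pw1 idlMC -pwD -[in LHS](up_dn gi).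
Qed.

End PowerProducts.

Section Families.
Context {A : comNzRingType} {M : lmodType A} {D : nat} (aa : 'I_D -> idl A).
Implicit Types (g h e : 'I_D -> nat) (N K : ('I_D -> nat) -> set M) (y : seq (A * 'I_D)).

Local Notation pw := (pw aa).

Definition powfam g : set M := mulsm (pw g) [set: M].

(** Stable under the Rees algebra and decreasing in the degree, as for graded modules over the
    extended Rees algebra. Kernels and cokernels of a single element stay in this class. *)
Definition mfam N : Prop := [/\ forall g, submodule (N g),
    forall g h, mle g h -> N h `<=` N g
  & forall e g r u, (pw e : set A) r -> N g u -> N (madd g e) (r *: u)].

Definition coeffs_in y : Prop := forall p, p \in y -> (aa p.2 : set A) p.1.

Lemma mle_dn i g : mle (dn i g) g.
Proof. by move=> j; rewrite /dn leq_subr. Qed.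

Lemma mle_dn2 i g h : mle g h -> mle (dn i g) (dn i h).
Proof. by move=> gh j; rewrite /dn leq_sub2r. Qed.

(** Truncation at 0 turns the expected equalities of degrees into inequalities, which decreasing
    families absorb. *)
Lemma mle_dn_madd i g e : mle (dn i (madd g e)) (madd (dn i g) e).
Proof. by move=> j; rewrite /dn /madd; lia. Qed.

Lemma mle_dn_madd2 i g e : mle (dn i (madd g e)) (madd g (dn i e)).
Proof. by move=> j; rewrite /dn /madd; lia. Qed.

Lemma mle_madd_dn i g : mle g (madd (dn i g) (unit_mi i)).
Proof. by move=> j; rewrite /dn /madd /unit_mi; lia. Qed.

Lemma mfam_gfam y N : coeffs_in y -> mfam N -> gfam dn y N.
Proof.
move=> ya [sN dN mN]; split=> // [p g py|p g u py Nu]; first by apply: dN; exact: mle_dn.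
apply: (dN g (madd (dn p.2 g) (unit_mi p.2))); first exact: mle_madd_dn.
by apply: mN => //; rewrite pw1; exact: ya.
Qed.

Lemma mfamI K N : mfam K -> mfam N -> mfam (fun g => K g `&` N g).
Proof.
move=> [sK dK mK] [sN dN mN]; split=> [g|g h gh u [Ku Nu]|e g r u er [Ku Nu]].
- exact: submoduleI.
- by split; [exact: (dK _ _ gh)|exact: (dN _ _ gh)].
- by split; [exact: mK|exact: mN].
Qed.

Lemma mfamD K N : mfam K -> mfam N -> mfam (fun g => addsm (K g) (N g)).
Proof.
move=> [sK dK mK] [sN dN mN]; split=> [g|g h gh|e g r _ er [u Ku [v Nv <-]]].
- exact: submodule_addsm.
- by apply: addsm_mono; [exact: dK|exact: dN].
- by rewrite scalerDr; exists (r *: u); [exact: mK|exists (r *: v) => //; exact: mN].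
Qed.

Lemma mfam_shift i N : mfam N -> mfam (N \o dn i).
Proof.
move=> [sN dN mN]; split=> [g|g h gh|e g r u er Nu] /=; first exact: sN.
- by apply: dN; exact: mle_dn2.
- by apply: (dN _ (madd (dn i g) e)); [exact: mle_dn_madd|exact: mN].
Qed.

Lemma mfam_scale (a : A) N : mfam N -> mfam (fun g => [set a *: u | u in N g]).
Proof.
move=> [sN dN mN]; split=> [g|g h gh _ [u Nu <-]|e g r _ er [u Nu <-]].
- exact: submodule_scale.
- by exists u => //; exact: dN Nu.
- by exists (r *: u); [exact: mN|rewrite !scalerA mulrC].
Qed.

Lemma mfam_pre (a : A) K : mfam K -> mfam (fun g => [set u | K g (a *: u)]).
Proof.
move=> [sK dK mK]; split=> [g|g h gh u Ku|e g r u er Ku] /=.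
- exact: submodule_pre.
- exact: (dK _ _ gh).
- by rewrite scalerA mulrC -scalerA; exact: mK.
Qed.

Lemma mfam_coker a i K N : mfam K -> mfam N -> mfam (coker_fam dn a i K N).
Proof. by move=> fK fN; apply: mfamD => //; apply: mfam_scale; exact: mfam_shift. Qed.

Lemma mfam_ker a i K N : mfam K -> mfam N -> mfam (ker_fam dn a i K N).
Proof. by move=> fK fN; apply: mfamI; [exact: mfam_shift|exact: mfam_pre]. Qed.

Lemma mfam_powfam : mfam powfam.
Proof.
split=> [g|g h gh|e g r u er]; first exact: submodule_mulsm.
  by apply: mulsm_mono => //; exact: pw_mono.
by rewrite /powfam pwD idlMC mulsm_mulid; exact: mulsm_in.
Qed.

(** A kernel inside [N (dn i g)] need not lie in [powfam g], but it does up to a shift of degree,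
    which is enough for Artin-Rees. *)
Definition bounded N : Prop := exists c, forall g, N (madd g (mcst c)) `<=` powfam g.

Lemma bounded_ker a i K N : mfam N -> bounded N -> bounded (ker_fam dn a i K N).
Proof.
move=> [_ dN _] [c hc]; exists c.+1 => g u [Nu _]; apply: hc; apply: dN Nu.
by move=> j; rewrite /madd /dn /mcst; lia.
Qed.

Lemma pw_gen_stable N : (forall g, submodule (N g)) ->
  (forall i g r u, (aa i : set A) r -> N g u -> N (up i g) (r *: u)) ->
  forall e g r u, (pw e : set A) r -> N g u -> N (madd g e) (r *: u).
Proof.
move=> sN aN e; move En : (\sum_j e j)%N => n; elim: n e En => [|n IH] e En g r u er Nu.
  have -> : madd g e = g.
    apply: funext => j; rewrite /madd; move/eqP: En.
    by rewrite sum_nat_eq0 => /forallP/(_ j)/= /eqP ->; rewrite addn0.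
  exact: submoduleZ.
have [i ei] : exists i, (0 < e i)%N.
  apply: contrapT => h; have : (\sum_j e j)%N = 0%N.
    by apply: big1 => j _; apply/eqP; rewrite -leqn0 leqNgt; apply/negP => ej; apply: h; exists j.
  by rewrite En.
have E : madd g e = up i (madd g (dn i e)).
  apply: funext => j; rewrite /madd /up /dn; case: (eqVneq j i) => [->|_] /=; lia.
suff h : pw e `<=` [set r | N (madd g e) (r *: u)] by exact: h.
rewrite (pw_dn _ ei); apply: mulid_min.
  split; first by rewrite /= scale0r; exact: submodule0.
  by move=> x y z Ny Nz /=; rewrite scalerDl -[(x *: y) *: u]scalerA; apply sN.
move=> x z ax ez /=; rewrite E -scalerA; apply: aN => //; apply: IH => //.
have E1 : (\sum_(j | j != i) dn i e j = \sum_(j | j != i) e j)%N.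
  by apply: eq_bigr => j /negPf ji; rewrite /dn ji subn0.
have E2 : dn i e i = (e i).-1 by rewrite /dn eqxx subn1.
rewrite (bigD1 i)//= E1 E2; move: En; rewrite (bigD1 i)//=; lia.
Qed.

(** Shifted by [c], the family lies in a Noetherian family containing the Rees module of [M]. Its
    subfamilies generated in degrees with coordinates at most [n] increase with [n]; they stabilize
    at some [p], so the shifted family is generated in coordinates at most [p]. *)
Lemma artin_rees N : noetherian A -> noetherian_module M -> mfam N -> bounded N ->
  exists b, forall g e, mle (mcst b) g -> N (madd g e) `<=` mulsm (pw e) (N g).
Proof.
move=> nA nM [sN dN mN] [c hc].
have [gens hgens] : {gens : 'I_D -> seq A & forall i, aa i = ideal_span (gens i) :> set A}.
  apply: (@choice _ _ (fun i s => aa i = ideal_span s :> set A)) => i.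
  exact: nA (idl_ideal (aa i)).
pose y := [seq (a, i) | i <- enum 'I_D, a <- gens i].
have yE i a : a \in gens i -> (a, i) \in y.
  by move=> ai; apply/allpairsPdep; exists i, a; rewrite mem_enum.
have [R [[sR yR] nR R0]] := gnoetherian_exists (@upC D) (@up_inj D) y (mcst 0) nM.
have aR i g r u : (aa i : set A) r -> R g u -> R (up i g) (r *: u).
  move=> ar Ru; suff h : aa i `<=` [set r | R (up i g) (r *: u)] by exact: h.
  rewrite hgens; apply: (@span_min _ A^o).
    split; first by rewrite /= scale0r; exact: (submodule0 (sR _)).
    by move=> x v w Nv Nw /=; rewrite scalerDl -[(x *: v) *: u]scalerA; apply sR.
  by move=> a ai; apply: (yR (a, i)) => //; exact: yE.
have FR g : powfam g `<=` R g.
  apply: mulsm_min => // r u er _; have -> : g = madd (mcst 0) g by [].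
  by apply: (pw_gen_stable sR aR) => //; exact: R0.
pose Nc g := N (madd g (mcst c)).
have maddA g e f : madd (madd g e) f = madd (madd g f) e.
  by apply: funext => j; rewrite /madd addnAC.
have mNc e g r u : (pw e : set A) r -> Nc g u -> Nc (madd g e) (r *: u).
  by move=> er Nu; rewrite /Nc maddA; exact: mN.
pose S h k := mulsm (pw (fun j => (h j - k j)%N)) (Nc k).
have S_mono h k k' : mle k k' -> mle k' h -> S h k `<=` S h k'.
  move=> kk' k'h; rewrite /S.
  have -> : (fun j => (h j - k j)%N) = madd (fun j => (h j - k' j)%N) (fun j => (k' j - k j)%N).
    by apply: funext => j; rewrite /madd; have := kk' j; have := k'h j; lia.
  rewrite pwD mulsm_mulid; apply: mulsm_mono => //; apply: mulsm_min; first exact: sN.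
  move=> r u er Nu; have := mNc _ _ _ _ er Nu.
  suff -> : madd k (fun j => (k' j - k j)%N) = k' by [].
  by apply: funext => j; rewrite /madd subnKC.
have S_mul h k i a u : mle k h -> (aa i : set A) a -> S h k u -> S (up i h) k (a *: u).
  move=> kh aia Su; rewrite /S.
  have -> : (fun j => (up i h j - k j)%N) = madd (unit_mi i) (fun j => (h j - k j)%N).
    by apply: funext => j; rewrite /madd /up /unit_mi; have := kh j; lia.
  by rewrite pwD pw1 mulsm_mulid; exact: mulsm_in.
have S_sub h k : mle k h -> S h k `<=` Nc h.
  move=> kh; apply: mulsm_min; first exact: sN.
  move=> r u er Nu; have := mNc _ _ _ _ er Nu.
  suff -> : madd k (fun j => (h j - k j)%N) = h by [].
  by apply: funext => j; rewrite /madd subnKC.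
pose tr n h : 'I_D -> nat := fun j => minn (h j) n.
have trh n h : mle (tr n h) h by move=> j; exact: geq_minl.
have [n|n g|n g|p hp] := nR (fun n h => S h (tr n h)).
- split=> [g|q g u qy Su]; first exact: submodule_mulsm.
  have aq : (aa q.2 : set A) q.1.
    have /allpairsPdep[i [a [_ ai ->]]] := qy; rewrite hgens; exact: (@span_in _ A^o _ _ ai).
  apply: (@S_mono _ (tr n g)); last by apply: S_mul.
    by move=> j; rewrite /tr /up; lia.
  exact: trh.
- apply: S_mono; last exact: trh.
  by move=> j; rewrite /tr; lia.
- apply: subset_trans (FR g); apply: (subset_trans (S_sub _ _ (trh n g))); exact: hc.
(* [c] undoes the shift; what is left of [g] has all its coordinates at least [p], past the
   generators. *)
exists (p + c)%N => g e bg.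
pose k : 'I_D -> nat := fun j => (g j - c)%N.
have pk j : (p <= k j)%N by have := bg j; rewrite /k /mcst; lia.
have kE : madd k (mcst c) = g.
  by apply: funext => j; have := bg j; rewrite /madd /k /mcst; lia.
(* [n] bounds every coordinate of [h], so the [n]-th subfamily is all of [Nc] in degree [h]. *)
pose h := madd k e; pose n := (p + \max_j h j)%N.
have hn j : (h j <= n)%N by rewrite /n; have := leq_bigmax (F := h) j; lia.
have -> : N (madd g e) = Nc h by rewrite /Nc /h maddA kE.
move=> u Nu; have : S h (tr n h) u.
  have -> : tr n h = h by apply: funext => j; rewrite /tr; apply/minn_idPl.
  rewrite /S; have -> : (fun j => (h j - h j)%N) = mcst 0 by apply: funext => j; rewrite subnn.
  by rewrite pw0 /idl1 /= mulsmT //; exact: sN.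
move=> /(hp n (leq_addr _ _) h) {Nu}; move: u.
have -> : tr p h = mcst p.
  by apply: funext => j; rewrite /tr /h /madd /mcst; have := pk j; lia.
rewrite /S; have -> : (fun j => (h j - mcst p j)%N) = madd e (fun j => (k j - p)%N).
  by apply: funext => j; rewrite /h /madd /mcst; have := pk j; lia.
rewrite pwD mulsm_mulid; apply: mulsm_mono => //; apply: mulsm_min; first exact: sN.
move=> r u er Nu; have := mN _ _ _ _ er Nu.
suff -> : madd (madd (mcst p) (mcst c)) (fun j => (k j - p)%N) = g by [].
by apply: funext => j; rewrite -kE /madd /mcst; have := pk j; lia.
Qed.

End Families.

(** * Vanishing and polynomial growth in large degrees *)

Section Exactness.
Context {A : comNzRingType} {M : lmodType A} {D : nat} (aa : 'I_D -> idl A).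
Implicit Types (g h e t : 'I_D -> nat) (N K : ('I_D -> nat) -> set M) (y : seq (A * 'I_D)).

Local Notation pw := (pw aa).

(* The component of degree t of the ideal generated by y in the Rees algebra. *)
Fixpoint wsum y t (r : A) : Prop :=
  if y is (a, i) :: y' then exists2 c, (pw (dn i t) : set A) c & wsum y' t (r - a * c)
  else r = 0.

Lemma wsum_ideal y t : ideal [set r | wsum y t r].
Proof.
elim: y => [|[a i] y IH] /=; first exact: (@submodule_set0 _ A^o).
split=> /=; first by exists 0; [exact: ideal0 (idl_ideal _)|rewrite mulr0 subr0; exact: ideal0 IH].
move=> x u v [c hc hu] [c' hc' hv]; exists (x * c + c').
  by apply: (idealD (idl_ideal _)) => //; exact: (idealMl _ (idl_ideal _)).
have -> : x *: (u : A^o) + v - a * (x * c + c') = x * (u - a * c) + (v - a * c').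
  by rewrite -[x *: (u : A^o)]/(x * u); ring.
by apply: (idealD IH) => //; exact: (idealMl _ IH).
Qed.

Lemma wsum_in y t a i c : (a, i) \in y -> (pw (dn i t) : set A) c -> wsum y t (a * c).
Proof.
elim: y => // -[b j] y IH; rewrite inE => /predU1P[[-> ->]|ay] hc /=.
  by exists c => //; rewrite subrr; exact: ideal0 (wsum_ideal _ _).
by exists 0; [exact: ideal0 (idl_ideal _)|rewrite mulr0 subr0; exact: IH].
Qed.

Lemma wsum_mul y t e r s : wsum y t r -> (pw e : set A) s -> wsum y (madd t e) (r * s).
Proof.
elim: y r => [|[a i] y IH] r /=; first by move=> -> _; rewrite mul0r.
move=> [c hc hr] es; exists (c * s); last by rewrite mulrA -mulrBl; exact: IH.
apply: (@pw_mono _ _ aa _ (madd (dn i t) e)); first exact: mle_dn_madd.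
by rewrite pwD; exact: mulid_in.
Qed.

Lemma wsum_sub y t : coeffs_in aa y -> (forall i, (0 < t i)%N) ->
  forall r, wsum y t r -> (pw t : set A) r.
Proof.
move=> ya t0; elim: y ya => [|[a i] y IH] ya r /=; first by move=> ->; exact: ideal0 (idl_ideal _).
move=> [c hc hr]; rewrite -[r](subrK (a * c)); apply: (idealD (idl_ideal _)).
  by apply: IH => // p py; apply: ya; rewrite inE py orbT.
by rewrite (pw_dn _ (t0 i)); apply: mulid_in => //; apply: (ya (a, i)); exact: mem_head.
Qed.

Hypotheses (nA : noetherian A) (nM : noetherian_module M).

(** In the Rees algebra, the last hypothesis puts the component of degree [t] into (y) plus the
    annihilator of [N/K]. Kernels and cokernels of the first element inherit this for the tail,
    since that element kills them. Once [y] is exhausted, [pw t] sends [N g] into [K (madd g t)],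
    and by Artin-Rees [N] and [K] agree in large degrees. *)
Lemma gsym_eventually0 y K N t : coeffs_in aa y -> mfam aa K -> mfam aa N -> gsub K N ->
  bounded aa N ->
  (forall r, (pw t : set A) r -> exists2 z, wsum y t (r - z) &
     forall g u, N g u -> K (madd g t) (z *: u)) ->
  exists b, forall g, mle (mcst b) g -> gsym dn y K N g = 0.
Proof.
elim: y K N => [|[a i] y IH] K N ya fK fN KN bN H.
  have [b hb] := artin_rees nA nM fN bN; have [sK _ _] := fK.
  exists (b + \max_j t j)%N => g bg /=; suff -> : N g = K g by rewrite mlengthxx.
  apply/seteqP; split; last exact: KN.
  have tg j : (b + t j <= g j)%N.
    by apply: leq_trans (bg j); rewrite leq_add2l; exact: leq_bigmax.
  have gE : madd (fun j => (g j - t j)%N) t = g.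
    by apply: funext => j; rewrite /madd; have := tg j; lia.
  rewrite -gE; apply: (subset_trans (hb _ _ _)).
    by move=> j; rewrite /mcst; have := tg j; lia.
  apply: mulsm_min => // r u /H[z /eqP]; rewrite subr_eq0 => /eqP -> h Nu.
  exact: h.
have [sK dK mK] := fK; have [sN dN mN] := fN.
have ya' : coeffs_in aa y by move=> p py; apply: ya; rewrite inE py orbT.
have gK := mfam_gfam ya fK; have gN := mfam_gfam ya fN.
have [||||b1 hb1] := IH (coker_fam dn a i K N) N ya' _ fN.
- exact: mfam_coker.
- exact: coker_sub gN KN.
- exact: bN.
- move=> r /H[z /= [c hc hw] hz]; exists (z + a * c); first by rewrite opprD addrA.
  move=> g u Nu; rewrite scalerDl -scalerA; exists (z *: u); first exact: hz.
  exists (a *: (c *: u)) => //; exists (c *: u) => //.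
  by apply: (dN _ _ (@mle_dn_madd2 _ i g t)); exact: mN.
have [|||||b2 hb2] := IH (K \o dn i) (ker_fam dn a i K N) ya'.
- exact: mfam_shift.
- exact: mfam_ker.
- exact: sub_ker gK KN.
- exact: bounded_ker.
- move=> r /H[z /= [c hc hw] hz]; exists (z + a * c); first by rewrite opprD addrA.
  move=> g u [Nu Ku] /=; rewrite scalerDl; apply: (submoduleD (sK _)).
    by apply: (dK _ _ (@mle_dn_madd _ i g t)); exact: hz.
  rewrite mulrC -scalerA; apply: (dK _ _ (@mle_dn_madd2 _ i g t)); exact: mK.
exists (maxn b1 b2) => g bg /=; rewrite hb1 ?hb2 ?subrr// => j; apply: leq_trans (bg j).
  exact: leq_maxr.
exact: leq_maxl.
Qed.

Definition colors (i : 'I_D) y : seq A := [seq p.1 | p <- y & p.2 == i].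

Lemma colors_rem p y i r : p \in y -> ideal_span (colors i y) r ->
  exists2 e, (p.2 != i -> e = 0) & ideal_span (colors i (rem p y)) (r - e * p.1).
Proof.
move=> py; have E : colors i y =i colors i (p :: rem p y).
  by apply: perm_mem; apply: perm_map; apply: perm_filter; exact: perm_to_rem.
have -> : ideal_span (colors i y) = ideal_span (colors i (p :: rem p y)).
  rewrite /ideal_span; suff -> : [set` colors i y] = [set` colors i (p :: rem p y)] by [].
  by apply/seteqP; split=> x /=; rewrite E.
rewrite /colors /=; case: eqP => [pi|_] /=; last by exists 0; rewrite // mul0r subr0.
by move=> /(@span_cons _ A^o)[e he]; exists e.
Qed.

Lemma mlength_eventually0 i K N : mfam aa K -> mfam aa N -> gsub K N -> bounded aa N ->
  (forall r g u, (aa i : set A) r -> N g u -> K (up i g) (r *: u)) ->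
  epoly (fun g => (mlength (K g) (N g))%:Z).
Proof.
move=> [sK _ _] fN KN bN H; have [b hb] := artin_rees nA nM fN bN.
apply: (@epoly0 _ _ b.+1) => g bg; suff -> : N g = K g by rewrite mlengthxx.
apply/seteqP; split; last exact: KN.
have gi : (0 < g i)%N by exact: leq_trans (bg i).
have gE : madd (dn i g) (unit_mi i) = g by exact: (up_dn gi).
rewrite -gE; apply: (subset_trans (hb _ _ _)).
  by move=> j; have := bg j; rewrite /mcst /dn; case: (j == i) => /=; lia.
by apply: mulsm_min => // r u; rewrite pw1; exact: H.
Qed.

(** Induction on the number of generators. If some colour has none, the lengths vanish in large
    degrees by Artin-Rees. Otherwise the difference in each direction [i] is the length of the
    cokernel minus that of the kernel of a generator of colour [i], and both need one generator
    less. *)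
Lemma hilbert_serre y K N : coeffs_in aa y -> mfam aa K -> mfam aa N -> gsub K N ->
  bounded aa N -> (forall g, finite_length (K g) (N g)) ->
  (forall i r, (aa i : set A) r -> exists2 z, ideal_span (colors i y) (r - z) &
     forall g u, N g u -> K (up i g) (z *: u)) ->
  epoly (fun g => (mlength (K g) (N g))%:Z).
Proof.
move En : (size y) => n; elim: n y En K N => [|n IH] y En K N ya fK fN KN bN fl H.
all: have [sK dK mK] := fK; have [sN dN mN] := fN.
all: have [[i hi]|allc] := pselect (exists i, colors i y = [::]).
1,3: apply: (mlength_eventually0 (i := i)) => // r g u /H[z];
  by rewrite hi => /(@span_nil _ A^o)/eqP; rewrite subr_eq0 => /eqP -> h Nu; exact: h.
  (* With [y] empty and no colour empty there are no colours at all, so there is a single degree. *)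
  case: y En {H ya} allc => // _ allc.
  exists (mlength (K (mcst 0)) (N (mcst 0)))%:R%:MP, 0%N => g _.
  have -> : g = mcst 0 by apply: funext => i; case: allc; exists i.
  by rewrite mevalC.
apply: epoly_of_diff => i.
have [p py pi] : exists2 p, p \in y & p.2 = i.
  apply: contrapT => h; apply: allc; exists i; rewrite /colors; apply/eqP;
    rewrite -size_eq0 size_map size_filter -leqn0 leqNgt -has_count.
  by apply/hasPn => p py; apply/eqP => pi; apply: h; exists p.
case: p py pi => a i' py /= Ei; rewrite {i'}Ei in py.
have gKp : gfam dn [:: (a, i)] K by apply: mfam_gfam fK => q; rewrite inE => /eqP ->; exact: ya.
have gNp : gfam dn [:: (a, i)] N by apply: mfam_gfam fN => q; rewrite inE => /eqP ->; exact: ya.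
have ya' : coeffs_in aa (rem (a, i) y) by move=> q /mem_rem; exact: ya.
have fC : mfam aa (coker_fam dn a i K N) by exact: mfam_coker.
have fZ : mfam aa (ker_fam dn a i K N) by exact: mfam_ker.
have fK' : mfam aa (K \o dn i) by exact: mfam_shift.
have CN := coker_sub gNp KN; have KZ := sub_ker gKp KN.
have [sC _ _] := fC; have [sZ _ _] := fZ.
have -> : (fun g => (mlength (K g) (N g))%:Z - (mlength (K (dn i g)) (N (dn i g)))%:Z) =
    (fun g => (mlength (coker_fam dn a i K N g) (N g))%:Z
            - (mlength ((K \o dn i) g) (ker_fam dn a i K N g))%:Z).
  by apply: funext => g; have := gsym_finite (@dnC D) gKp gNp KN fl g => /= ->.
have sz : size (rem (a, i) y) = n by rewrite size_rem// En.
apply: epolyB.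
  apply: (IH _ sz) => //.
  - by move=> g; have [] := finite_length_sub (sK g) (sC g) (sN g)
      (@addsm_subl _ _ _ _ (submodule_scale a (sN (dn i g)))) (CN g) (fl g).
  - move=> j r /H[z hz kz]; have [e he1 he] := colors_rem py hz.
    exists (z + e * a); first by rewrite opprD addrA.
    move=> g u Nu; rewrite scalerDl; have [ij|ij] := eqVneq i j; last first.
      rewrite he1 // mul0r scale0r addr0; apply: addsm_subl; last exact: kz.
      exact: submodule_scale.
    exists (z *: u); first exact: kz.
    exists ((e * a) *: u) => //; exists (e *: u); last by rewrite scalerA mulrC.
    by apply: (submoduleZ _ (sN _)); rewrite -ij dn_up.
apply: (IH _ sz) => //.
- exact: bounded_ker.
- move=> g; have [] := finite_length_sub (sK _) (sZ g) (sN _) (KZ g) _ (fl (dn i g)) => //.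
  by move=> u [].
- move=> j r /H[z hz kz]; have [e he1 he] := colors_rem py hz.
  exists (z + e * a); first by rewrite opprD addrA.
  move=> g u [Nu Ku] /=; rewrite scalerDl; apply: (submoduleD (sK _)).
    by apply: dK (kz _ _ Nu) => k; rewrite /dn /up; lia.
  have [ij|ij] := eqVneq i j; last by rewrite he1 // mul0r scale0r; exact: submodule0.
  by rewrite -ij dn_up -scalerA; apply: (submoduleZ _ (sK _)).
Qed.

End Exactness.

(** * Joint reductions *)

Section Frcons.
Context {T : Type} {d : nat}.
Implicit Types (t : T) (f : 'I_d -> T).

Lemma frcons_max f t : frcons f t ord_max = t.
Proof. by rewrite /frcons unlift_none. Qed.

Lemma frcons_lift f t i : frcons f t (lift ord_max i) = f i.
Proof. by rewrite /frcons liftK. Qed.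

Lemma fcons0 f t : fcons t f ord0 = t.
Proof. by rewrite /fcons unlift_none. Qed.

Lemma fcons_lift f t i : fcons t f (lift ord0 i) = f i.
Proof. by rewrite /fcons liftK. Qed.

Lemma ord_maxP (P : 'I_d.+1 -> Prop) : P ord_max -> (forall i, P (lift ord_max i)) -> forall j, P j.
Proof. by move=> h1 h2 j; case: (unliftP ord_max j) => [i|] ->. Qed.

Lemma widen_lift (i : 'I_d) : widen_ord (leqnSn d) i = lift ord_max i.
Proof. by apply: ord_inj; rewrite lift_max. Qed.

End Frcons.

Lemma prime_chain_sub (A : comNzRingType) (c c' : set A) l r :
  c `<=` c' -> prime_chain c' l r -> prime_chain c l r.
Proof.
move=> cc [rP rS]; split=> // i il; have [p1 p2] := rP i il.
by split=> //; exact: subset_trans p2.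
Qed.

Lemma bigaddsm_min (A : comNzRingType) (M : lmodType A) r (N : 'I_r -> set M) (T : set M) :
  submodule T -> (forall i, N i `<=` T) -> \big[@addsm A M/[set 0]]_(i < r) N i `<=` T.
Proof.
move=> sT NT; elim/big_ind: _ => [u ->|K L KT LT|i _]; first exact: submodule0.
  exact: addsm_min.
exact: NT.
Qed.

Lemma prime_idlM (A : comNzRingType) (I J : idl A) (p : set A) :
  prime_ideal p -> idlM I J `<=` p -> I `<=` p \/ J `<=` p.
Proof.
move=> [_ _ pM] h; apply: contrapT => /not_orP[/existsNP[a /not_implyP[Ia npa]]].
move=> /existsNP[b /not_implyP[Jb npb]].
by have /pM[] : p (a * b) by apply: h; exact: mulid_in.
Qed.

Lemma prime_pw (A : comNzRingType) D (aa : 'I_D -> idl A) e (p : set A) :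
  prime_ideal p -> pw aa e `<=` p -> exists2 i, (0 < e i)%N & aa i `<=` p.
Proof.
move=> pp h; apply: contrapT => nh; move: h; rewrite /pw.
elim/big_ind: _ => [h|I J nI nJ /(prime_idlM pp)[]//|i _ h].
  by case: pp => _ np1 _; apply: np1; exact: h.
apply: nh; exists i; last exact: prime_idlX pp h.
by case: (e i) h => // h; case: pp => _ np1 _; case: np1; exact: h.
Qed.

Section TailVanishing.
Context {A : comNzRingType} {M : lmodType A} {D : nat} (E : set A).
Hypothesis finE : forall K N : set M, submodule K -> submodule N -> K `<=` N ->
  (forall r u, E r -> N u -> K (r *: u)) -> finite_length K N.
Hypotheses (nA : noetherian A) (nM : noetherian_module M).
Implicit Types (K N : ('I_D -> nat) -> set M) (y : seq (A * 'I_D)).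

(* If the degrees do not depend on the i-th coordinate, multiplication by the tail y2 of
   colour i is ungraded, and y2 is longer than the dimension. *)
Lemma gsym_tail_vanish i y1 y2 K N : {in y2, forall p, p.2 = i} ->
  gfam dn (y1 ++ y2) K -> gfam dn (y1 ++ y2) N -> gsub K N -> gcls E (y1 ++ y2) K N ->
  (forall g, K (dn i g) = K g) -> (forall g, N (dn i g) = N g) ->
  (forall g l r, prime_chain [set a | forall u, N g u -> K g (a *: u)] l r ->
     (l < size y2)%N) ->
  forall g, gsym dn (y1 ++ y2) K N g = 0.
Proof.
move=> y2i; elim: y1 K N => [|[a j] y1 IH] K N fK fN KN cl Ki Ni dim g.
  have [sK _ _] := fK; have [sN _ _] := fN.
  rewrite (@gsym_cst _ _ _ _ dn (@dnC D) y2 K N (K g) (N g)) //.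
  - apply: (mult_symbol_vanish finE) => //.
      by move=> r /cl[z hz kz]; exists z => // u; exact: kz.
    by move=> l r /dim; rewrite size_map.
  - by move=> p h /y2i ->.
  - by move=> p h /y2i ->.
have [sK dK mK] := fK; have [sN dN mN] := fN.
have fKy := gfam_behead fK; have fNy := gfam_behead fN.
rewrite /= !IH ?subrr //.
- exact: (gfam_shift (@dnC D)).
- exact: (gfam_ker (@dnC D)).
- exact: sub_ker fK KN.
- exact: gcls_ker fK cl.
- by move=> h /=; rewrite dnC Ki.
- by move=> h; rewrite /ker_fam dnC Ni Ki.
- move=> h l r rC; apply: (dim (dn j h) l r); apply: prime_chain_sub rC => b hb u [Nu _].
  exact: hb.
- exact: (gfam_coker (@dnC D)).
- exact: coker_sub fN KN.
- exact: gcls_coker fK fN cl.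
- by move=> h; rewrite /coker_fam dnC Ni Ki.
- move=> h l r rC; apply: (dim h l r); apply: prime_chain_sub rC => b hb u Nu.
  by apply: addsm_subl; [exact: submodule_scale|exact: hb].
Qed.

End TailVanishing.

Section Differences.
Context {A : comNzRingType} {D : nat}.
Implicit Types (f : ('I_D -> nat) -> int) (y : seq (A * 'I_D)) (g h : 'I_D -> nat).

Lemma gdiff_eventually y f f' b : (forall h, mle (mcst b) h -> f h = f' h) ->
  forall g, mle (mcst (b + size y)%N) g -> gdiff dn y f g = gdiff dn y f' g.
Proof.
elim: y f f' b => [|[a i] y IH] f f' b ff g hg /=.
  by apply: ff; move=> j; have := hg j; rewrite /mcst addn0.
apply: (IH _ _ b.+1) => [h hh|j]; last by have := hg j; rewrite /mcst /= addnS.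
by rewrite !ff // => j; have := hh j; rewrite /mcst /dn; case: (j == i) => /=; lia.
Qed.

(** The truncated shift agrees with subtraction on positive coordinates; each difference may lower a
    coordinate by one, whence [size y] in the threshold. *)
Lemma gdiff_vdiff y f (F : ('I_D -> rat) -> rat) b :
  (forall g, mle (mcst b) g -> (f g)%:~R = F (nval g)) ->
  forall g, mle (mcst (b + size y)%N) g ->
    (gdiff dn y f g)%:~R = vdiff [seq p.2 | p <- y] F (nval g).
Proof.
elim: y f F b => [|[a i] y IH] f F b fF g hg /=.
  by apply: fF; move=> j; have := hg j; rewrite /mcst addn0.
apply: (IH _ _ b.+1) => [h hh|j]; last by have := hg j; rewrite /mcst /= addnS.
have hi : (0 < h i)%N by have := hh i; rewrite /mcst; lia.
rewrite intrB -nval_dn // !fF // => j; have := hh j; rewrite /mcst /dn; last lia.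
by case: (j == i) => /=; lia.
Qed.

Lemma vdiff_rename (r : 'I_D -> 'I_D) (rho : ('I_D -> rat) -> 'I_D -> rat) ds F v :
  (forall i w, rho (vdn i w) = vdn (r i) (rho w)) ->
  vdiff ds (fun w => F (rho w)) v = vdiff (map r ds) F (rho v).
Proof.
move=> hr; elim: ds F => //= i ds IH F; rewrite -(IH (fun w => F w - F (vdn (r i) w))).
by congr vdiff; apply: funext => w; rewrite hr.
Qed.

End Differences.

(** * The joint reduction: parameters, vanishing symbols, and the coefficient *)

Section JointReduction.
Context {A : comNzRingType} {M : lmodType A} {d : nat}.
Variables (m : set A) (J : set A) (I : 'I_d -> set A).
Variables (k0 : nat) (k : 'I_d -> nat) (X : 'I_d.+1 -> seq A).

Let D := d.+1.
Let jm : 'I_D := ord_max.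
Let prodI := prodid I (fun=> 1%N).
Let annM := ann [set (0 : M)].
Let x := flatten [seq X i | i <- enum 'I_D].
Let nk := (\sum_(i < d) k i)%N.

Hypotheses (nA : noetherian A) (locm : local_ring m) (fgM : fin_gen [set: M])
  (Jprim : m_primary m J) (idI : forall i, ideal (I i))
  (dimM : module_dim (ann_infty M prodI) (k0 + nk).+1)
  (jr : joint_reduction M (frcons I J) (frcons k k0.+1) X)
  (xm : {in x, forall a, m a})
  (htI : height_gt annM (addsm (prodI : set A^o) (annM : set A^o)) nk).

Let nM : noetherian_module M := noetherian_module_fin_gen nA fgM.

Let idJ : ideal J. Proof. by case: Jprim => [[]]. Qed.

Let idIJ i : ideal (frcons I J i).
Proof. by move: i; apply: ord_maxP => [|i]; rewrite ?frcons_max ?frcons_lift. Qed.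

Let aa (i : 'I_D) : idl A := Idl (idIJ i).
Let bI (i : 'I_d) : idl A := Idl (idI i).

Let aa_max : aa jm = J :> set A. Proof. exact: frcons_max. Qed.
Let aa_lift i : aa (lift jm i) = I i :> set A. Proof. exact: frcons_lift. Qed.

Let F := @powfam A M D aa.

Let colored (l : seq 'I_D) : seq (A * 'I_D) := flatten [seq [seq (b, i) | b <- X i] | i <- l].
Let y := colored (enum 'I_D).
Let y1 := colored [seq widen_ord (leqnSn d) i | i <- enum 'I_d].
Let y2 : seq (A * 'I_D) := [seq (b, jm) | b <- X jm].
Let x1 := unzip1 y1.

Let coloredP l p : p \in colored l -> p.1 \in X p.2 /\ p.2 \in l.
Proof. by case/flattenP => s /mapP[i il ->] /mapP[b bX ->]. Qed.

Let colored_unzip l : unzip1 (colored l) = flatten [seq X i | i <- l].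
Proof.
rewrite /colored /unzip1 map_flatten -map_comp; congr flatten; apply: eq_map => i /=.
by rewrite -map_comp map_id.
Qed.

Let xE : unzip1 y = x. Proof. exact: colored_unzip. Qed.

Let yE : y = y1 ++ y2.
Proof. by rewrite /y enum_ordSr /colored map_rcons flatten_rcons. Qed.

Let Xx i b : b \in X i -> b \in x.
Proof. by move=> bX; apply/flattenP; exists (X i) => //; apply: map_f; rewrite mem_enum. Qed.

Let x1P b : b \in x1 -> exists i : 'I_d, b \in X (lift jm i).
Proof.
rewrite /x1 colored_unzip => /flattenP[s /mapP[_ /mapP[i _ ->] ->]].
by rewrite widen_lift; exists i.
Qed.

Let Xx1 i b : b \in X (lift jm i) -> b \in x1.
Proof.
move=> bX; rewrite /x1 colored_unzip; apply/flattenP; exists (X (lift jm i)) => //.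
by apply/mapP; exists (lift jm i) => //; rewrite -widen_lift; apply: map_f; rewrite mem_enum.
Qed.

Let x1x b : b \in x1 -> b \in x.
Proof. by move=> /x1P[i bX]; exact: Xx bX. Qed.

Let size_max : size (X jm) = k0.+1.
Proof. by case: jr => h _ _; rewrite h frcons_max. Qed.

Let size_x1 : size x1 = nk.
Proof.
rewrite /x1 colored_unzip size_flatten /shape -2!map_comp sumnE big_map big_enum /=.
by case: jr => h _ _; apply: eq_bigr => i _; rewrite h widen_lift frcons_lift.
Qed.

Let size_x : size x = (k0 + nk).+1.
Proof.
by rewrite -xE yE /unzip1 map_cat size_cat -/x1 size_x1 size_map size_map size_max; lia.
Qed.

Let ya : coeffs_in aa y.
Proof. by move=> p /coloredP[pX _]; case: jr => _ h _; exact: h. Qed.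

Let im : ideal m. Proof. by case: locm => [[]]. Qed.

Let prime_J p : prime_ideal p -> J `<=` p -> p = m.
Proof.
move=> pp Jp; apply/seteqP; split; first exact: (prime_sub_maximal nA locm pp).
by case: Jprim => _ <- a [n Jan]; apply: (prime_idealX (n := n) pp); exact: Jp.
Qed.

Let id_annM : ideal annM.
Proof.
split; first by move=> u; rewrite /= scale0r.
move=> a b c hb hc u; rewrite /= scalerDl -[(a *: b) *: u]scalerA.
by rewrite (hb u : _ = 0) (hc u : _ = 0) scaler0 addr0.
Qed.

Let prodI_sub i : prodI `<=` I i.
Proof.
rewrite /prodI -(pwE bI) (@pw_dn _ _ bI i) //.
exact: (mulid_subl (idI i)).
Qed.

Let prime_powI p e : prime_ideal p -> pw aa e `<=` p -> e jm = 0%N -> prodI `<=` p.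
Proof.
move=> pp /(prime_pw pp)[i ei aip] e0.
case: (unliftP jm i) ei aip => [i'|] -> ei aip; last by rewrite e0 in ei.
by apply: subset_trans (prodI_sub i') _; rewrite -aa_lift.
Qed.

Let span_prime (s : seq A) p : prime_ideal p -> {in s, forall a, p a} -> ideal_span s `<=` p.
Proof. by move=> pp sp; apply: (@span_min _ A^o) => //; exact: prime_ideal_ideal. Qed.

Let trI (g : 'I_D -> nat) : 'I_D -> nat := fun j => if j == jm then 0%N else g j.

Let trI_mono g h : mle g h -> mle (trI g) (trI h).
Proof. by move=> gh j; rewrite /trI; case: eqP. Qed.

Let trI_le g : mle (trI g) g.
Proof. by move=> j; rewrite /trI; case: eqP. Qed.

Let trI_madd g : madd (trI g) (fun j => (unit_mi jm j * g jm)%N) = g.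
Proof.
apply: funext => j; rewrite /madd /trI /unit_mi.
by case: eqP => [->|_]; rewrite ?mul1n ?add0n // mul0n addn0.
Qed.

Let pw_trI g : pw aa g = idlM (pw aa (trI g)) (idlX (aa jm) (g jm)).
Proof. by rewrite -[in LHS](trI_madd g) pwD -pw1 pwX. Qed.

Let mF : mfam aa F. Proof. exact: mfam_powfam. Qed.
Let sF g : submodule (F g). Proof. exact: submodule_mulsm. Qed.
Let F_mono g h : mle g h -> F h `<=` F g. Proof. by case: mF => _ + _; apply. Qed.

Let jr_bound : exists n0, forall t, mle (mcst n0) t -> forall T : set M, submodule T ->
  (forall i, mulsm (ideal_span (X i)) (F (dn i t)) `<=` T) -> F t `<=` T.
Proof.
have [_ _ [n0 h]] := jr; exists n0 => t tn T sT hT.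
rewrite /F /powfam pwE h // ; apply: bigaddsm_min => // i; apply: subset_trans (hT i).
by rewrite /F /powfam pwE.
Qed.

(* Nakayama's lemma over the localization of A at p. *)
Let nakayama_prime (N K : set M) p r : prime_ideal p -> submodule N -> submodule K ->
  ~ p r -> (forall u, N u -> addsm K (mulsm p N) (r *: u)) ->
  exists2 s, ~ p s & forall u, N u -> K (s *: u).
Proof.
move=> pp sN sK npr h.
have [n [e pe he]] := nakayama sN (nM sN) sK (prime_ideal_ideal pp) h.
exists (r ^+ n - e) => // pre; apply: npr; apply: (prime_idealX (n := n) pp).
by rewrite -[_ ^+ _](subrK e); apply: (idealD (prime_ideal_ideal pp)).
Qed.

(** The source of all finite lengths modulo (x). The argument descends from [p] to a prime [q]
    inside it, minimal over [Ann M] and the elements taken from the [I_i]: the relation found at [p]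
    would force [q] to contain I, which its height forbids. *)
Lemma prime_over_joint_reduction p : prime_ideal p -> annM `<=` p ->
  {in x, forall a, p a} -> p = m.
Proof.
move=> pp annp xp; apply: contrapT => npm; have ip := prime_ideal_ideal pp.
have nJp : ~ (J `<=` p) by move=> /(prime_J pp).
have [n0 hn0] := jr_bound; pose t : 'I_D -> nat := mcst n0.+1.
have tn : mle (mcst n0) t by move=> j; exact: leqnSn.
have spX i : ideal_span (X i) `<=` p by apply: span_prime => // b /Xx; exact: xp.
have ptp : pw aa t `<=` p.
  apply: contrapT => /existsNP[r /not_implyP[rt npr]].
  have [|s nps hs] := nakayama_prime pp (@submoduleT _ M) (@submodule_set0 _ M) npr.
    move=> u _; apply: addsm_subr => //.
    have : F t (r *: u) by exact: mulsm_in.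
    by move: (r *: u); apply: hn0 => // i; apply: mulsm_mono.
  by apply: nps; apply: annp => u; exact: hs.
pose tI := trI t.
pose B := mulsm (ideal_span x1) [set: M].
(* Some power of [J] has an element outside [p], and the summand of the joint reduction with colour
   [J] lies in [p] times [F tI]; Nakayama's lemma leaves only the elements [x1]. *)
have [s nps hs] : exists2 s, ~ p s & forall u, F tI u -> B (s *: u).
  have [r Jr npr] : exists2 r, (idlX (aa jm) (t jm) : set A) r & ~ p r.
    apply: contrapT => h; apply: nJp; rewrite -aa_max.
    apply: (prime_idlX (n := t jm) pp) => r hr; apply: contrapT => npr; apply: h.
    by exists r.
  apply: (nakayama_prime pp (sF tI) (submodule_mulsm _ _) npr).
  move=> u Fu; have : F t (r *: u).
    by rewrite /F /powfam pw_trI idlMC mulsm_mulid; exact: mulsm_in.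
  have sBp : submodule (addsm B (mulsm p (F tI))).
    by apply: submodule_addsm; exact: submodule_mulsm.
  move: (r *: u); apply: hn0 => //; apply: ord_maxP => [|i].
    apply: subset_trans (@addsm_subr _ _ B (mulsm p (F tI)) (submodule_mulsm _ _)).
    apply: mulsm_mono => //; apply: F_mono => j; rewrite /tI /trI /dn.
    by case: eqP => // _; rewrite subn0.
  apply: subset_trans (@addsm_subl _ _ B (mulsm p (F tI)) (submodule_mulsm _ _)).
  apply: mulsm_mono => //; apply: (@span_min _ A^o); first exact: (@submodule_span _ A^o).
  by move=> c cX; apply: (@span_in _ A^o); exact: Xx1 cX.
pose b : set A := addsm (ideal_span x1 : set A^o) (annM : set A^o).
have isx1 : ideal (ideal_span x1) by exact: (@submodule_span _ A^o).
have bp : b `<=` p.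
  by apply: (@addsm_min _ A^o) => //; apply: span_prime => // c /x1x; exact: xp.
have [q [pq bq qp minq]] := minimal_prime pp bp.
have x1q : ideal_span x1 `<=` q by apply: subset_trans bq; exact: (@addsm_subl _ A^o _ _ id_annM).
have annq : annM `<=` q by apply: subset_trans bq; exact: (@addsm_subr _ A^o _ _ isx1).
(* Otherwise the height hypothesis gives a chain of more than [nk] steps ending at [q], whereas
   Krull's theorem allows at most the number [nk] of elements of [x1]. *)
have nIq : ~ (prodI `<=` q).
  move=> Iq; have [|l nl [r rC rl]] := htI pq.
    by apply: (@addsm_min _ A^o) => //; exact: prime_ideal_ideal.
  have : (l <= size x1)%N.
    apply: (krull_height nA pq _ _ rC rl).
      by move=> c cx1; apply: x1q; exact: (@span_in _ A^o _ _ cx1).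
    move=> q' pq' cq' xq' q'q; apply: minq => //.
    by apply: (@addsm_min _ A^o) => //; [exact: prime_ideal_ideal|exact: span_prime].
  by rewrite size_x1 leqNgt nl.
have [w wI nqw] : exists2 w, (pw aa tI : set A) w & ~ q w.
  apply: contrapT => h; apply: nIq; apply: (prime_powI (e := tI) pq).
    by move=> w hw; apply: contrapT => nqw; apply: h; exists w.
  by rewrite /tI /trI eqxx.
have nqs : ~ q s by move=> /qp.
(* [s * w] sends [M] into (x1) M, so a power of it lies in (x1) + Ann M, hence in [q]. *)
have [|n [e be he]] := @nakayama _ _ [set: M] [set 0] (ideal_span x1) (s * w)
  submoduleT fgM submodule_set0 isx1.
  move=> u _; apply: addsm_subr => //; rewrite -scalerA; apply: hs.
  exact: mulsm_in.
have : q (s * w).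
  apply: (prime_idealX (n := n) pq); rewrite -[_ ^+ _](subrK e).
  apply: (idealD (prime_ideal_ideal pq)); last exact: x1q.
  by apply: annq => u; exact: he.
by case: pq => _ _ h /h[].
Qed.

Let E : set A := addsm (ideal_span x : set A^o) (annM : set A^o).

Let finE (K N : set M) : submodule K -> submodule N -> K `<=` N ->
  (forall r u, E r -> N u -> K (r *: u)) -> finite_length K N.
Proof.
move=> sK sN KN h; apply: (@finite_length_primes _ _ m) => //; first by case: locm.
move=> p pp hp; apply: prime_over_joint_reduction => //.
  move=> a aann; apply: hp => u Nu; apply: h => //.
  by apply: (@addsm_subr _ A^o) => //; exact: (@submodule_span _ A^o).
move=> a ax; apply: hp => u Nu; apply: h => //.
by apply: (@addsm_subl _ A^o) => //; exact: (@span_in _ A^o _ _ ax).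
Qed.

Let finJ n (K N : set M) : submodule K -> submodule N -> K `<=` N ->
  (forall r u, (idlX (aa jm) n : set A) r -> N u -> K (r *: u)) -> finite_length K N.
Proof.
move=> sK sN KN h; apply: (@finite_length_primes _ _ m) => //; first by case: locm.
move=> p pp hp; apply: prime_J => //; rewrite -aa_max.
by apply: (prime_idlX (n := n) pp) => r hr; apply: hp => u; exact: h.
Qed.

Let chain_bound l r : prime_chain annM l r -> (l <= (k0 + nk).+1)%N.
Proof.
rewrite -size_x; apply: (prime_chain_bound nA locm xm) => p pp annp xp.
exact: prime_over_joint_reduction.
Qed.

Lemma joint_reduction_parameters : system_of_parameters M m x.
Proof.
split=> //; last first.
  apply: finE => // r u [s sx [z zann <-]] _; rewrite scalerDl.
  apply: (submoduleD (submodule_mulsm _ _)); first exact: mulsm_in.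
  by rewrite (zann u : _ = 0); exact: (submodule0 (submodule_mulsm _ _)).
rewrite /module_dim size_x; split; last by move=> l [r /chain_bound].
(* [Ann M] also kills the quotient of [M] by [ann_infty], so a longest chain for that quotient is a
   chain for [M]; this gives the lower bound on dim M. *)
have [[r rC] _] := dimM; exists r; apply: prime_chain_sub rC => a aann u.
by exists 0%N => c _; rewrite (aann u : _ = 0) scaler0.
Qed.

Let F' g : set M := F (trI g).

Let gF' : gfam dn y F'.
Proof.
split=> [g|p g py|p g u py Fu]; first exact: sF.
  by apply: F_mono; apply: trI_mono; exact: mle_dn.
apply: (@F_mono (trI g) (madd (trI (dn p.2 g)) (unit_mi p.2))).
  by move=> j; rewrite /trI /madd /unit_mi /dn; case: (j == jm); lia.
by case: mF => _ _; apply => //; rewrite pw1; exact: ya.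
Qed.

Let gF : gfam dn y F. Proof. exact: (mfam_gfam ya mF). Qed.

Let FF' : gsub F F'. Proof. by move=> g; apply: F_mono; exact: trI_le. Qed.

Let gcls_sub0 (K N : ('I_D -> nat) -> set M) : (forall g, submodule (K g)) -> gcls E y K N.
Proof.
move=> sK r [s sx [z zann <-]]; exists z; first by rewrite xE addrK.
by move=> g u _; rewrite (zann u : _ = 0); exact: (submodule0 (sK g)).
Qed.

Let trI_dn g : trI (dn jm g) = trI g.
Proof. by apply: funext => j; rewrite /trI /dn; case: eqP => // _; rewrite subn0. Qed.

(** A prime above the annihilator of [M / F'] contains I, so a chain of more than [nk] steps ends at
    it. Placed below a chain of length [l], it gives at least [l + nk + 1] steps, and dim M is at
    most [k0 + nk + 1]; hence [l] is at most [k0]. *)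
Let quotient_vanish g : gsym dn y F' (fun=> [set: M]) g = 0.
Proof.
rewrite yE; apply: (@gsym_tail_vanish _ _ _ E finE nA nM jm); rewrite -?yE.
- by move=> p /mapP[b _ ->].
- exact: gF'.
- exact: gfam_cst.
- by [].
- by apply: gcls_sub0 => h; exact: sF.
- by move=> h; rewrite /F' trI_dn.
- by [].
move=> h l r rC; rewrite size_map size_max ltnS.
have [rP rS] := rC; have [pr cr] := rP 0%N (leq0n _).
have Ir : prodI `<=` r 0%N.
  apply: (prime_powI (e := trI h) pr); last by rewrite /trI eqxx.
  by move=> a ha; apply: cr => u _; exact: mulsm_in.
have annr : annM `<=` r 0%N.
  by move=> a ha; apply: cr => u _; rewrite (ha u : _ = 0); exact: (submodule0 (sF _)).
have [|l' nl' [r' rC' E']] := htI pr.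
  by apply: (@addsm_min _ A^o) => //; exact: prime_ideal_ideal.
have rC2 : prime_chain annM l r.
  apply: prime_chain_sub rC => a ha u _.
  by rewrite (ha u : _ = 0); exact: (submodule0 (sF _)).
have := chain_bound (prime_chain_cat rC' rC2 E'); lia.
Qed.

(** The joint reduction in degree [t] says that [pw t] sends [M] into [b M], where [b] is the degree
    [t] part of the ideal generated by [y]. The determinant trick splits each element of the
    (n+1)-st power of [pw t] into one of [b (pw t)^n] and one killing [M], as needed in degree
    [t' = (n+1) t]. *)
Let Fexact : exists b, forall g, mle (mcst b) g -> gsym dn y (fun=> [set 0]) F g = 0.
Proof.
have [n0 hn0] := jr_bound; pose t : 'I_D -> nat := mcst n0.+1.
have tn : mle (mcst n0) t by move=> j; exact: leqnSn.
pose b : idl A := Idl (wsum_ideal aa y t).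
have bt : b `<=` pw aa t by apply: wsum_sub.
have Fb : F t `<=` mulsm b [set: M].
  apply: hn0 => // i; rewrite /F /powfam -mulsm_mulid; apply: mulsm_mono => //.
  apply: mulid_min => [|a c aX ct]; first exact: wsum_ideal.
  suff h : ideal_span (X i) `<=` [set a | wsum aa y t (a * c)] by exact: h.
  apply: (@span_min _ A^o).
    split; first by rewrite /= mul0r; exact: ideal0 (wsum_ideal _ _ _).
    move=> z u v hu hv; rewrite /= mulrDl -[(z *: u) * c]/(z * u * c) -mulrA.
    by apply: (idealD (wsum_ideal _ _ _)) => //; exact: (idealMl _ (wsum_ideal _ _ _)).
  move=> e eX; apply: (wsum_in (i := i)) => //; apply/flattenP.
  by exists [seq (b, i) | b <- X i]; [apply: map_f; rewrite mem_enum|apply: map_f].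
have [s Ms] := fgM.
have [|n hn] := @nakayama_ideal _ _ s [set 0] b (pw aa t) submodule_set0 bt.
  rewrite -Ms => a u at_ _; apply: addsm_subr => //; apply: Fb; exact: mulsm_in.
pose t' : 'I_D -> nat := fun j => (t j * n.+1)%N.
apply: (@gsym_eventually0 _ _ _ aa nA nM y _ F t') => //.
- split=> [g|g h _ u //|e g r u _ /= ->]; [exact: submodule_set0|exact: scaler0].
- by move=> g u /= ->; exact: (submodule0 (sF g)).
- by exists 0%N => g; apply: F_mono => j; exact: leq_addr.
move=> r; rewrite -pwX => /hn[z [hz kz]]; exists z; last first.
  by move=> g u _; apply: kz; rewrite -Ms.
suff : idlM b (idlX (pw aa t) n) `<=` [set r | wsum aa y t' r] by exact.
rewrite pwX; apply: mulid_min => [|a c ba ct]; first exact: wsum_ideal.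
have -> : t' = madd t (fun j => (t j * n)%N) by apply: funext => j; rewrite /t' /madd mulnS.
exact: wsum_mul.
Qed.

Let H g : int := (mlength (F (up jm g)) (F g))%:Z.

Let y0 := y1 ++ [seq (b, jm) | b <- take k0 (X jm)].

Let y_rcons : y = rcons y0 (nth 0 (X jm) k0, jm).
Proof.
rewrite yE /y0 /y2 rcons_cat; congr (_ ++ _).
rewrite -[LHS](congr1 _ (take_size (X jm))) size_max (take_nth 0) ?size_max//.
by rewrite map_rcons.
Qed.

Let mult_symbol_gdiff : exists B, forall g, mle (mcst B) g ->
  mult_symbol x [set (0 : M)] [set: M] = gdiff dn y0 H g.
Proof.
have [b hb] := Fexact; exists (b + size y0).+1 => g hg.
have g0 : gfam dn y (fun=> [set (0 : M)]) by exact: gfam_cst.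
have gM : gfam dn y (fun=> [set: M]) by exact: gfam_cst.
have s00 (N : ('I_D -> nat) -> set M) : (forall h, submodule (N h)) -> gsub (fun=> [set 0]) N.
  by move=> sN h u /= ->; exact: (submodule0 (sN h)).
have bg : mle (mcst b) (up jm g) by move=> j; have := hg j; rewrite /mcst /up; lia.
(* The symbol of the constant families is the same in every degree; [up jm g] is chosen to cancel
   the shift [dn jm] left by the last difference. *)
have -> : mult_symbol x [set (0 : M)] [set: M] =
  gsym dn y (fun=> [set 0]) (fun=> [set: M]) (up jm g).
  by rewrite -xE; apply/esym/(gsym_cst (@dnC D)).
have s0F := s00 F sF; have s0F' : gsub (fun=> [set 0]) F' by apply: s00 => h; exact: sF.
rewrite (gsym_add (@dnC D) finE (L := F')) //; last by apply: gcls_sub0 => h; exact: submodule_set0.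
rewrite quotient_vanish addr0.
rewrite (gsym_add (@dnC D) finE (L := F)) //; last by apply: gcls_sub0 => h; exact: submodule_set0.
rewrite hb // add0r.
have fl h : finite_length (F h) (F' h).
  apply: (finJ (n := h jm) (sF h) (sF _) (@FF' h)) => r u hr Fu.
  by rewrite /F /powfam pw_trI idlMC mulsm_mulid; exact: mulsm_in.
rewrite (gsym_finite (@dnC D)) // y_rcons (gdiff_rcons (@dnC D)).
(* [F'] is the same in degrees [h] and [dn jm h], so the difference of the lengths of [F'/F] is that
   of [F (dn jm h)] over [F h]. *)
rewrite (gdiff_eventually (f' := fun h => H (dn jm h)) (b := b.+1)); first last.
- by move=> j; have := hg j; rewrite /mcst /up; lia.
- move=> h hh; have h0 : (0 < h jm)%N by exact: leq_trans (hh jm).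
  have E1 : F' (dn jm h) = F' h by rewrite /F' trI_dn.
  have sub1 : F h `<=` F (dn jm h) by apply: F_mono; exact: mle_dn.
  have sub2 : F (dn jm h) `<=` F' h by rewrite -E1; exact: FF'.
  rewrite E1 (mlength_add (sF h) (sF (dn jm h)) (sF _) sub1 sub2 (fl h)) PoszD addrK.
  by rewrite /H up_dn.
by rewrite (gdiff_shift (@dnC D)) dn_up.
Qed.

Let filtrationE n0 (n : 'I_d -> nat) : @filtration A M d J I n0 n = F (frcons n n0).
Proof.
have aJ : aa ord_max = Idl idJ by apply: idl_inj; exact: frcons_max.
have aI i : aa (widen_ord (leqnSn d) i) = bI i.
  by apply: idl_inj; rewrite widen_lift; exact: frcons_lift.
rewrite /filtration /F /powfam; congr (mulsm _ _).
rewrite /pw big_ord_recr /= frcons_max aJ mulidC; congr mulid; last by rewrite idlXE.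
rewrite (prodidE bI); congr idl_set; apply: eq_bigr => i _.
by rewrite aI widen_lift frcons_lift.
Qed.

Let up_frcons n0 (n : 'I_d -> nat) : up jm (frcons n n0) = frcons n n0.+1.
Proof.
apply: funext; apply: ord_maxP => [|i]; rewrite /up ?frcons_max ?frcons_lift ?eqxx ?addn1//.
by rewrite eq_sym (negPf (neq_lift _ _)) addn0.
Qed.

(** [hilbert_poly] is a choice among the polynomials with the required values, so one has to be
    exhibited. Generators of all the ideals are taken as [Y], which makes 0 a valid multiplier
    [z]. *)
Let epolyH : epoly H.
Proof.
have [gens hgens] : {gens : 'I_D -> seq A & forall i, aa i = ideal_span (gens i) :> set A}.
  apply: (@choice _ _ (fun i s => aa i = ideal_span s :> set A)) => i.
  exact: nA (idl_ideal (aa i)).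
pose Y := flatten [seq [seq (b, i) | b <- gens i] | i <- enum 'I_D].
have YP i b : b \in gens i -> (b, i) \in Y.
  move=> bi; apply/flattenP; exists [seq (b, i) | b <- gens i]; last exact: map_f.
  by apply: (map_f (fun i => [seq (b, i) | b <- gens i])); rewrite mem_enum.
have YA : coeffs_in aa Y.
  move=> p /flattenP[s /mapP[i _ ->] /mapP[b bi ->]]; rewrite -[_ _.1]/((aa i : set A) b) hgens.
  exact: (@span_in _ A^o _ _ bi).
have upF g : F (up jm g) `<=` F g by apply: F_mono => j; exact: leq_addr.
apply: (hilbert_serre nA nM YA (K := F \o up jm)) => //.
- have [_ dF mFF] := mF; split=> [g|g h gh|e g r u er Fu] /=; first exact: sF.
    by apply: dF => j; rewrite /up leq_add2r.
  have -> : up jm (madd g e) = madd (up jm g) e by apply: funext => j; rewrite /up /madd addnAC.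
  exact: mFF.
- by exists 0%N => g; apply: F_mono => j; exact: leq_addr.
- move=> g; apply: (finJ (n := 1) (sF _) (sF _) (upF g)) => r u; rewrite idlX1 => Jr Fu;
  rewrite /F /powfam.
  have -> : up jm g = madd (unit_mi jm) g by apply: funext => j; rewrite /up /madd addnC.
  by rewrite pwD pw1 mulsm_mulid; exact: mulsm_in.
move=> i r ir; exists 0; last by move=> g u _; rewrite scale0r; exact: (submodule0 (sF _)).
rewrite subr0; move: r ir; rewrite hgens; apply: (@span_min _ A^o).
  exact: (@submodule_span _ A^o).
move=> b bi; apply: (@span_in _ A^o); apply/mapP; exists (b, i) => //.
by rewrite mem_filter eqxx; exact: YP.
Qed.

(* The Hilbert polynomial has the variable of J first, joint reductions have J last. *)
Let r : 'I_D -> 'I_D := frcons (lift ord0) ord0.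
Let rho (T : Type) (w : 'I_D -> T) : 'I_D -> T := fcons (w jm) (fun i => w (lift jm i)).

Let rho_r T (w : 'I_D -> T) j : rho w (r j) = w j.
Proof.
by move: j; apply: ord_maxP => [|i]; rewrite /r /rho ?frcons_max ?frcons_lift ?fcons0 ?fcons_lift.
Qed.

Let r_surj j : exists i, j = r i.
Proof.
case: (unliftP ord0 j) => [i|] ->; first by exists (lift jm i); rewrite /r frcons_lift.
by exists jm; rewrite /r frcons_max.
Qed.

Let r_inj : injective r.
Proof. by move=> i j rij; rewrite -(rho_r id i) rij rho_r. Qed.

Let hilbert_polyP : is_hilbert_poly M J I (hilbert_poly M J I).
Proof.
apply: xgetPex; have [P [b hP]] := epolyH.
pose sub : D.-tuple {mpoly rat[D]} := [tuple 'X_(r j) | j < D].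
exists (P \mPo sub), b => n0 n bn0 bn.
rewrite !filtrationE -up_frcons; have := hP (frcons n n0).
rewrite /H -pmulrn => ->; last by apply: ord_maxP => [|i]; rewrite ?frcons_max ?frcons_lift.
rewrite comp_mpoly_meval; apply: meval_eq => j; rewrite tnth_mktuple mevalXU /nval.
by move: j; apply: ord_maxP => [|i]; rewrite /r ?frcons_max ?frcons_lift ?fcons0 ?fcons_lift.
Qed.

Let count_y0 i : count_mem i [seq p.2 | p <- y0] = frcons k k0 i.
Proof.
have : count_mem i [seq p.2 | p <- y] = frcons k k0.+1 i.
  case: jr => <- _ _; rewrite /y /colored map_flatten -map_comp count_flatten -map_comp.
  have cX j : count_mem i [seq p.2 | p <- [seq (b, j) | b <- X j]] = ((j == i) * size (X j))%N.
    by rewrite -map_comp; elim: (X j) => [|b s /= ->]; rewrite ?muln0//= mulnS.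
  rewrite sumnE big_map big_enum (eq_bigr _ (fun j _ => cX j)) (bigD1 i)//= eqxx mul1n.
  by rewrite big1 ?addn0// => j /negPf ->.
rewrite y_rcons map_rcons -cats1 count_cat /= addn0.
move: i; apply: ord_maxP => [|i]; rewrite ?frcons_max ?frcons_lift.
  by rewrite eqxx addn1 => -[].
by rewrite (negPf (neq_lift _ _)) addn0.
Qed.

Lemma mixed_mult_joint_reduction :
  mixed_mult M J I k0 k = (mult_symbol x [set (0 : M)] [set: M])%:~R.
Proof.
have [B hB] := mult_symbol_gdiff; have [N hN] := hilbert_polyP.
set P := hilbert_poly M J I in hN *.
have HP g : mle (mcst N) g -> (H g)%:~R = P.@[rho (nval g)].
  move=> gN; have gE : g = frcons (fun i => g (lift jm i)) (g jm).
    by apply: funext; apply: ord_maxP => [|i]; rewrite ?frcons_max ?frcons_lift.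
  rewrite /H {1 2}gE up_frcons -!filtrationE -pmulrn (hN _ _ (gN jm) (fun i => gN _)).
  by apply: meval_eq.
pose mm := [multinom fcons k0 k i | i < d.+1].
transitivity ((\prod_j (mm j)`!)%:R * P@_mm).
  by rewrite /mixed_mult -/P -/mm big_ord_recl mnmE fcons0; congr ((_ * _)%:R * _);
    apply: eq_bigr => i _; rewrite mnmE fcons_lift.
(* [B] serves the formula for the symbol and [N] the values of the Hilbert polynomial; the
   differences along [y0] may lower coordinates by [size y0]. *)
apply: (@mcoeff_of_vdiff _ P mm (map r [seq p.2 | p <- y0]) (B + (N + size y0))%N).
  move=> j; have [i ->] := r_surj j; rewrite count_map.
  rewrite (eq_count (a2 := pred1 i)) => [|i']; last by rewrite /= (inj_eq r_inj).
  by rewrite count_y0 mnmE -(rho_r (frcons k k0)) /rho frcons_max; congr fcons;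
    apply: funext => l; rewrite frcons_lift.
move=> g' hg'; pose g j := g' (r j).
have hg : mle (mcst (B + (N + size y0))%N) g by move=> j; exact: hg'.
have -> : nval g' = rho (nval g).
  by apply: funext => j; have [i ->] := r_surj j; rewrite rho_r.
rewrite -(vdiff_rename (rho := @rho rat)) => [|i w]; last first.
  by apply: funext => j; have [j' ->] := r_surj j; rewrite /vdn !rho_r (inj_eq r_inj).
rewrite -(gdiff_vdiff (y := y0) HP).
  by rewrite -hB // => j; apply: leq_trans (hg j); exact: leq_addr.
by move=> j; apply: leq_trans (hg j); exact: leq_addl.
Qed.

End JointReduction.

Theorem corollary3p5 (A : comNzRingType) (m : set A) (M : lmodType A)
    (J : set A) (d : nat) (I : 'I_d -> set A)
    (k0 : nat) (k : 'I_d -> nat) (X : 'I_d.+1 -> seq A) :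
  let prodI := prodid I (fun=> 1%N) in
  let annM := ann [set (0 : M)] in
  let x := flatten [seq X i | i <- enum 'I_d.+1] in
  noetherian A -> local_ring m -> infinite_residue m ->
  fin_gen [set: M] ->
  m_primary m J ->
  (0 < d)%N -> (forall i, ideal (I i)) ->
  ~ (prodI `<=` radical annM) ->
  module_dim (ann_infty M prodI) (k0 + \sum_(i < d) k i).+1 ->
  joint_reduction M (frcons I J) (frcons k k0.+1) X ->
  {in x, forall a, m a} ->
  height_gt annM (addsm (prodI : set A^o) (annM : set A^o)) (\sum_(i < d) k i) ->
  system_of_parameters M m x /\
  mixed_mult M J I k0 k = (mult_symbol x [set (0 : M)] [set: M])%:~R.
Proof.
move=> prodI annM x nA locm _ fgM Jprim _ idI _ dimM jr xm htI; split.
  exact: joint_reduction_parameters nA locm fgM Jprim idI dimM jr xm htI.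
exact: mixed_mult_joint_reduction nA locm fgM Jprim idI jr xm htI.
Qed.
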